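(* For all $z$ with $0<|z|\le 1$, \[ \sum_{k=1}^\infty\frac{(-1)^{k-1}\zeta(2k)z^{2k}}{(2k+1)(k+1)} = -\frac12-\frac{\pi z}{6}-\frac{\pi}{12z}-\frac{\zeta(3)}{2\pi^2z^2}+\frac{\operatorname{Li}_3(e^{2\pi z})}{2\pi^2z^2}-\frac{\operatorname{Li}_2(e^{2\pi z})}{2\pi z}. \]
   Context: $\zeta$ is the Riemann zeta function. $\operatorname{Li}_s(x)=\sum_{k\ge1}x^k/k^s$ is the polylogarithm (analytically continued to the complex plane). *)

(* Defs.v *)
From Stdlib Require Import Reals.
From Coquelicot Require Import Coquelicot.
Open Scope R_scope.

Definition zeta (s : nat) : R := Series (fun n : nat => / (INR (S n)) ^ s).

Definition cexp (z : C) : C :=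
  (exp (Re z) * cos (Im z), exp (Re z) * sin (Im z)).

Definition on_cut (x : C) : Prop := Im x = 0 /\ 1 <= Re x.

(* L is the polylogarithm Li_s: it is given by the series sum_{k>=1} x^k/k^s
   on the closed unit disk (where the series converges for s >= 2), it is
   holomorphic (complex differentiable) on the slit plane C \ [1,+oo)
   (so it is the analytic continuation of the series there), and on the cut
   x > 1 it takes the boundary value from the lower half-plane
   (principal-branch convention, continuous from below like -Log(1-x)). *)
Definition is_polylog (s : nat) (L : C -> C) : Prop :=
  (forall x : C, Cmod x <= 1 ->
     is_series (fun k : nat => (x ^ (S k) / RtoC (INR (S k) ^ s))%C) (L x)) /\
  (forall x : C, ~ on_cut x -> @ex_derive C_AbsRing C_NormedModule L x) /\
  (forall x : C, Im x = 0 -> 1 < Re x ->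
     filterlim L (within (fun w : C => Im w < 0) (locally x)) (locally (L x))).

Definition thm14_term (z : C) (k : nat) : C :=
  (RtoC ((-1) ^ (k - 1) * zeta (2 * k)) * z ^ (2 * k)
     / RtoC ((2 * INR k + 1) * (INR k + 1)))%C.

(* Main.v *)
(** Multiplied by [(2 pi z)^2], and with [w = 2 pi z], the identity says that
    [D(w) = 2 Li_3(e^w) - w Li_2(e^w) - 2 zeta(3) - pi^2 w / 6 - w^2 / 2 - w^3 / 12 - w^2 S(w / (2 pi))]
    vanishes, where [S] is the series on the left. For [w = - t < 0] everything is real:
    differentiating twice in [t] turns the polylogarithms into elementary functions, and [D'' = 0]
    becomes the partial fraction expansion of [coth (t / 2)], obtained from the duplication formula
    of [coth] by dominated convergence. Both [D] and [D'] tend to [0] at [0], the latter because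
    [zeta(2) = pi^2 / 6], which is also read off the expansion of [coth].

    A polylogarithm is only assumed to be complex differentiable off the cut, so the passage to the
    upper and lower half disks needs unique continuation from the negative real axis. Goursat's
    theorem gives a second primitive of the function to be shown zero; a primitive of this kind
    satisfies the maximum principle, and comparing it with a weight [exp (N exp (- M w))] as [N]
    grows forces it to vanish. The unit circle and the real points [z > 0], which lie over the cut,
    are reached by limits, in the second case from [Im z < 0]. *)

Require Import Defs.
From Stdlib Require Import Arith Reals Lra Lia Psatz Classical ClassicalEpsilon.
From Coquelicot Require Import Coquelicot.
Open Scope R_scope.

(** * Complex derivatives *)

(** Differentiability at every point says nothing about continuity of the derivative, whereas the
    maximum principle for [|h|^2] rests on a Laplacian. Integrating twice exchanges the roles: the
    given function becomes a second derivative, and neither Cauchy's integral formula nor power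
    series at arbitrary centres are called for. All contours are rectangles, so that integrals over
    real intervals suffice; an exponential substitution turns each half disk into a strip, where
    rectangles fit.

    The growth argument replaces the usual propagation of zeros: the zeros fill one side of a
    rectangle, and the weight at an interior point exceeds its values on the other three sides by a
    factor that is unbounded in [N].

    At [w = 0] the value [e^w] is the branch point 1, and [D'] contains [t Li_1(e^(-t))], of order
    [t log t]. Hence both constants of integration are found from one-sided limits rather than from
    values at 0. *)

Notation is_Cderive := (@is_derive C_AbsRing C_NormedModule).

(** Balls of the product structure on [C] are squares; [locally_C] passes to discs of the
    modulus. *)
Lemma locally_Cmod (z : C) (P : C -> Prop) :
  locally z P <-> exists d, 0 < d /\ forall w, Cmod (w - z) < d -> P w.
Proof.
  rewrite locally_C. split.
  - intros [d Hd]. exists d. split; [apply cond_pos|]. intros w Hw. apply Hd. exact Hw.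
  - intros [d [Hd H]]. exists (mkposreal d Hd). intros w Hw. apply H. exact Hw.
Qed.

Lemma is_Cderive_eps (f : C -> C) (z l : C) :
  is_Cderive f z l <->
  forall eps, 0 < eps -> exists d, 0 < d /\ forall w, Cmod (w - z) < d ->
    Cmod (f w - f z - (w - z) * l) <= eps * Cmod (w - z).
Proof.
  split.
  - intros [_ H] eps Heps.
    specialize (H z (fun P HP => HP) (mkposreal eps Heps)).
    apply locally_Cmod. apply locally_C. exact H.
  - intros H. split.
    + apply is_linear_scal_l.
    + intros x Hx eps.
      assert (Hzx : z = x).
      { apply (is_filter_lim_locally_unique (V := AbsRing_NormedModule C_AbsRing)). exact Hx. }
      subst x.
      destruct (H eps (cond_pos eps)) as [d [Hd Hw]].
      apply (locally_C z). apply locally_Cmod. exists d. split; [exact Hd|exact Hw].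
Qed.

Lemma is_Cderive_ext (f g : C -> C) (z l : C) :
  (forall w, f w = g w) -> is_Cderive f z l -> is_Cderive g z l.
Proof. intros He Hf. now apply (is_derive_ext f). Qed.

Lemma is_Cderive_const (c z : C) : is_Cderive (fun _ => c) z (RtoC 0).
Proof. exact (is_derive_const c z). Qed.

Lemma is_Cderive_id (z : C) : is_Cderive (fun w => w) z (RtoC 1).
Proof.
  apply is_Cderive_eps. intros eps He. exists 1. split; [lra|]. intros w _.
  replace (w - z - (w - z) * RtoC 1)%C with (RtoC 0) by ring.
  rewrite Cmod_0. apply Rmult_le_pos; [lra|apply Cmod_ge_0].
Qed.

Lemma is_Cderive_plus (f g : C -> C) (z a b : C) :
  is_Cderive f z a -> is_Cderive g z b -> is_Cderive (fun w => f w + g w)%C z (a + b)%C.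
Proof. exact (is_derive_plus f g z a b). Qed.

Lemma is_Cderive_opp (f : C -> C) (z a : C) :
  is_Cderive f z a -> is_Cderive (fun w => - f w)%C z (- a)%C.
Proof. exact (is_derive_opp f z a). Qed.

Lemma is_Cderive_minus (f g : C -> C) (z a b : C) :
  is_Cderive f z a -> is_Cderive g z b -> is_Cderive (fun w => f w - g w)%C z (a - b)%C.
Proof. exact (is_derive_minus f g z a b). Qed.

(** [C] carries two structures of normed module over itself; the product rule and the inner function
    of the chain rule are stated for the one that comes from the ring. *)
Lemma is_Cderive_AbsRing (f : C -> C) (z l : C) :
  is_Cderive f z l <-> @is_derive C_AbsRing (AbsRing_NormedModule C_AbsRing) f z l.
Proof.
  split; intros [Hl H]; (split; [apply is_linear_scal_l | exact H]).
Qed.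

Lemma is_Cderive_mult (f g : C -> C) (z a b : C) :
  is_Cderive f z a -> is_Cderive g z b ->
  is_Cderive (fun w => f w * g w)%C z (a * g z + f z * b)%C.
Proof.
  rewrite !is_Cderive_AbsRing. intros Hf Hg.
  exact (is_derive_mult f g z a b Hf Hg Cmult_comm).
Qed.

Lemma is_Cderive_comp (f g : C -> C) (z a b : C) :
  is_Cderive f (g z) a -> is_Cderive g z b -> is_Cderive (fun w => f (g w)) z (b * a)%C.
Proof.
  rewrite (is_Cderive_AbsRing g). intros Hf Hg.
  exact (is_derive_comp f g z a b Hf Hg).
Qed.

Lemma is_Cderive_eq (f : C -> C) (z a b : C) : a = b -> is_Cderive f z a -> is_Cderive f z b.
Proof. now intros ->. Qed.

Lemma is_Cderive_continuous (f : C -> C) (z l : C) : is_Cderive f z l ->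
  filterlim f (locally z) (locally (f z)).
Proof.
  intros H. apply filterlim_locally. intros eps.
  destruct (proj1 (is_Cderive_eps f z l) H 1 Rlt_0_1) as [d [Hd Hw]].
  apply locally_Cmod.
  assert (Hl := Cmod_ge_0 l).
  exists (Rmin d (eps / (2 + Cmod l))). split.
  { apply Rmin_glb_lt; [lra|]. apply Rdiv_lt_0_compat; [apply cond_pos|lra]. }
  intros w Hwz.
  assert (H1 := Hw w (Rlt_le_trans _ _ _ Hwz (Rmin_l _ _))).
  assert (H2 := Rlt_le_trans _ _ _ Hwz (Rmin_r _ _)).
  apply C_NormedModule_mixin_compat1.
  change (minus (f w) (f z)) with (f w - f z)%C.
  replace (f w - f z)%C with ((f w - f z - (w - z) * l) + (w - z) * l)%C by ring.
  eapply Rle_lt_trans; [apply Cmod_triangle|]. rewrite Cmod_mult.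
  assert (H3 : Cmod (w - z) * (2 + Cmod l) < eps).
  { apply Rlt_le_trans with (eps / (2 + Cmod l) * (2 + Cmod l)).
    - apply Rmult_lt_compat_r; lra.
    - right. field. lra. }
  assert (H4 := Cmod_ge_0 (w - z)). nra.
Qed.

Lemma Cexp_0 : cexp 0 = RtoC 1.
Proof. unfold cexp; simpl. rewrite exp_0, cos_0, sin_0. apply injective_projections; simpl; ring. Qed.

Lemma Cexp_plus (a b : C) : cexp (a + b) = (cexp a * cexp b)%C.
Proof.
  destruct a as [a1 a2], b as [b1 b2]. unfold cexp, Cmult, Cplus, Re, Im; simpl.
  rewrite exp_plus, cos_plus, sin_plus. apply injective_projections; simpl; ring.
Qed.

Lemma Cmod_cexp (z : C) : Cmod (cexp z) = exp (Re z).
Proof.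
  unfold cexp, Cmod; simpl.
  replace (exp (Re z) * cos (Im z) * (exp (Re z) * cos (Im z) * 1) +
     exp (Re z) * sin (Im z) * (exp (Re z) * sin (Im z) * 1)) with
   (exp (Re z) ^2 * (Rsqr (sin (Im z)) + Rsqr (cos (Im z)))) by (unfold Rsqr; ring).
  rewrite sin2_cos2, Rmult_1_r. apply sqrt_pow2. left; apply exp_pos.
Qed.

Lemma Cmod_le_abs (z : C) : Cmod z <= Rabs (Re z) + Rabs (Im z).
Proof.
  destruct z as [x y]. simpl.
  replace (x, y) with (RtoC x + Ci * RtoC y)%C
    by (apply injective_projections; simpl; ring).
  eapply Rle_trans; [apply Cmod_triangle|].
  rewrite Cmod_mult, !Cmod_R, Cmod_Ci. lra.
Qed.

Lemma im_le_Cmod (z : C) : Rabs (Im z) <= Cmod z.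
Proof. eapply Rle_trans; [apply Rmax_r|apply Rmax_Cmod]. Qed.

Lemma is_derive_eps (f : R -> R) (x l : R) : is_derive f x l ->
  forall eps, 0 < eps -> exists d, 0 < d /\ forall y, Rabs (y - x) < d ->
    Rabs (f y - f x - (y - x) * l) <= eps * Rabs (y - x).
Proof.
  intros [_ H] eps He.
  destruct (H x (fun P HP => HP) (mkposreal eps He)) as [d Hd].
  exists d. split; [apply cond_pos|]. intros y Hy. apply (Hd y). exact Hy.
Qed.

Lemma is_Cderive_cexp_0 : is_Cderive cexp (RtoC 0) (RtoC 1).
Proof.
  apply is_Cderive_eps. intros eps He.
  assert (D1 : is_derive exp 0 1) by (auto_derive; [exact I|rewrite exp_0; ring]).
  assert (D2 : is_derive cos 0 0) by (auto_derive; [exact I|rewrite sin_0; ring]).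
  assert (D3 : is_derive sin 0 1) by (auto_derive; [exact I|rewrite cos_0; ring]).
  (* The remainders [E], [K], [S] of exp, cos and sin will contribute at most [9 e |w|] in all;
     [e <= 1] and [|w| < e] keep [|1 + x + E|] below 3. *)
  set (e := Rmin 1 (eps / 12)).
  assert (He0 : 0 < e) by (apply Rmin_glb_lt; lra).
  assert (He1 : e <= 1) by apply Rmin_l.
  assert (He2 : e <= eps / 12) by apply Rmin_r.
  destruct (is_derive_eps _ _ _ D1 e He0) as [d1 [Hd1 H1]].
  destruct (is_derive_eps _ _ _ D2 e He0) as [d2 [Hd2 H2]].
  destruct (is_derive_eps _ _ _ D3 e He0) as [d3 [Hd3 H3]].
  exists (Rmin e (Rmin d1 (Rmin d2 d3))). split.
  { repeat apply Rmin_glb_lt; lra. }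
  intros w Hw. rewrite Cexp_0.
  replace (w - 0)%C with w in * by ring.
  destruct w as [x y].
  assert (Hx : Rabs x <= Cmod (x, y)) by apply (re_le_Cmod (x, y)).
  assert (Hy : Rabs y <= Cmod (x, y)) by apply (im_le_Cmod (x, y)).
  assert (L0 := Rlt_le_trans _ _ _ Hw (Rmin_l _ _)).
  assert (L1 := Rlt_le_trans _ _ _ Hw (Rmin_r _ _)).
  assert (L2 := Rlt_le_trans _ _ _ L1 (Rmin_l _ _)).
  assert (L3 := Rlt_le_trans _ _ _ L1 (Rmin_r _ _)).
  assert (L4 := Rlt_le_trans _ _ _ L3 (Rmin_l _ _)).
  assert (L5 := Rlt_le_trans _ _ _ L3 (Rmin_r _ _)).
  specialize (H1 x). specialize (H2 y). specialize (H3 y).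
  rewrite Rminus_0_r in H1, H2, H3.
  specialize (H1 ltac:(lra)). specialize (H2 ltac:(lra)). specialize (H3 ltac:(lra)).
  rewrite exp_0 in H1. rewrite cos_0 in H2. rewrite sin_0 in H3.
  set (E := exp x - 1 - x * 1) in *. set (K := cos y - 1 - y * 0) in *.
  set (S := sin y - 0 - y * 1) in *.
  set (m := Cmod (x, y)) in *.
  assert (EE : Rabs E <= e * m) by nra. assert (KK : Rabs K <= e * m) by nra.
  assert (SS : Rabs S <= e * m) by nra.
  eapply Rle_trans; [apply Cmod_le_abs|].
  unfold cexp; simpl.
  replace (exp x * cos y + - (1) + - (x * 1 - y * 0)) with (E + (1 + x + E) * K)
    by (unfold E, K; ring).
  replace (exp x * sin y + - 0 + - (x * 0 + y * 1)) with ((x + E) * y + (1 + x + E) * S)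
    by (unfold E, S; ring).
  assert (Hm0 : 0 <= m) by apply Cmod_ge_0.
  assert (B1 : Rabs (1 + x + E) <= 3).
  { eapply Rle_trans; [apply Rabs_triang|]. assert (Q := Rabs_triang 1 x).
    rewrite Rabs_R1 in Q. nra. }
  assert (B2 : Rabs (x + E) <= 2 * m).
  { eapply Rle_trans; [apply Rabs_triang|]. nra. }
  assert (T1 := Rabs_triang E ((1 + x + E) * K)).
  assert (T2 := Rabs_triang ((x + E) * y) ((1 + x + E) * S)).
  rewrite Rabs_mult in T1, T2. rewrite Rabs_mult in T2.
  assert (P1 := Rabs_pos (1 + x + E)). assert (P2 := Rabs_pos K).
  assert (P3 := Rabs_pos S). assert (P4 := Rabs_pos y). assert (P5 := Rabs_pos (x + E)).
  assert (M1 : Rabs (1 + x + E) * Rabs K <= 3 * (e * m)) by (apply Rmult_le_compat; assumption).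
  assert (M2 : Rabs (1 + x + E) * Rabs S <= 3 * (e * m)) by (apply Rmult_le_compat; assumption).
  assert (M3 : Rabs (x + E) * Rabs y <= (2 * m) * e) by (apply Rmult_le_compat; try assumption; lra).
  assert (M4 : e * m <= eps / 12 * m) by (apply Rmult_le_compat_r; assumption).
  lra.
Qed.

(** The functional equation carries the derivative at 0 to every point. *)
Lemma is_Cderive_cexp (z : C) : is_Cderive cexp z (cexp z).
Proof.
  apply (is_Cderive_ext (fun w => cexp z * cexp (w - z))%C).
  { intros w. rewrite <- Cexp_plus. f_equal. ring. }
  eapply is_Cderive_eq; [|apply is_Cderive_mult;
    [apply is_Cderive_const|apply (is_Cderive_comp cexp (fun w => w - z)%C z (RtoC 1));
      [|apply is_Cderive_minus; [apply is_Cderive_id|apply is_Cderive_const]]]].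
  - cbv beta. ring.
  - replace (z - z)%C with (RtoC 0) by ring. exact is_Cderive_cexp_0.
Qed.

(** * Maximum principle on rectangles *)

Lemma nested_halving (B : R) (x : nat -> R) :
  (forall n, x n <= x (S n)) ->
  (forall n, x (S n) + B / 2 ^ (S n) <= x n + B / 2 ^ n) -> 0 <= B ->
  exists p, forall n, x n <= p <= x n + B / 2 ^ n.
Proof.
  intros Hu Hd HB.
  assert (Hpos : forall n, 0 <= B / 2 ^ n).
  { intros n. apply Rdiv_le_0_compat; [exact HB|]. apply pow_lt. lra. }
  assert (Hmu : forall m n, (m <= n)%nat -> x m <= x n).
  { intros m n Hmn. induction Hmn; [lra|]. specialize (Hu m0). lra. }
  assert (Hmd : forall m n, (m <= n)%nat -> x n + B / 2 ^ n <= x m + B / 2 ^ m).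
  { intros m n Hmn. induction Hmn; [lra|]. specialize (Hd m0). lra. }
  assert (Hub : forall n m, x m <= x n + B / 2 ^ n).
  { intros n m. destruct (Nat.le_ge_cases n m) as [H|H].
    - specialize (Hmd _ _ H). specialize (Hpos m). lra.
    - specialize (Hmu _ _ H). specialize (Hpos n). lra. }
  destruct (completeness (fun r => exists n, r = x n)) as [p [Hp1 Hp2]].
  - exists (x O + B / 2 ^ 0). intros r [n ->]. apply Hub.
  - exists (x O). now exists O.
  - exists p. intros n. split.
    + apply Hp1. now exists n.
    + apply Hp2. intros r [m ->]. apply Hub.
Qed.

(* [P n x y] speaks about the rectangle with lower left corner [(x, y)] and sides
   [B / 2^n], [H / 2^n]. *)
Lemma bisection (B H x0 y0 : R) (P : nat -> R -> R -> Prop) :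
  0 <= B -> 0 <= H ->
  (forall n x y, P (S n) x y -> P (S n) (x + B / 2 ^ S n) y ->
     P (S n) x (y + H / 2 ^ S n) -> P (S n) (x + B / 2 ^ S n) (y + H / 2 ^ S n) ->
     P n x y) ->
  (forall p q, x0 <= p <= x0 + B -> y0 <= q <= y0 + H ->
     exists d, 0 < d /\ forall n x y,
       x0 <= x -> x + B / 2 ^ n <= x0 + B -> y0 <= y -> y + H / 2 ^ n <= y0 + H ->
       x <= p <= x + B / 2 ^ n -> y <= q <= y + H / 2 ^ n ->
       B / 2 ^ n < d -> H / 2 ^ n < d -> P n x y) ->
  P O x0 y0.
Proof.
  intros HB HH Hq Hloc. apply NNPP. intros HN.
  (* [nxt] selects a quarter on which [P] fails: if the first three satisfy [P], the fourth cannot.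
     The selected rectangles shrink to a point [(p, q)], at which the local hypothesis gives the
     contradiction. *)
  set (nxt := fun (n : nat) (z : R * R) =>
    let (x, y) := z in
    if excluded_middle_informative (P (S n) x y) then
      if excluded_middle_informative (P (S n) (x + B / 2 ^ S n) y) then
        if excluded_middle_informative (P (S n) x (y + H / 2 ^ S n)) then
          (x + B / 2 ^ S n, y + H / 2 ^ S n)
        else (x, y + H / 2 ^ S n)
      else (x + B / 2 ^ S n, y)
    else (x, y)).
  set (u := fix u (n : nat) : R * R := match n with O => (x0, y0) | S m => nxt m (u m) end).
  assert (HP : forall n, ~ P n (fst (u n)) (snd (u n))).
  { induction n as [|n IH]; [exact HN|].
    change (u (S n)) with (nxt n (u n)). destruct (u n) as [x y]. simpl in IH.
    unfold nxt.
    repeat destruct excluded_middle_informative; simpl; try assumption.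
    intros H4. apply IH. now apply Hq. }
  assert (Hh : forall (D : R) n, D / 2 ^ n = D / 2 ^ S n + D / 2 ^ S n).
  { intros D n. simpl. field. apply pow_nonzero. lra. }
  assert (Hpos : forall D n, 0 <= D -> 0 <= D / 2 ^ n).
  { intros D n HD. apply Rdiv_le_0_compat; [exact HD|]. apply pow_lt. lra. }
  assert (Hstep : forall n,
    (fst (u n) <= fst (u (S n)) /\
     fst (u (S n)) + B / 2 ^ S n <= fst (u n) + B / 2 ^ n) /\
    (snd (u n) <= snd (u (S n)) /\
     snd (u (S n)) + H / 2 ^ S n <= snd (u n) + H / 2 ^ n)).
  { intros n. change (u (S n)) with (nxt n (u n)). destruct (u n) as [x y].
    assert (E1 := Hh B n). assert (E2 := Hh H n).
    assert (E3 := Hpos B (S n) HB). assert (E4 := Hpos H (S n) HH).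
    unfold nxt.
    repeat destruct excluded_middle_informative; cbn [fst snd]; lra. }
  destruct (nested_halving B (fun n => fst (u n))) as [p Hp];
    [intros n; apply Hstep|intros n; apply Hstep|exact HB|].
  destruct (nested_halving H (fun n => snd (u n))) as [q Hqq];
    [intros n; apply Hstep|intros n; apply Hstep|exact HH|].
  cbv beta in Hp, Hqq.
  assert (Hin : forall n, (x0 <= fst (u n) /\ fst (u n) + B / 2 ^ n <= x0 + B) /\
     (y0 <= snd (u n) /\ snd (u n) + H / 2 ^ n <= y0 + H)).
  { induction n as [|n IH].
    - simpl. lra.
    - specialize (Hstep n). lra. }
  assert (Hp0 := Hp O). assert (Hq0 := Hqq O). simpl in Hp0, Hq0.
  destruct (Hloc p q) as [d [Hd Hl]]; [lra|lra|].
  assert (Hlim : exists n, forall D, 0 <= D <= B + H -> D / 2 ^ n < d).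
  { destruct (pow_lt_1_zero (/ 2)) with (y := d / (B + H + 1)) as [n Hn].
    - rewrite Rabs_pos_eq; lra.
    - apply Rdiv_lt_0_compat; lra.
    - exists n. intros D HD. specialize (Hn n (Nat.le_refl n)).
      rewrite Rabs_pos_eq in Hn by (apply pow_le; lra).
      rewrite pow_inv in Hn.
      assert (0 < / 2 ^ n) by (apply Rinv_0_lt_compat, pow_lt; lra).
      apply Rmult_lt_compat_r with (r := B + H + 1) in Hn; [|lra].
      replace (d / (B + H + 1) * (B + H + 1)) with d in Hn by (field; lra).
      unfold Rdiv. nra. }
  destruct Hlim as [n Hn].
  destruct (Hin n) as [[I1 I2] [I3 I4]].
  apply (HP n). apply Hl; try assumption; try apply Hn; try lra; [apply Hp|apply Hqq].
Qed.

(** Without a maximum, every point has a neighbourhood on which [g] stays below some value of [g].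
    Bisection extends this to the whole rectangle, and the resulting value of [g] would be less than
    itself. *)
Lemma continuous_rectangle_max (g : R -> R -> R) (a b c d : R) :
  a <= b -> c <= d ->
  (forall p q, a <= p <= b -> c <= q <= d -> continuity_2d_pt g p q) ->
  exists p q, a <= p <= b /\ c <= q <= d /\
    forall x y, a <= x <= b -> c <= y <= d -> g x y <= g p q.
Proof.
  intros Hab Hcd Hc. apply NNPP. intros HN.
  assert (HN' : forall p q, a <= p <= b -> c <= q <= d ->
    exists x y, a <= x <= b /\ c <= y <= d /\ g p q < g x y).
  { intros p q Hp Hq. apply NNPP. intros HN2. apply HN. exists p, q.
    split; [exact Hp|]. split; [exact Hq|]. intros x y Hx Hy.
    apply Rnot_lt_le. intros Hlt. apply HN2. now exists x, y. }
  set (P := fun (n : nat) x y => exists p q, a <= p <= b /\ c <= q <= d /\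
     forall s t, x <= s <= x + (b - a) / 2 ^ n -> y <= t <= y + (d - c) / 2 ^ n ->
       g s t < g p q).
  assert (HP : P O a c).
  { apply (bisection (b - a) (d - c)); [lra|lra| |].
    - intros n x y [p1 [q1 [A1 [B1 C1]]]] [p2 [q2 [A2 [B2 C2]]]]
        [p3 [q3 [A3 [B3 C3]]]] [p4 [q4 [A4 [B4 C4]]]].
      assert (Hm : exists p q, a <= p <= b /\ c <= q <= d /\ g p1 q1 <= g p q /\
        g p2 q2 <= g p q /\ g p3 q3 <= g p q /\ g p4 q4 <= g p q).
      { set (m1 := if Rle_dec (g p1 q1) (g p2 q2) then (p2, q2) else (p1, q1)).
        set (m2 := if Rle_dec (g p3 q3) (g p4 q4) then (p4, q4) else (p3, q3)).
        set (m := if Rle_dec (g (fst m1) (snd m1)) (g (fst m2) (snd m2)) then m2 else m1).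
        exists (fst m), (snd m). unfold m. unfold m1, m2.
        repeat destruct Rle_dec; simpl in *; lra. }
      destruct Hm as [p [q [A [B [C1' [C2' [C3' C4']]]]]]].
      exists p, q. split; [exact A|]. split; [exact B|].
      assert (Hh : forall (D : R), D / 2 ^ n = D / 2 ^ S n + D / 2 ^ S n).
      { intros D. simpl. field. apply pow_nonzero. lra. }
      rewrite (Hh (b - a)), (Hh (d - c)). intros s t Hs Ht.
      destruct (Rle_dec s (x + (b - a) / 2 ^ S n)) as [L1|L1];
      destruct (Rle_dec t (y + (d - c) / 2 ^ S n)) as [L2|L2].
      + eapply Rlt_le_trans; [apply C1; lra|lra].
      + eapply Rlt_le_trans; [apply C3; lra|lra].
      + eapply Rlt_le_trans; [apply C2; lra|lra].
      + eapply Rlt_le_trans; [apply C4; lra|lra].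
    - intros p q Hp Hq.
      destruct (HN' p q) as [x [y [Hx [Hy Hlt]]]]; [lra|lra|].
      assert (He : 0 < g x y - g p q) by lra.
      destruct (Hc p q ltac:(lra) ltac:(lra) (mkposreal _ He)) as [de Hde]. simpl in Hde.
      exists de. split; [apply cond_pos|].
      intros n x' y' _ _ _ _ Hx' Hy' Hb Hd.
      exists x, y. split; [exact Hx|]. split; [exact Hy|].
      intros s t Hs Ht.
      assert (Habs := Hde s t).
      assert (Rabs (g s t - g p q) < g x y - g p q).
      { apply Habs; apply Rabs_def1; lra. }
      apply Rabs_def2 in H. lra. }
  destruct HP as [p [q [Hp [Hq Hall]]]].
  specialize (Hall p q). simpl in Hall. rewrite !Rdiv_1_r in Hall.
  assert (g p q < g p q) by (apply Hall; lra). lra.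
Qed.

Lemma second_derivative_max (q q1 : R -> R) (q2 r : R) :
  0 < r -> (forall t, -r < t < r -> is_derive q t (q1 t)) -> is_derive q1 0 q2 ->
  (forall t, -r < t < r -> q t <= q 0) -> q2 <= 0.
Proof.
  intros Hr H1 H2 Hmax. apply Rnot_lt_le. intros Hq.
  destruct (is_derive_eps _ _ _ H2 (q2 / 2) ltac:(lra)) as [d [Hd He]].
  set (s := Rmin d r / 2).
  assert (Hs : 0 < s /\ s < d /\ s < r).
  { assert (Rmin d r <= d) by apply Rmin_l. assert (Rmin d r <= r) by apply Rmin_r.
    assert (0 < Rmin d r) by (apply Rmin_glb_lt; lra). unfold s. lra. }
  assert (Hd1 : forall t, Rabs t < d -> Rabs (q1 t - q1 0 - t * q2) <= q2 / 2 * Rabs t).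
  { intros t Ht. specialize (He t). rewrite Rminus_0_r in He. now apply He. }
  assert (Hmvt : forall u v, - r < u < v -> v < r ->
    exists c, u <= c <= v /\ q v - q u = q1 c * (v - u)).
  { intros u v Huv Hv. destruct (MVT_gen q u v q1) as [c Hc].
    - intros x. rewrite Rmin_left, Rmax_right by lra. intros Hx. apply H1. lra.
    - intros x. rewrite Rmin_left, Rmax_right by lra. intros Hx.
      apply continuity_pt_filterlim. apply (ex_derive_continuous q).
      eexists. apply H1. lra.
    - rewrite Rmin_left, Rmax_right in Hc by lra. now exists c. }
  (* As [q2] is positive, [q1] exceeds [q1 0] just right of 0 and is below it just left of 0.
     Whatever the sign of [q1 0], [q] rises above [q 0] on one of the two sides. *)
  destruct (Rle_dec 0 (q1 0)) as [L|L].
  - assert (Hm : forall c, 0 < c <= s -> 0 < q1 c).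
    { intros c Hc. specialize (Hd1 c). rewrite Rabs_pos_eq in Hd1 by lra.
      specialize (Hd1 ltac:(lra)). apply Rabs_le_between in Hd1. nra. }
    (* The mean value point may be an endpoint, and [q1] may vanish at 0; the second half of the
       interval supplies the strict increase. *)
    destruct (Hmvt 0 (s / 2)) as [c [Hc Hqc]]; [lra|lra|].
    destruct (Hmvt (s / 2) s) as [c' [Hc' Hqc']]; [lra|lra|].
    assert (0 < q1 c') by (apply Hm; lra).
    assert (0 <= q1 c).
    { destruct (Req_dec c 0) as [->|Hc0]; [exact L|]. left. apply Hm. lra. }
    assert (q s <= q 0) by (apply Hmax; lra). nra.
  - destruct (Hmvt (- s) 0) as [c [Hc Hqc]]; [lra|lra|].
    assert (q1 c < 0).
    { destruct (Req_dec c 0) as [->|Hc0]; [lra|].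
      specialize (Hd1 c). rewrite Rabs_left in Hd1 by lra.
      specialize (Hd1 ltac:(lra)). apply Rabs_le_between in Hd1. nra. }
    assert (q (- s) <= q 0) by (apply Hmax; lra). nra.
Qed.

Lemma is_derive_line (f : C -> C) (z v l : C) (t0 : R) :
  is_Cderive f (z + RtoC t0 * v)%C l ->
  is_derive (V := C_R_NormedModule) (fun t : R => f (z + RtoC t * v)%C) t0 (v * l)%C.
Proof.
  intros H. split.
  { apply is_linear_scal_l. }
  intros x Hx eps.
  assert (Hzx : t0 = x) by (apply (is_filter_lim_locally_unique (V := R_NormedModule)); exact Hx).
  subst x.
  assert (Hv := Cmod_ge_0 v).
  destruct (proj1 (is_Cderive_eps _ _ _) H (eps / (1 + Cmod v))) as [d [Hd Hw]].
  { apply Rdiv_lt_0_compat; [apply cond_pos|lra]. }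
  assert (Hd' : 0 < d / (1 + Cmod v)) by (apply Rdiv_lt_0_compat; lra).
  exists (mkposreal _ Hd'). intros t Ht.
  assert (Ht' : Rabs (t - t0) < d / (1 + Cmod v)) by exact Ht.
  assert (E : Cmod (z + RtoC t * v - (z + RtoC t0 * v)) = Rabs (t - t0) * Cmod v).
  { rewrite <- Cmod_R, <- Cmod_mult. f_equal. rewrite RtoC_minus. ring. }
  specialize (Hw (z + RtoC t * v)%C). rewrite E in Hw.
  assert (Ha := Rabs_pos (t - t0)).
  assert (Hq : Rabs (t - t0) * (1 + Cmod v) < d).
  { apply Rmult_lt_compat_r with (r := 1 + Cmod v) in Ht'; [|lra].
    replace (d / (1 + Cmod v) * (1 + Cmod v)) with d in Ht' by (field; lra). exact Ht'. }
  specialize (Hw ltac:(nra)).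
  rewrite <- Cmod_norm.
  change (norm (minus t t0)) with (Rabs (t - t0)).
  change (minus t t0) with (t - t0)%R. rewrite scal_R_Cmult.
  change (Cmod (f (z + RtoC t * v) - f (z + RtoC t0 * v) - RtoC (t - t0)%R * (v * l))%C
    <= eps * Rabs (t - t0)).
  replace (f (z + RtoC t * v) - f (z + RtoC t0 * v) - RtoC (t - t0) * (v * l))%C with
    (f (z + RtoC t * v) - f (z + RtoC t0 * v) - (z + RtoC t * v - (z + RtoC t0 * v)) * l)%C
    by (rewrite RtoC_minus; ring).
  eapply Rle_trans; [exact Hw|].
  apply Rle_trans with (eps / (1 + Cmod v) * (1 + Cmod v) * Rabs (t - t0)).
  - assert (0 < eps / (1 + Cmod v)) by (apply Rdiv_lt_0_compat; [apply cond_pos|lra]). nra.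
  - right. field. lra.
Qed.

Lemma is_derive_Re (f : R -> C) (t : R) (l : C) :
  is_derive (V := C_R_NormedModule) f t l -> is_derive (fun t => Re (f t)) t (Re l).
Proof.
  intros [_ H]. split.
  { apply is_linear_scal_l. }
  intros x Hx eps. specialize (H x Hx eps).
  revert H. apply filter_imp. intros y Hy. eapply Rle_trans; [|exact Hy]. rewrite <- Cmod_norm.
  exact (re_le_Cmod (minus (G := C_R_NormedModule) (minus (f y) (f x)) (scal (minus y x) l))).
Qed.

Lemma is_derive_Im (f : R -> C) (t : R) (l : C) :
  is_derive (V := C_R_NormedModule) f t l -> is_derive (fun t => Im (f t)) t (Im l).
Proof.
  intros [_ H]. split.
  { apply is_linear_scal_l. }
  intros x Hx eps. specialize (H x Hx eps).
  revert H. apply filter_imp. intros y Hy. eapply Rle_trans; [|exact Hy]. rewrite <- Cmod_norm.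
  exact (im_le_Cmod (minus (G := C_R_NormedModule) (minus (f y) (f x)) (scal (minus y x) l))).
Qed.

Lemma is_derive_sqr (u : R -> R) (t l : R) :
  is_derive u t l -> is_derive (fun t => u t ^ 2) t (2 * u t * l).
Proof.
  intros H. apply (is_derive_ext (fun t => u t * u t)).
  { intros s. simpl. ring. }
  replace (2 * u t * l) with (l * u t + u t * l) by ring.
  exact (is_derive_mult u u t l l H H Rmult_comm).
Qed.

Lemma Cmod_sqr (z : C) : Cmod z ^ 2 = Re z ^ 2 + Im z ^ 2.
Proof. apply Cmod2_alt. Qed.

(* The conclusion is half the second derivative of [|h0|^2 + eps (Re - a)^2] along [z + t v]. *)
Lemma perturbed_modulus_max (h0 h1 : C -> C) (h2 z v : C) (a eps r : R) :
  0 < r ->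
  (forall t, - r < t < r ->
    is_Cderive h0 (z + RtoC t * v)%C (h1 (z + RtoC t * v)%C)) ->
  is_Cderive h1 z h2 ->
  (forall t, - r < t < r ->
    Cmod (h0 (z + RtoC t * v)%C) ^ 2 + eps * (Re z + t * Re v - a) ^ 2 <=
    Cmod (h0 z) ^ 2 + eps * (Re z - a) ^ 2) ->
  Cmod (v * h1 z) ^ 2 + eps * Re v ^ 2 + Re (Cconj (h0 z) * (v * v * h2)) <= 0.
Proof.
  intros Hr H0 H1 Hmax.
  assert (Hz : (z + RtoC 0 * v)%C = z) by ring.
  pose proof (fun t Ht => is_derive_line h0 z v _ t (H0 t Ht)) as L0.
  assert (L1 : is_derive (V := C_R_NormedModule) (fun t => h1 (z + RtoC t * v)%C) 0 (v * h2)%C).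
  { apply is_derive_line. now rewrite Hz. }
  set (q := fun t => Re (h0 (z + RtoC t * v)%C) ^ 2 + Im (h0 (z + RtoC t * v)%C) ^ 2
     + eps * (Re z + t * Re v - a) ^ 2).
  set (q1 := fun t =>
     2 * Re (h0 (z + RtoC t * v)%C) * Re (v * h1 (z + RtoC t * v))%C +
     2 * Im (h0 (z + RtoC t * v)%C) * Im (v * h1 (z + RtoC t * v))%C
     + eps * (2 * (Re z + t * Re v - a) * Re v)).
  assert (A : forall t, is_derive (fun t => Re z + t * Re v - a) t (Re v)).
  { intros t. auto_derive; [exact I|ring]. }
  assert (Hq : 2 * (Cmod (v * h1 z) ^ 2 + eps * Re v ^ 2 + Re (Cconj (h0 z) * (v * v * h2)))
     <= 0); [|lra].
  apply (second_derivative_max q q1 _ r Hr).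
  - intros t Ht. specialize (L0 t Ht). apply is_derive_Re in L0 as R0.
    apply is_derive_Im in L0 as I0.
    unfold q, q1. apply (is_derive_plus (V := R_NormedModule)).
    + apply (is_derive_plus (V := R_NormedModule)).
      * apply (is_derive_sqr (fun t => Re (h0 (z + RtoC t * v)%C))). exact R0.
      * apply (is_derive_sqr (fun t => Im (h0 (z + RtoC t * v)%C))). exact I0.
    + apply (is_derive_scal (fun t => (Re z + t * Re v - a) ^ 2)).
      apply (is_derive_sqr (fun t => Re z + t * Re v - a)). apply A.
  - assert (R0 := is_derive_Re _ _ _ (L0 0 ltac:(lra))).
    assert (I0 := is_derive_Im _ _ _ (L0 0 ltac:(lra))).
    assert (L2 : is_derive (V := C_R_NormedModule)
       (fun t => v * h1 (z + RtoC t * v))%C 0 (v * (v * h2))%C).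
    { apply (is_derive_line (fun w => v * h1 w)%C z v (v * h2)%C 0). rewrite Hz.
      eapply is_Cderive_eq; [|apply is_Cderive_mult; [apply is_Cderive_const|exact H1]].
      cbv beta; ring. }
    assert (R1 := is_derive_Re _ _ _ L2). assert (I1 := is_derive_Im _ _ _ L2).
    rewrite Cmod_sqr. unfold q1. cbv beta in *. rewrite Hz in *.
    evar_last.
    + apply (is_derive_plus (V := R_NormedModule)).
      * apply (is_derive_plus (V := R_NormedModule)).
        -- apply (is_derive_mult (fun t => 2 * Re (h0 (z + RtoC t * v)%C))
             (fun t => Re (v * h1 (z + RtoC t * v))%C)).
           ++ apply (is_derive_scal (fun t => Re (h0 (z + RtoC t * v)%C))). exact R0.
           ++ exact R1.
           ++ exact Rmult_comm.
        -- apply (is_derive_mult (fun t => 2 * Im (h0 (z + RtoC t * v)%C))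
             (fun t => Im (v * h1 (z + RtoC t * v))%C)).
           ++ apply (is_derive_scal (fun t => Im (h0 (z + RtoC t * v)%C))). exact I0.
           ++ exact I1.
           ++ exact Rmult_comm.
      * instantiate (1 := 2 * eps * Re v ^ 2). auto_derive; [exact I|ring].
    + unfold plus, mult; simpl. rewrite ?Hz. unfold Re, Im. simpl. ring.
  - intros t Ht. specialize (Hmax t Ht). rewrite !Cmod_sqr in Hmax. unfold q.
    rewrite Hz. replace (Re z + 0 * Re v - a) with (Re z - a) by ring. exact Hmax.
Qed.

(* [|h|^2] is subharmonic; adding [eps Re^2] makes the Laplacian positive. *)
Lemma maximum_modulus_rectangle (h0 h1 h2 : C -> C) (a b c d M : R) :
  a <= b -> c <= d ->
  (forall x y, a <= x <= b -> c <= y <= d ->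
     is_Cderive h0 (x, y) (h1 (x, y)) /\ is_Cderive h1 (x, y) (h2 (x, y))) ->
  (forall x y, a <= x <= b -> c <= y <= d -> x = a \/ x = b \/ y = c \/ y = d ->
     Cmod (h0 (x, y)) ^ 2 <= M) ->
  forall x y, a <= x <= b -> c <= y <= d -> Cmod (h0 (x, y)) ^ 2 <= M.
Proof.
  intros Hab Hcd Hder Hbd x0 y0 Hx0 Hy0. apply Rnot_lt_le. intros Hlt.
  (* Small enough that [eps (b - a)^2] stays below the supposed excess over [M]; a maximum of the
     perturbed function then cannot lie on the boundary. *)
  set (eps := (Cmod (h0 (x0, y0)) ^ 2 - M) / (2 * ((b - a) ^ 2 + 1))).
  assert (Hba : 0 <= (b - a) ^ 2) by apply pow2_ge_0.
  assert (Heps : 0 < eps) by (apply Rdiv_lt_0_compat; nra).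
  assert (HepsM : eps * (b - a) ^ 2 < Cmod (h0 (x0, y0)) ^ 2 - M).
  { apply Rlt_le_trans with (eps * (2 * ((b - a) ^ 2 + 1))).
    - apply Rmult_lt_compat_l; lra.
    - right. unfold eps. field. nra. }
  set (g := fun x y => Cmod (h0 (x, y)) ^ 2 + eps * (x - a) ^ 2).
  destruct (continuous_rectangle_max g a b c d Hab Hcd) as [p [q [Hp [Hq Hmax]]]].
  { intros p q Hp Hq. apply continuity_2d_pt_filterlim.
    unfold g. apply (filterlim_ext
      (fun z : R * R => plus (mult (Cmod (h0 z)) (Cmod (h0 z))) (eps * (fst z - a) ^ 2))).
    { intros [x y]. unfold plus, mult; simpl. ring. }
    destruct (Hder p q Hp Hq) as [D0 _]. apply is_Cderive_continuous in D0.
    assert (Dn : filterlim (fun z : R * R => Cmod (h0 z)) (locally (p, q))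
       (locally (Cmod (h0 (p, q))))).
    { apply filterlim_comp with (1 := D0).
      exact (filterlim_norm (V := C_NormedModule) (h0 (p, q))). }
    replace (Cmod (h0 (p, q)) ^ 2 + eps * (p - a) ^ 2) with
      (plus (mult (Cmod (h0 (p, q))) (Cmod (h0 (p, q)))) (eps * (p - a) ^ 2))
      by (unfold plus, mult; simpl; ring).
    eapply filterlim_comp_2.
    - eapply filterlim_comp_2; [exact Dn|exact Dn|apply (filterlim_mult (K := R_AbsRing))].
    - apply (filterlim_comp _ _ _ fst (fun x => eps * (x - a) ^ 2) _ (locally p)).
      + intros P [e He]. exists e. intros y [H1 _]. apply He. exact H1.
      + apply (ex_derive_continuous (fun x => eps * (x - a) ^ 2)). auto_derive. exact I.
    - apply (filterlim_plus (V := R_NormedModule)). }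
  assert (Hg : Cmod (h0 (x0, y0)) ^ 2 <= g p q).
  { eapply Rle_trans; [|apply (Hmax x0 y0); assumption]. unfold g.
    assert (0 <= (x0 - a) ^ 2) by apply pow2_ge_0. nra. }
  assert (Hint : a < p < b /\ c < q < d).
  { assert (HB : ~ (p = a \/ p = b \/ q = c \/ q = d)).
    { intros HB. specialize (Hbd p q Hp Hq HB). unfold g in Hg.
      assert ((p - a) ^ 2 <= (b - a) ^ 2) by (apply pow_incr; lra). nra. }
    assert (p <> a) by tauto. assert (p <> b) by tauto.
    assert (q <> c) by tauto. assert (q <> d) by tauto. lra. }
  set (r := Rmin (Rmin (p - a) (b - p)) (Rmin (q - c) (d - q))).
  assert (Hr : 0 < r) by (repeat apply Rmin_glb_lt; lra).
  assert (R1 : r <= p - a) by (eapply Rle_trans; [apply Rmin_l|apply Rmin_l]).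
  assert (R2 : r <= b - p) by (eapply Rle_trans; [apply Rmin_l|apply Rmin_r]).
  assert (R3 : r <= q - c) by (eapply Rle_trans; [apply Rmin_r|apply Rmin_l]).
  assert (R4 : r <= d - q) by (eapply Rle_trans; [apply Rmin_r|apply Rmin_r]).
  assert (X : forall t : R, ((p, q) + RtoC t * RtoC 1)%C = (p + t, q)).
  { intros t. apply injective_projections; simpl; ring. }
  assert (Y : forall t : R, ((p, q) + RtoC t * Ci)%C = (p, q + t)).
  { intros t. apply injective_projections; simpl; ring. }
  destruct (Hder p q ltac:(lra) ltac:(lra)) as [_ D1].
  assert (T1 := perturbed_modulus_max h0 h1 (h2 (p, q)) (p, q) (RtoC 1) a eps r Hr).
  assert (T2 := perturbed_modulus_max h0 h1 (h2 (p, q)) (p, q) Ci a eps r Hr).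
  specialize (T1 ltac:(intros t Ht; rewrite X; apply Hder; lra) D1).
  specialize (T2 ltac:(intros t Ht; rewrite Y; apply Hder; lra) D1).
  lapply T1; [clear T1; intros T1|].
  2:{ intros t Ht. rewrite X. simpl Re. rewrite Rmult_1_r. apply (Hmax (p + t) q); lra. }
  lapply T2; [clear T2; intros T2|].
  2:{ intros t Ht. rewrite Y. simpl Re. rewrite Rmult_0_r, Rplus_0_r.
      apply (Hmax p (q + t)); lra. }
  (* The directions 1 and [Ci] have opposite squares, so the terms with [h2] cancel on addition and
     leave [2 |h1|^2 + eps <= 0]. *)
  assert (E : Re (Cconj (h0 (p, q)) * (Ci * Ci * h2 (p, q))) =
     - Re (Cconj (h0 (p, q)) * (RtoC 1 * RtoC 1 * h2 (p, q)))).
  { unfold Re; simpl. ring. }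
  rewrite E in T2. simpl Re in T1, T2.
  assert (N1 := pow2_ge_0 (Cmod (RtoC 1 * h1 (p, q)))).
  assert (N2 := pow2_ge_0 (Cmod (Ci * h1 (p, q)))). lra.
Qed.

(** * Goursat's theorem and unique continuation *)

Notation RIntC := (@RInt C_R_CompleteNormedModule).
Notation ex_RIntC := (@ex_RInt C_R_CompleteNormedModule).

Lemma is_derive_hline (f : C -> C) (x y : R) (l : C) :
  is_Cderive f (x, y) l -> is_derive (V := C_R_NormedModule) (fun t => f (t, y)) x l.
Proof.
  intros H. apply (is_derive_ext (V := C_R_NormedModule)
    (fun t : R => f ((0, y) + RtoC t * RtoC 1)%C)).
  { intros t. f_equal. apply injective_projections; simpl; ring. }
  replace l with (RtoC 1 * l)%C by ring. apply is_derive_line.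
  replace ((0, y) + RtoC x * RtoC 1)%C with (x, y); [exact H|].
  apply injective_projections; simpl; ring.
Qed.

Lemma is_derive_vline (f : C -> C) (x y : R) (l : C) :
  is_Cderive f (x, y) l -> is_derive (V := C_R_NormedModule) (fun t => f (x, t)) y (Ci * l)%C.
Proof.
  intros H. apply (is_derive_ext (V := C_R_NormedModule)
    (fun t : R => f ((x, 0) + RtoC t * Ci)%C)).
  { intros t. f_equal. apply injective_projections; simpl; ring. }
  apply is_derive_line.
  replace ((x, 0) + RtoC y * Ci)%C with (x, y); [exact H|].
  apply injective_projections; simpl; ring.
Qed.

Definition Ccontinuous (f : C -> C) (z : C) : Prop :=
  filterlim f (locally z) (locally (f z)).

Lemma continuous_hline (f : C -> C) (x y : R) : Ccontinuous f (x, y) ->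
  continuous (U := C_R_NormedModule) (fun t => f (t, y)) x.
Proof.
  intros H P HP. specialize (H P HP). destruct H as [d Hd].
  exists d. intros t Ht. apply Hd. split; [exact Ht|apply ball_center].
Qed.

Lemma continuous_vline (f : C -> C) (x y : R) : Ccontinuous f (x, y) ->
  continuous (U := C_R_NormedModule) (fun t => f (x, t)) y.
Proof.
  intros H P HP. specialize (H P HP). destruct H as [d Hd].
  exists d. intros t Ht. apply Hd. split; [apply ball_center|exact Ht].
Qed.

(** The ends come in either order, because the increments of a primitive have either sign. *)
Definition between (a b x : R) : Prop := Rmin a b <= x <= Rmax a b.

Lemma ex_RInt_hline (f : C -> C) (a b y : R) :
  (forall x, between a b x -> Ccontinuous f (x, y)) -> ex_RIntC (fun x => f (x, y)) a b.
Proof. intros H. apply ex_RInt_continuous. intros x Hx. now apply continuous_hline, H. Qed.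

Lemma ex_RInt_vline (f : C -> C) (x c d : R) :
  (forall y, between c d y -> Ccontinuous f (x, y)) -> ex_RIntC (fun y => f (x, y)) c d.
Proof. intros H. apply ex_RInt_continuous. intros y Hy. now apply continuous_vline, H. Qed.

Lemma norm_RIntC_le (f : R -> C) (a b M : R) :
  ex_RIntC f a b -> (forall x, between a b x -> Cmod (f x) <= M) ->
  Cmod (RIntC f a b) <= Rabs (b - a) * M.
Proof.
  intros Hex HM. rewrite Cmod_norm.
  apply (norm_RInt_le_const_abs (V := C_R_NormedModule) f a b).
  - intros x Hx. rewrite <- Cmod_norm. now apply HM.
  - now apply (RInt_correct (V := C_R_CompleteNormedModule)).
Qed.

(** The contour integral along the boundary of the rectangle, anticlockwise if [a <= b] and
    [c <= d]. *)
Definition rect_int (f : C -> C) (a b c d : R) : C :=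
  (RIntC (fun x => f (x, c)) a b - RIntC (fun x => f (x, d)) a b
   + Ci * (RIntC (fun y => f (b, y)) c d - RIntC (fun y => f (a, y)) c d))%C.

Definition on_rect (P : C -> Prop) (a b c d : R) : Prop :=
  forall x y, between a b x -> between c d y -> P (x, y).

Lemma between_l (a b : R) : between a b a.
Proof. split; [apply Rmin_l|apply Rmax_l]. Qed.

Lemma between_r (a b : R) : between a b b.
Proof. split; [apply Rmin_r|apply Rmax_r]. Qed.

Lemma between_le (a b x : R) : a <= b -> between a b x <-> a <= x <= b.
Proof. intros H. unfold between. now rewrite Rmin_left, Rmax_right by exact H. Qed.

Lemma rect_int_primitive (g Q : C -> C) (a b c d : R) :
  on_rect (Ccontinuous g) a b c d ->
  on_rect (fun z => is_Cderive Q z (g z)) a b c d -> rect_int g a b c d = RtoC 0.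
Proof.
  intros Hg HQ. unfold rect_int.
  assert (Hh : forall y, between c d y -> RIntC (fun x => g (x, y)) a b = (Q (b, y) - Q (a, y))%C).
  { intros y Hy. apply is_RInt_unique.
    apply (is_RInt_derive (V := C_R_CompleteNormedModule) (fun t => Q (t, y))).
    - intros x Hx. apply is_derive_hline. now apply HQ.
    - intros x Hx. apply continuous_hline. now apply Hg. }
  assert (Hv : forall x, between a b x ->
     RIntC (fun y => g (x, y)) c d = (- Ci * Q (x, d) - - Ci * Q (x, c))%C).
  { intros x Hx. apply is_RInt_unique.
    (* Differentiating along a vertical line multiplies the complex derivative by [Ci]; the factor
       [- Ci] undoes this. *)
    apply (is_RInt_derive (V := C_R_CompleteNormedModule) (fun t => - Ci * Q (x, t))%C).
    - intros y Hy.
      replace (g (x, y)) with (Ci * (RtoC 0 * Q (x, y) + - Ci * g (x, y)))%C.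
      2:{ apply injective_projections; simpl; ring. }
      apply (is_derive_vline (fun z => - Ci * Q z)%C x y).
      apply (is_Cderive_mult (fun _ => - Ci)%C Q (x, y)); [apply is_Cderive_const|].
      now apply HQ.
    - intros y Hy. apply continuous_vline. now apply Hg. }
  rewrite !Hh by (apply between_l || apply between_r).
  rewrite !Hv by (apply between_l || apply between_r).
  apply injective_projections; simpl; ring.
Qed.

Lemma RIntC_minus (f g : R -> C) (a b : R) : ex_RIntC f a b -> ex_RIntC g a b ->
  RIntC (fun x => f x - g x)%C a b = (RIntC f a b - RIntC g a b)%C.
Proof. exact (RInt_minus (V := C_R_CompleteNormedModule) f g a b). Qed.

Lemma RIntC_Chasles (f : R -> C) (a b c : R) : ex_RIntC f a b -> ex_RIntC f b c ->
  (RIntC f a b + RIntC f b c)%C = RIntC f a c.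
Proof. exact (RInt_Chasles (V := C_R_CompleteNormedModule) f a b c). Qed.

Lemma RIntC_swap (f : R -> C) (a b : R) : ex_RIntC f a b ->
  RIntC f b a = (- RIntC f a b)%C.
Proof. intros H. symmetry. exact (opp_RInt_swap (V := C_R_CompleteNormedModule) f a b H). Qed.

Lemma Ccontinuous_minus (f g : C -> C) (z : C) :
  Ccontinuous f z -> Ccontinuous g z -> Ccontinuous (fun w => f w - g w)%C z.
Proof.
  intros Hf Hg. 
  apply (filterlim_comp_2 (G := locally (f z)) (H := locally (- g z)%C) f
    (fun w => - g w)%C Cplus); [exact Hf| |].
  - apply (filterlim_comp _ _ _ g Copp _ (locally (g z))); [exact Hg|]. exact (filterlim_opp (V := C_NormedModule) (g z)).
  - exact (filterlim_plus (V := C_NormedModule) (f z) (- g z)%C).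
Qed.

Lemma rect_int_bound (f : C -> C) (a b c d M : R) : a <= b -> c <= d ->
  on_rect (Ccontinuous f) a b c d -> on_rect (fun z => Cmod (f z) <= M) a b c d ->
  Cmod (rect_int f a b c d) <= 2 * (b - a + (d - c)) * M.
Proof.
  intros Hab Hcd Hf HM. unfold rect_int.
  assert (Hh : forall y, between c d y -> Cmod (RIntC (fun x => f (x, y)) a b) <= (b - a) * M).
  { intros y Hy. rewrite <- (Rabs_pos_eq (b - a)) by lra. apply norm_RIntC_le.
    - apply ex_RInt_hline. intros x Hx. now apply Hf.
    - intros x Hx. now apply HM. }
  assert (Hv : forall x, between a b x -> Cmod (RIntC (fun y => f (x, y)) c d) <= (d - c) * M).
  { intros x Hx. rewrite <- (Rabs_pos_eq (d - c)) by lra. apply norm_RIntC_le.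
    - apply ex_RInt_vline. intros y Hy. now apply Hf.
    - intros y Hy. now apply HM. }
  eapply Rle_trans; [apply Cmod_triangle|]. rewrite Cmod_mult, Cmod_Ci.
  assert (T1 := Cmod_triangle (RIntC (fun x => f (x, c)) a b) (- RIntC (fun x => f (x, d)) a b)).
  assert (T2 := Cmod_triangle (RIntC (fun x => f (b, x)) c d) (- RIntC (fun x => f (a, x)) c d)).
  rewrite Cmod_opp in T1, T2.
  assert (U1 := Hh c (between_l c d)). assert (U2 := Hh d (between_r c d)).
  assert (U3 := Hv a (between_l a b)). assert (U4 := Hv b (between_r a b)).
  unfold Cminus. lra.
Qed.

Lemma rect_int_minus (f g : C -> C) (a b c d : R) :
  on_rect (Ccontinuous f) a b c d -> on_rect (Ccontinuous g) a b c d ->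
  rect_int (fun z => f z - g z)%C a b c d = (rect_int f a b c d - rect_int g a b c d)%C.
Proof.
  intros Hf Hg.
  assert (Hh : forall y, between c d y -> RIntC (fun x => f (x, y) - g (x, y))%C a b =
    (RIntC (fun x => f (x, y)) a b - RIntC (fun x => g (x, y)) a b)%C).
  { intros y Hy. apply RIntC_minus; apply ex_RInt_hline; intros x Hx; [now apply Hf|now apply Hg]. }
  assert (Hv : forall x, between a b x -> RIntC (fun y => f (x, y) - g (x, y))%C c d =
    (RIntC (fun y => f (x, y)) c d - RIntC (fun y => g (x, y)) c d)%C).
  { intros x Hx. apply RIntC_minus; apply ex_RInt_vline; intros y Hy; [now apply Hf|now apply Hg]. }
  unfold rect_int.
  rewrite (Hh c (between_l c d)), (Hh d (between_r c d)).
  rewrite (Hv a (between_l a b)), (Hv b (between_r a b)). ring.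
Qed.

Lemma rect_int_quarters (f : C -> C) (a m b c n d : R) :
  a <= m <= b -> c <= n <= d -> on_rect (Ccontinuous f) a b c d ->
  rect_int f a b c d =
  (rect_int f a m c n + rect_int f m b c n + rect_int f a m n d + rect_int f m b n d)%C.
Proof.
  intros Hm Hn Hf.
  assert (Hf' : forall x y, a <= x <= b -> c <= y <= d -> Ccontinuous f (x, y)).
  { intros x y Hx Hy. apply Hf; apply between_le; lra. }
  assert (Hh : forall y, c <= y <= d ->
    RIntC (fun x => f (x, y)) a b = (RIntC (fun x => f (x, y)) a m + RIntC (fun x => f (x, y)) m b)%C).
  { intros y Hy. symmetry. apply RIntC_Chasles; apply ex_RInt_hline; intros x Hx;
      rewrite between_le in Hx by lra; apply Hf'; lra. }
  assert (Hv : forall x, a <= x <= b ->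
    RIntC (fun y => f (x, y)) c d = (RIntC (fun y => f (x, y)) c n + RIntC (fun y => f (x, y)) n d)%C).
  { intros x Hx. symmetry. apply RIntC_Chasles; apply ex_RInt_vline; intros y Hy;
      rewrite between_le in Hy by lra; apply Hf'; lra. }
  unfold rect_int. rewrite !Hh, !Hv by lra. ring.
Qed.

(** The bound [eps / 4^n] scales like the area, so it adds up over four quarters. On a small
    rectangle around [(p, q)], [f] is affine up to [e |w - (p, q)|], and the affine part has a
    primitive, hence integral 0. *)
Lemma goursat_ordered (f : C -> C) (a b c d : R) : a <= b -> c <= d ->
  on_rect (fun z => exists l, is_Cderive f z l) a b c d -> rect_int f a b c d = RtoC 0.
Proof.
  intros Hab Hcd Hf.
  assert (Hf' : forall x y, a <= x <= b -> c <= y <= d -> exists l, is_Cderive f (x, y) l).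
  { intros x y Hx Hy. apply Hf; apply between_le; lra. }
  assert (Hc : forall x y, a <= x <= b -> c <= y <= d -> Ccontinuous f (x, y)).
  { intros x y Hx Hy. destruct (Hf' x y Hx Hy) as [l Hl]. exact (is_Cderive_continuous _ _ _ Hl). }
  set (B := b - a). set (H := d - c).
  assert (HB : 0 <= B) by (unfold B; lra). assert (HH : 0 <= H) by (unfold H; lra).
  assert (Hpos : forall D n, 0 <= D -> 0 <= D / 2 ^ n).
  { intros D n HD. apply Rdiv_le_0_compat; [exact HD|]. apply pow_lt. lra. }
  assert (Hh : forall (D : R) n, D / 2 ^ n = D / 2 ^ S n + D / 2 ^ S n).
  { intros D n. simpl. field. apply pow_nonzero. lra. }
  assert (Main : forall eps, 0 < eps -> Cmod (rect_int f a b c d) <= eps).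
  2:{ apply Cmod_eq_0. apply Rle_antisym; [|apply Cmod_ge_0].
      apply le_epsilon. intros e He. rewrite Rplus_0_l. now apply Main. }
  intros eps Heps.
  set (P := fun (n : nat) x y => a <= x -> x + B / 2 ^ n <= b -> c <= y -> y + H / 2 ^ n <= d ->
    Cmod (rect_int f x (x + B / 2 ^ n) y (y + H / 2 ^ n)) <= eps / 4 ^ n).
  assert (HP : P O a c).
  { apply (bisection B H); [exact HB|exact HH| |].
    - intros n x y P1 P2 P3 P4 Hx1 Hx2 Hy1 Hy2.
      assert (E1 := Hh B n). assert (E2 := Hh H n).
      assert (E3 := Hpos B (S n) HB). assert (E4 := Hpos H (S n) HH).
      unfold P in *. rewrite E1 in *. rewrite E2 in *.
      set (u := B / 2 ^ S n) in *. set (v := H / 2 ^ S n) in *.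
      rewrite (rect_int_quarters f x (x + u) _ y (y + v)) by
        (try lra; intros s t Hs Ht; rewrite between_le in Hs by lra;
          rewrite between_le in Ht by lra; apply Hc; lra).
      specialize (P1 ltac:(lra) ltac:(lra) ltac:(lra) ltac:(lra)).
      specialize (P2 ltac:(lra) ltac:(lra) ltac:(lra) ltac:(lra)).
      specialize (P3 ltac:(lra) ltac:(lra) ltac:(lra) ltac:(lra)).
      specialize (P4 ltac:(lra) ltac:(lra) ltac:(lra) ltac:(lra)).
      rewrite <- !Rplus_assoc in *.
      assert (E5 : eps / 4 ^ n = 4 * (eps / 4 ^ S n)).
      { simpl. field. apply pow_nonzero. lra. }
      rewrite E5. set (e := eps / 4 ^ S n) in *.
      eapply Rle_trans; [apply Cmod_triangle|].
      eapply Rle_trans; [apply Rplus_le_compat_r, Cmod_triangle|].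
      eapply Rle_trans; [apply Rplus_le_compat_r, Rplus_le_compat_r, Cmod_triangle|].
      lra.
    - intros p q Hp Hq. unfold B, H in Hp, Hq.
      destruct (Hf' p q ltac:(lra) ltac:(lra)) as [l Hl].
      (* For sides [u = B / 2^n] and [v = H / 2^n] the perimeter [2 (u + v)] times the error
         [e (u + v)] is [2 e (B + H)^2 / 4^n]. The added 1 keeps the divisor positive when the
         rectangle is a point. *)
      set (e := eps / (2 * (B + H) ^ 2 + 1)).
      assert (Hsq := pow2_ge_0 (B + H)).
      assert (He : 0 < e) by (apply Rdiv_lt_0_compat; lra).
      destruct (proj1 (is_Cderive_eps _ _ _) Hl e He) as [dl [Hdl Hlin]].
      exists (dl / 2). split; [lra|].
      intros n x y Hx1 Hx2 Hy1 Hy2 Hxp Hyq HBn HHn _ _ _ _.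
      unfold B at 2 in Hx2. unfold H at 2 in Hy2.
      set (u := B / 2 ^ n) in *. set (v := H / 2 ^ n) in *.
      assert (Hu := Hpos B n HB : 0 <= u). assert (Hv := Hpos H n HH : 0 <= v).
      set (g := fun w : C => (f (p, q) + (w - (p, q)) * l)%C).
      assert (Dg : forall z, is_Cderive g z l).
      { intros z. unfold g. eapply is_Cderive_eq; [|apply is_Cderive_plus;
          [apply is_Cderive_const|apply is_Cderive_mult;
            [apply is_Cderive_minus; [apply is_Cderive_id|apply is_Cderive_const]
            |apply is_Cderive_const]]].
        cbv beta. ring. }
      assert (Cg : forall z, Ccontinuous g z).
      { intros z. exact (is_Cderive_continuous _ _ _ (Dg z)). }
      assert (Zg : rect_int g x (x + u) y (y + v) = RtoC 0).
      { apply (rect_int_primitive g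
          (fun w => f (p, q) * w + (w - (p, q)) * (w - (p, q)) * (l * RtoC (/ 2)))%C).
        - intros s t _ _. apply Cg.
        - intros s t _ _. eapply is_Cderive_eq; [|apply is_Cderive_plus;
            [apply is_Cderive_mult; [apply is_Cderive_const|apply is_Cderive_id]
            |apply is_Cderive_mult; [apply is_Cderive_mult;
              (apply is_Cderive_minus; [apply is_Cderive_id|apply is_Cderive_const])
              |apply is_Cderive_const]]].
          unfold g. apply injective_projections; simpl; field. }
      assert (Cf : on_rect (Ccontinuous f) x (x + u) y (y + v)).
      { intros s t Hs Ht. rewrite between_le in Hs by lra. rewrite between_le in Ht by lra.
        apply Hc; lra. }
      replace (rect_int f x (x + u) y (y + v)) with
        (rect_int (fun w => f w - g w)%C x (x + u) y (y + v)).
      2:{ rewrite rect_int_minus, Zg by (exact Cf || (intros s t _ _; apply Cg)). ring. }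
      eapply Rle_trans.
      { apply (rect_int_bound _ _ _ _ _ (e * (u + v))); [lra|lra| |].
        - intros s t Hs Ht. apply Ccontinuous_minus; [now apply Cf|apply Cg].
        - intros s t Hs Ht. rewrite between_le in Hs by lra. rewrite between_le in Ht by lra.
          assert (Hd : Cmod ((s, t) - (p, q))%C <= u + v).
          { eapply Rle_trans; [apply Cmod_le_abs|]. simpl.
            apply Rplus_le_compat; apply Rabs_le; lra. }
          specialize (Hlin (s, t) ltac:(lra)).
          unfold g. replace (f (s, t) - (f (p, q) + ((s, t) - (p, q)) * l))%C with
            (f (s, t) - f (p, q) - ((s, t) - (p, q)) * l)%C by ring.
          eapply Rle_trans; [exact Hlin|]. apply Rmult_le_compat_l; lra. }
      replace (2 * (x + u - x + (y + v - y)) * (e * (u + v))) with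
        (e * (2 * (B + H) ^ 2) / 4 ^ n).
      2:{ unfold u, v. replace 4 with (2 * 2) by ring. rewrite Rpow_mult_distr. field.
          apply pow_nonzero. lra. }
      apply Rmult_le_compat_r; [left; apply Rinv_0_lt_compat, pow_lt; lra|].
      apply Rle_trans with (e * (2 * (B + H) ^ 2 + 1)); [nra|].
      right. unfold e. field. lra. }
  unfold P, B, H in HP. simpl in HP. rewrite !Rdiv_1_r in HP.
  replace (a + (b - a)) with b in HP by ring. replace (c + (d - c)) with d in HP by ring.
  apply HP; lra.
Qed.

Lemma goursat (f : C -> C) (a b c d : R) :
  on_rect (fun z => exists l, is_Cderive f z l) a b c d -> rect_int f a b c d = RtoC 0.
Proof.
  intros Hf.
  assert (Hc : on_rect (Ccontinuous f) a b c d).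
  { intros x y Hx Hy. destruct (Hf x y Hx Hy) as [l Hl]. exact (is_Cderive_continuous _ _ _ Hl). }
  assert (Hh : forall y, between c d y -> ex_RIntC (fun x => f (x, y)) a b).
  { intros y Hy. apply ex_RInt_hline. intros x Hx. now apply Hc. }
  assert (Hv : forall x, between a b x -> ex_RIntC (fun y => f (x, y)) c d).
  { intros x Hx. apply ex_RInt_vline. intros y Hy. now apply Hc. }
  assert (Sx : rect_int f b a c d = (- rect_int f a b c d)%C).
  { unfold rect_int. rewrite (RIntC_swap (fun x => f (x, c)) a b), (RIntC_swap (fun x => f (x, d)) a b).
    - ring.
    - apply Hh, between_r.
    - apply Hh, between_l. }
  assert (Sy : rect_int f a b d c = (- rect_int f a b c d)%C).
  { unfold rect_int. rewrite (RIntC_swap (fun y => f (a, y)) c d), (RIntC_swap (fun y => f (b, y)) c d).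
    - ring.
    - apply Hv, between_r.
    - apply Hv, between_l. }
  assert (Sxy : rect_int f b a d c = rect_int f a b c d).
  { unfold rect_int.
    rewrite (RIntC_swap (fun y => f (a, y)) c d), (RIntC_swap (fun y => f (b, y)) c d).
    rewrite (RIntC_swap (fun x => f (x, c)) a b), (RIntC_swap (fun x => f (x, d)) a b).
    - ring.
    - apply Hh, between_r.
    - apply Hh, between_l.
    - apply Hv, between_r.
    - apply Hv, between_l. }
  assert (Copp_involutive : forall z : C, (- - z)%C = z) by (intros z; ring).
  unfold on_rect, between in Hf.
  destruct (Rle_or_lt a b) as [L1|L1]; destruct (Rle_or_lt c d) as [L2|L2].
  - now apply goursat_ordered.
  - rewrite <- (Copp_involutive (rect_int f a b c d)), <- Sy, goursat_ordered;
      [apply Copp_0|lra|lra|].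
    unfold on_rect, between. rewrite (Rmin_comm d c), (Rmax_comm d c). exact Hf.
  - rewrite <- (Copp_involutive (rect_int f a b c d)), <- Sx, goursat_ordered;
      [apply Copp_0|lra|lra|].
    unfold on_rect, between. rewrite (Rmin_comm b a), (Rmax_comm b a). exact Hf.
  - rewrite <- Sxy. apply goursat_ordered; [lra|lra|].
    unfold on_rect, between. rewrite (Rmin_comm b a), (Rmax_comm b a), (Rmin_comm d c), (Rmax_comm d c).
    exact Hf.
Qed.

Lemma Ccontinuous_eps (f : C -> C) (z : C) : Ccontinuous f z ->
  forall eps, 0 < eps -> exists d, 0 < d /\ forall w, Cmod (w - z) < d -> Cmod (f w - f z) < eps.
Proof.
  intros H eps He.
  apply locally_Cmod. apply (H (fun w => Cmod (w - f z) < eps)).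
  apply locally_Cmod. exists eps. split; [exact He|]. intros w Hw. exact Hw.
Qed.

(** The path goes horizontally, then vertically. Neither leg is longer than the distance of the end
    points, whence the factor 2. *)
Lemma path_integral_estimate (f : C -> C) (x y x' y' eps : R) :
  (forall t, between x x' t -> Ccontinuous f (t, y) /\ Cmod (f (t, y) - f (x, y)) <= eps) ->
  (forall s, between y y' s -> Ccontinuous f (x', s) /\ Cmod (f (x', s) - f (x, y)) <= eps) ->
  Cmod (RIntC (fun t => f (t, y)) x x' + Ci * RIntC (fun s => f (x', s)) y y'
        - ((x', y') - (x, y)) * f (x, y)) <= 2 * eps * Cmod ((x', y') - (x, y))%C.
Proof.
  intros Hh Hv.
  assert (K : forall a b (k : C), RIntC (fun _ => k) a b = (RtoC (b - a) * k)%C).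
  { intros a b k. rewrite (RInt_const (V := C_R_CompleteNormedModule)). apply scal_R_Cmult. }
  assert (E1 : ex_RIntC (fun t => f (t, y)) x x').
  { apply ex_RInt_hline. intros t Ht. now apply Hh. }
  assert (E2 : ex_RIntC (fun s => f (x', s)) y y').
  { apply ex_RInt_vline. intros t Ht. now apply Hv. }
  assert (E3 : forall a b (k : C), ex_RIntC (fun _ => k) a b).
  { intros a b k. apply ex_RInt_const. }
  replace (RIntC (fun t => f (t, y)) x x' + Ci * RIntC (fun s => f (x', s)) y y'
        - ((x', y') - (x, y)) * f (x, y))%C with
    (RIntC (fun t => f (t, y) - f (x, y)) x x' + Ci * RIntC (fun s => f (x', s) - f (x, y)) y y')%C.
  2:{ rewrite RIntC_minus by trivial.
      rewrite (RIntC_minus (fun s => f (x', s)) (fun _ => f (x, y)) y y') by trivial.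
      rewrite !K. apply injective_projections; simpl; ring. }
  eapply Rle_trans; [apply Cmod_triangle|]. rewrite Cmod_mult, Cmod_Ci, Rmult_1_l.
  assert (B1 : Cmod (RIntC (fun t => f (t, y) - f (x, y))%C x x') <= Rabs (x' - x) * eps).
  { apply norm_RIntC_le; [|intros t Ht; now apply Hh].
    exact (ex_RInt_minus (V := C_R_NormedModule) _ _ _ _ E1 (E3 x x' (f (x, y)))). }
  assert (B2 : Cmod (RIntC (fun s => f (x', s) - f (x, y))%C y y') <= Rabs (y' - y) * eps).
  { apply norm_RIntC_le; [|intros t Ht; now apply Hv].
    exact (ex_RInt_minus (V := C_R_NormedModule) _ _ _ _ E2 (E3 y y' (f (x, y)))). }
  assert (A1 := re_le_Cmod ((x', y') - (x, y))%C). assert (A2 := im_le_Cmod ((x', y') - (x, y))%C).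
  simpl in A1, A2.
  assert (0 <= eps).
  { eapply Rle_trans; [apply Cmod_ge_0|]. apply (Hh x). apply between_l. }
  change (x' + - x) with (x' - x) in A1. change (y' + - y) with (y' - y) in A2.
  nra.
Qed.

(** * Primitives in a box *)

Definition in_box (A V1 V2 : R) (z : C) : Prop := - A < Re z < A /\ V1 < Im z < V2.

Lemma in_box_open (A V1 V2 : R) (z : C) : in_box A V1 V2 z ->
  exists d, 0 < d /\ forall w, Rabs (Re w - Re z) < d -> Rabs (Im w - Im z) < d -> in_box A V1 V2 w.
Proof.
  intros [H1 H2].
  exists (Rmin (Rmin (Re z + A) (A - Re z)) (Rmin (Im z - V1) (V2 - Im z))).
  split; [repeat apply Rmin_glb_lt; lra|].
  intros w Hx Hy.
  assert (R1 := Rmin_l (Rmin (Re z + A) (A - Re z)) (Rmin (Im z - V1) (V2 - Im z))).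
  assert (R2 := Rmin_r (Rmin (Re z + A) (A - Re z)) (Rmin (Im z - V1) (V2 - Im z))).
  assert (R3 := Rmin_l (Re z + A) (A - Re z)). assert (R4 := Rmin_r (Re z + A) (A - Re z)).
  assert (R5 := Rmin_l (Im z - V1) (V2 - Im z)). assert (R6 := Rmin_r (Im z - V1) (V2 - Im z)).
  apply Rabs_def2 in Hx. apply Rabs_def2 in Hy. unfold in_box. lra.
Qed.

Lemma between_abs (a b x : R) : between a b x -> Rabs (x - a) <= Rabs (b - a).
Proof.
  unfold between, Rmin, Rmax, Rabs. destruct Rle_dec; repeat destruct Rcase_abs; lra.
Qed.

(* As [f] vanishes on the imaginary axis, integrating horizontally from the axis is the same as
   integrating along any path from a fixed base point. *)
Lemma primitive_in_box (f : C -> C) (A V1 V2 : R) :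
  (forall z, in_box A V1 V2 z -> exists l, is_Cderive f z l) ->
  (forall y, V1 < y < V2 -> f (0, y) = RtoC 0) ->
  forall z, in_box A V1 V2 z ->
    is_Cderive (fun w => RIntC (fun t => f (t, Im w)) 0 (Re w)) z (f z).
Proof.
  intros Hf Hz0 [x y] Hbox. apply is_Cderive_eps. intros eps Heps.
  assert (Hc : forall w, in_box A V1 V2 w -> Ccontinuous f w).
  { intros w Hw. destruct (Hf w Hw) as [l Hl]. exact (is_Cderive_continuous _ _ _ Hl). }
  destruct (in_box_open _ _ _ _ Hbox) as [d1 [Hd1 Hb]].
  destruct (Ccontinuous_eps f (x, y) (Hc _ Hbox) (eps / 2) ltac:(lra)) as [d2 [Hd2 Hf2]].
  exists (Rmin d1 d2). split; [apply Rmin_glb_lt; lra|].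
  intros [x' y'] Hw.
  assert (L1 := Rlt_le_trans _ _ _ Hw (Rmin_l _ _)).
  assert (L2 := Rlt_le_trans _ _ _ Hw (Rmin_r _ _)).
  assert (A1 := re_le_Cmod ((x', y') - (x, y))%C). assert (A2 := im_le_Cmod ((x', y') - (x, y))%C).
  simpl in A1, A2. change (x' + - x) with (x' - x) in A1. change (y' + - y) with (y' - y) in A2.
  assert (Hbox' : in_box A V1 V2 (x', y')) by (apply Hb; simpl; lra).
  assert (Hrow : forall t s, between 0 x t \/ between 0 x' t -> between y y' s ->
    in_box A V1 V2 (t, s)).
  { intros t s Ht Hs. unfold in_box, between in *. simpl in *.
    revert Ht Hs. unfold Rmin, Rmax. repeat destruct Rle_dec; lra. }
  (* The rectangle reaches from the axis to abscissa [x']. Its side on the axis contributes nothing,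
     so the integral along the row [y'] is the one along the row [y] followed by the vertical
     segment at [x']. *)
  assert (G : rect_int f 0 x' y y' = RtoC 0).
  { apply goursat. intros t s Ht Hs. apply Hf. apply Hrow; [now right|exact Hs]. }
  unfold rect_int in G.
  assert (Z : RIntC (fun s => f (0, s)) y y' = RtoC 0).
  { rewrite (RInt_ext (V := C_R_CompleteNormedModule) _ (fun _ => RtoC 0)).
    - rewrite (RInt_const (V := C_R_CompleteNormedModule)).
      rewrite scal_R_Cmult. exact (Cmult_0_r _).
    - intros s Hs. apply Hz0. unfold in_box in *. simpl in *. revert Hs.
      unfold Rmin, Rmax. destruct Rle_dec; lra. }
  rewrite Z in G. simpl Re. simpl Im.
  assert (Ch : RIntC (fun t => f (t, y)) 0 x' =
     (RIntC (fun t => f (t, y)) 0 x + RIntC (fun t => f (t, y)) x x')%C).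
  { symmetry. apply RIntC_Chasles; apply ex_RInt_hline; intros t Ht; apply Hc.
    - apply Hrow; [now left|apply between_l].
    - unfold in_box, between in *. simpl in *. revert Ht. unfold Rmin, Rmax.
      destruct Rle_dec; lra. }
  replace (RIntC (fun t => f (t, y')) 0 x' - RIntC (fun t => f (t, y)) 0 x -
     ((x', y') - (x, y)) * f (x, y))%C with
    (RIntC (fun t => f (t, y)) x x' + Ci * RIntC (fun s => f (x', s)) y y'
        - ((x', y') - (x, y)) * f (x, y))%C.
  2:{ transitivity (RIntC (fun t => f (t, y)) x x' + Ci * RIntC (fun s => f (x', s)) y y'
        - ((x', y') - (x, y)) * f (x, y) - RtoC 0)%C; [ring|].
      rewrite <- G, Ch. ring. }
  replace (eps * Cmod ((x', y') - (x, y))) with (2 * (eps / 2) * Cmod ((x', y') - (x, y))%C) by field.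
  apply path_integral_estimate.
  - intros t Ht. apply between_abs in Ht. split.
    + apply Hc. apply Hb; simpl; [lra|]. rewrite Rminus_diag, Rabs_R0. exact Hd1.
    + left. apply Hf2. eapply Rle_lt_trans; [|exact L2].
      replace ((t, y) - (x, y))%C with (RtoC (t - x)) by (apply injective_projections; simpl; ring).
      rewrite Cmod_R. lra.
  - intros s Hs. apply between_abs in Hs. split.
    + apply Hc. apply Hb; simpl; lra.
    + left. apply Hf2. eapply Rle_lt_trans; [|exact L2].
      unfold Cmod. apply sqrt_le_1_alt. simpl. rewrite !Rmult_1_r.
      apply Rplus_le_compat_l. apply Rsqr_le_abs_1. exact Hs.
Qed.

(** * Unique continuation from the imaginary axis *)

Lemma is_Cderive_zero_segment (F : C -> C) (x y r : R) (l : C) : 0 < r ->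
  is_Cderive F (x, y) l -> (forall t, x <= t < x + r -> F (t, y) = RtoC 0) -> l = RtoC 0.
Proof.
  intros Hr HF Hz. apply Cmod_eq_0. apply Rle_antisym; [|apply Cmod_ge_0].
  apply le_epsilon. intros eps He.
  destruct (proj1 (is_Cderive_eps _ _ _) HF eps He) as [d [Hd Hw]].
  set (h := Rmin d r / 2).
  assert (Hh : 0 < h /\ h < d /\ h < r).
  { assert (Rmin d r <= d) by apply Rmin_l. assert (Rmin d r <= r) by apply Rmin_r.
    assert (0 < Rmin d r) by (apply Rmin_glb_lt; lra). unfold h. lra. }
  specialize (Hw (x + h, y)). rewrite (Hz x), (Hz (x + h)) in Hw by lra.
  replace (((x + h)%R, y) - (x, y))%C with (RtoC h) in Hw by (apply injective_projections; simpl; ring).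
  rewrite Cmod_R, Rabs_pos_eq in Hw by lra.
  specialize (Hw ltac:(lra)).
  replace (RtoC 0 - RtoC 0 - RtoC h * l)%C with (- (RtoC h * l))%C in Hw by ring.
  rewrite Cmod_opp, Cmod_mult, Cmod_R, Rabs_pos_eq in Hw by lra.
  apply Rmult_le_reg_r with h; lra.
Qed.

Lemma bounded_by_exp_growth (m K eta : R) : 0 <= m -> 0 < eta ->
  (forall N, 0 <= N -> m * exp (N * eta) <= K) -> m = 0.
Proof.
  intros Hm Heta H. destruct Hm as [Hm|Hm]; [|now symmetry].
  assert (HK : 0 <= K).
  { specialize (H 0 (Rle_refl 0)). rewrite Rmult_0_l, exp_0 in H. lra. }
  (* At this [N] already [1 + x <= exp x] makes the left side at least [m + K]. *)
  assert (HN : 0 <= K / (m * eta)) by (apply Rdiv_le_0_compat; nra).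
  specialize (H (K / (m * eta)) HN).
  assert (E := exp_ge_taylor (K / (m * eta) * eta) 1).
  assert (0 <= K / (m * eta) * eta) by nra.
  specialize (E H0). simpl in E.
  replace (K / (m * eta) * eta) with (K / m) in * by (field; lra).
  assert (m * (1 + K / m) = m + K) by (field; lra).
  nra.
Qed.

(* When [M d = pi / 2], the modulus is 1 on the lines [Im w = c + d] and [Im w = c - d], and
   decreases to the right on [Im w = c]. *)
Definition weight (N M c : R) (w : C) : C :=
  cexp (RtoC N * cexp (- RtoC M * (w - (0, c)))).

Lemma Cmod_weight (N M c x y : R) :
  Cmod (weight N M c (x, y)) = exp (N * (exp (- (M * x)) * cos (M * (y - c)))).
Proof.
  unfold weight. rewrite Cmod_cexp, re_scal_l. do 2 f_equal.
  unfold cexp; simpl. f_equal.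
  - f_equal. ring.
  - rewrite <- cos_neg. f_equal. ring.
Qed.

Lemma is_Cderive_weight_exponent (M c : R) (z : C) :
  is_Cderive (fun w => cexp (- RtoC M * (w - (0, c))))%C z
    (- RtoC M * cexp (- RtoC M * (z - (0, c))))%C.
Proof.
  apply (is_Cderive_comp cexp (fun w => - RtoC M * (w - (0, c)))%C); [apply is_Cderive_cexp|].
  eapply is_Cderive_eq; [|apply is_Cderive_mult; [apply is_Cderive_const|
    apply is_Cderive_minus; [apply is_Cderive_id|apply is_Cderive_const]]].
  cbv beta. ring.
Qed.

Lemma is_Cderive_weight (N M c : R) (z : C) :
  is_Cderive (weight N M c) z
    (- RtoC (N * M) * cexp (- RtoC M * (z - (0, c))) * weight N M c z)%C.
Proof.
  unfold weight. eapply is_Cderive_eq; [|apply (is_Cderive_comp cexp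
    (fun w => RtoC N * cexp (- RtoC M * (w - (0, c))))%C); [apply is_Cderive_cexp|
    apply is_Cderive_mult; [apply is_Cderive_const|apply is_Cderive_weight_exponent]]].
  cbv beta. rewrite RtoC_mult. ring.
Qed.

(** On the left side of the rectangle [F] vanishes. On the other three the weight has modulus at
    most [L = exp (N exp (- M b))]: on the horizontal sides the cosine is 0 and the modulus is 1. At
    [(a, c)] the modulus is [exp (N exp (- M a))], and since [a < b] its ratio to [L] grows
    exponentially in [N], while the maximum principle bounds the product. *)
Lemma weighted_vanishing (F F1 f : C -> C) (b c d a : R) : 0 < b -> 0 < d -> 0 <= a < b ->
  (forall x y, 0 <= x <= b -> c - d <= y <= c + d ->
    is_Cderive F (x, y) (F1 (x, y)) /\ is_Cderive F1 (x, y) (f (x, y))) ->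
  (forall y, c - d <= y <= c + d -> F (0, y) = RtoC 0) ->
  F (a, c) = RtoC 0.
Proof.
  intros Hb Hd Ha HF HF0.
  destruct (continuous_rectangle_max (fun x y => Cmod (F (x, y)) ^ 2) 0 b (c - d) (c + d))
    as [p [q [Hp [Hq Hmax]]]]; [lra|lra| |].
  { intros x y Hx Hy. apply continuity_2d_pt_filterlim.
    destruct (HF x y Hx Hy) as [D0 _]. apply is_Cderive_continuous in D0.
    apply (filterlim_ext (fun z : R * R => (fun r => r ^ 2) (Cmod (F z)))).
    { now intros [s t]. }
    apply (filterlim_comp _ _ _ (fun z : R * R => Cmod (F z)) (fun r => r ^ 2) _
      (locally (Cmod (F (x, y))))).
    - apply filterlim_comp with (1 := D0). exact (filterlim_norm (V := C_NormedModule) (F (x, y))).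
    - apply (ex_derive_continuous (fun r => r ^ 2)). auto_derive. exact I. }
  set (K := Cmod (F (p, q)) ^ 2) in *.
  assert (HK : 0 <= K) by apply pow2_ge_0.
  set (M := PI / (2 * d)).
  assert (HM : 0 < M) by (apply Rdiv_lt_0_compat; [apply PI_RGT_0|lra]).
  assert (HMd : M * d = PI / 2) by (unfold M; field; lra).
  assert (HPI := PI_RGT_0).
  assert (Heta : 0 < exp (- (M * a)) - exp (- (M * b))).
  { apply Rlt_0_minus. apply exp_increasing. nra. }
  assert (Hz : Cmod (F (a, c)) ^ 2 = 0).
  { apply (bounded_by_exp_growth _ K (2 * (exp (- (M * a)) - exp (- (M * b)))));
      [apply pow2_ge_0|lra|].
    intros N HN.
    (* The logarithmic derivative of the weight: [e' = k e] and [k' = - M k], from which both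
       derivatives of [F e] are written down. *)
    set (k := fun z : C => (- RtoC (N * M) * cexp (- RtoC M * (z - (0, c))))%C).
    set (e := weight N M c).
    assert (De : forall z, is_Cderive e z (k z * e z)%C) by (intros z; apply is_Cderive_weight).
    assert (Dk : forall z, is_Cderive k z (- RtoC M * k z)%C).
    { intros z. unfold k. eapply is_Cderive_eq; [|apply is_Cderive_mult;
        [apply is_Cderive_const|apply is_Cderive_weight_exponent]]. cbv beta. ring. }
    set (L := exp (N * exp (- (M * b)))).
    assert (HL : 0 < L) by apply exp_pos.
    assert (Hbd := maximum_modulus_rectangle (fun z => F z * e z)%C
      (fun z => (F1 z + F z * k z) * e z)%C
      (fun z => (f z + (F1 z * k z + F z * (- RtoC M * k z)) + (F1 z + F z * k z) * k z) * e z)%C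
      0 b (c - d) (c + d) (K * L ^ 2) ltac:(lra) ltac:(lra)).
    lapply Hbd; [clear Hbd; intros Hbd|].
    2:{ intros x y Hx Hy. destruct (HF x y Hx Hy) as [D0 D1]. split.
        - eapply is_Cderive_eq; [|apply is_Cderive_mult; [exact D0|apply De]]. cbv beta. ring.
        - eapply is_Cderive_eq; [|apply is_Cderive_mult; [apply is_Cderive_plus;
            [exact D1|apply is_Cderive_mult; [exact D0|apply Dk]]|apply De]]. cbv beta. ring. }
    lapply Hbd; [clear Hbd; intros Hbd|].
    2:{ intros x y Hx Hy Hside. rewrite Cmod_mult, Rpow_mult_distr.
        assert (HFK : Cmod (F (x, y)) ^ 2 <= K) by (apply Hmax; assumption).
        destruct Hside as [->|Hside].
        { rewrite HF0, Cmod_0 by exact Hy. simpl. assert (0 <= K * (L * (L * 1))) by nra. lra. }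
        apply Rmult_le_compat; [apply pow2_ge_0|apply pow2_ge_0|exact HFK|].
        apply pow_incr. split; [apply Cmod_ge_0|].
        unfold e. rewrite Cmod_weight. unfold L.
        assert (Hexp : forall u v, u <= v -> exp u <= exp v).
        { intros u v [Huv|Huv]; [left; now apply exp_increasing|right; now rewrite Huv]. }
        apply Hexp. apply Rmult_le_compat_l; [exact HN|].
        assert (E0 := exp_pos (- (M * b))). assert (E1 := exp_pos (- (M * x))).
        destruct Hside as [->|[->| ->]].
        - assert (C1 := COS_bound (M * (y - c))). nra.
        - replace (M * (c - d - c)) with (- (PI / 2)) by (rewrite <- HMd; ring).
          rewrite cos_neg, cos_PI2. lra.
        - replace (M * (c + d - c)) with (PI / 2) by (rewrite <- HMd; ring).
          rewrite cos_PI2. lra. }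
    specialize (Hbd a c ltac:(lra) ltac:(lra)). cbv beta in Hbd.
    rewrite Cmod_mult, Rpow_mult_distr in Hbd. unfold e in Hbd. rewrite Cmod_weight in Hbd.
    rewrite Rminus_diag, Rmult_0_r, cos_0, Rmult_1_r in Hbd.
    set (T := exp (N * exp (- (M * a)))) in *.
    assert (HT : T ^ 2 = L ^ 2 * exp (N * (2 * (exp (- (M * a)) - exp (- (M * b)))))).
    { unfold T, L. simpl. rewrite !Rmult_1_r, <- !exp_plus. f_equal. ring. }
    rewrite HT in Hbd.
    apply Rmult_le_reg_r with (L ^ 2); [apply pow_lt; exact HL|]. lra. }
  apply Cmod_eq_0. destruct (Rmult_integral _ _ Hz) as [H|H]; [exact H|].
  rewrite Rmult_1_r in H. exact H.
Qed.

(* The second primitive of [f] is regular enough for the maximum principle; letting [N] tend to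
   infinity in the weight shows that it vanishes. *)
Lemma holomorphic_zero_on_axis (f : C -> C) (A V1 V2 : R) :
  (forall z, in_box A V1 V2 z -> exists l, is_Cderive f z l) ->
  (forall y, V1 < y < V2 -> f (0, y) = RtoC 0) ->
  forall x y, 0 <= x < A -> V1 < y < V2 -> f (x, y) = RtoC 0.
Proof.
  intros Hf Hf0.
  set (F1 := fun w : C => RIntC (fun t => f (t, Im w)) 0 (Re w)).
  assert (D1 : forall z, in_box A V1 V2 z -> is_Cderive F1 z (f z)).
  { exact (primitive_in_box f A V1 V2 Hf Hf0). }
  assert (Z : forall g y, (fun w : C => RIntC (fun t => g (t, Im w)) 0 (Re w)) (0, y) = RtoC 0).
  { intros g y. cbv beta. simpl. exact (RInt_point (V := C_R_CompleteNormedModule) 0 _). }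
  set (F2 := fun w : C => RIntC (fun t => F1 (t, Im w)) 0 (Re w)).
  assert (D2 : forall z, in_box A V1 V2 z -> is_Cderive F2 z (F1 z)).
  { apply primitive_in_box.
    - intros z Hz. exists (f z). now apply D1.
    - intros y _. apply Z. }
  assert (ZF2 : forall x y, 0 <= x < A -> V1 < y < V2 -> F2 (x, y) = RtoC 0).
  { intros x y Hx Hy.
    set (d := Rmin (y - V1) (V2 - y) / 2).
    assert (Hd : 0 < d /\ d < y - V1 /\ d < V2 - y).
    { assert (Rmin (y - V1) (V2 - y) <= y - V1) by apply Rmin_l.
      assert (Rmin (y - V1) (V2 - y) <= V2 - y) by apply Rmin_r.
      assert (0 < Rmin (y - V1) (V2 - y)) by (apply Rmin_glb_lt; lra). unfold d. lra. }
    (* The right side is placed halfway between [x] and [A], beyond the point and still inside the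
       box. *)
    apply (weighted_vanishing F2 F1 f ((x + A) / 2) y d x); [lra|lra|lra| |].
    - intros s t Hs Ht. split; [apply D2|apply D1]; unfold in_box; simpl; lra.
    - intros t _. apply Z. }
  assert (ZF1 : forall x y, 0 <= x < A -> V1 < y < V2 -> F1 (x, y) = RtoC 0).
  { intros x y Hx Hy. apply (is_Cderive_zero_segment F2 x y (A - x)); [lra| |].
    - apply D2. unfold in_box; simpl; lra.
    - intros t Ht. apply ZF2; lra. }
  intros x y Hx Hy. apply (is_Cderive_zero_segment F1 x y (A - x)); [lra| |].
  - apply D1. unfold in_box; simpl; lra.
  - intros t Ht. apply ZF1; lra.
Qed.

(** * Dominated convergence of series *)

Lemma is_series_sum_n_le (M : nat -> R) (n : nat) : (forall k, 0 <= M k) -> ex_series M ->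
  sum_n M n <= Series M.
Proof.
  intros HM Hex.
  assert (H : is_lim_seq (sum_n M) (Series M)) by exact (Series_correct M Hex).
  apply (is_lim_seq_incr_compare (sum_n M) (Series M) H).
  intros m. rewrite sum_Sn. unfold plus; simpl. specialize (HM (S m)). lra.
Qed.

Lemma norm_series_tail {K : AbsRing} {V : NormedModule K} (a : nat -> V) (s : V)
    (M : nat -> R) (N : nat) :
  ex_series M -> (forall k, norm (a k) <= M k) -> is_series a s ->
  norm (minus s (sum_n a N)) <= Series M - sum_n M N.
Proof.
  intros HM Ha Hs.
  assert (Hpos : forall k, 0 <= M k).
  { intros k. exact (Rle_trans _ _ _ (norm_ge_0 (a k)) (Ha k)). }
  assert (Hfin : forall m, norm (minus (sum_n a (N + m)) (sum_n a N)) <= sum_n M (N + m) - sum_n M N).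
  { induction m as [|m IH].
    - rewrite Nat.add_0_r, minus_eq_zero.
      rewrite Rminus_diag. right. exact norm_zero.
    - rewrite Nat.add_succ_r.
      assert (E : sum_n M (S (N + m)) = sum_n M (N + m) + M (S (N + m))) by exact (sum_Sn M _).
      rewrite E, (sum_Sn a).
      replace (minus (plus (sum_n a (N + m)) (a (S (N + m)))) (sum_n a N)) with
        (plus (minus (sum_n a (N + m)) (sum_n a N)) (a (S (N + m)))).
      2:{ unfold minus. rewrite <- !plus_assoc. f_equal. apply plus_comm. }
      eapply Rle_trans; [apply norm_triangle|]. specialize (Ha (S (N + m))).
      lra. }
  apply le_epsilon. intros eps Heps.
  destruct (proj1 (filterlim_locally_ball_norm _ _) Hs (mkposreal eps Heps)) as [m Hm].
  specialize (Hm (N + m)%nat ltac:(lia)). unfold ball_norm in Hm. simpl in Hm.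
  replace (minus s (sum_n a N)) with
    (plus (minus (sum_n a (N + m)) (sum_n a N)) (opp (minus (sum_n a (N + m)) s))).
  2:{ rewrite opp_minus, plus_comm. unfold minus. rewrite <- plus_assoc.
      f_equal. rewrite plus_assoc, plus_opp_l, plus_zero_l. reflexivity. }
  eapply Rle_trans; [apply norm_triangle|]. rewrite norm_opp.
  assert (H1 := is_series_sum_n_le M (N + m) Hpos HM). specialize (Hfin m). lra.
Qed.

Lemma filterlim_sum_n {T : Type} {F : (T -> Prop) -> Prop} {FF : Filter F}
    {K : AbsRing} {V : NormedModule K} (f : nat -> T -> V) (l : nat -> V) (n : nat) :
  (forall k, filterlim (f k) F (locally (l k))) ->
  filterlim (fun x => sum_n (fun k => f k x) n) F (locally (sum_n l n)).
Proof.
  intros H. induction n as [|n IH].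
  - rewrite sum_O. apply (filterlim_ext (f O)); [|apply H]. intros x. now rewrite sum_O.
  - rewrite sum_Sn.
    apply (filterlim_ext (fun x => plus (sum_n (fun k => f k x) n) (f (S n) x))).
    { intros x. now rewrite sum_Sn. }
    eapply filterlim_comp_2; [exact IH|apply H|apply filterlim_plus].
Qed.

(** Past a common index the tails are controlled by the tail of [M], uniformly in [x], and the
    finitely many other terms converge. The filter is arbitrary because the limits to come are along
    sequences, partial sums, one-sided and punctured neighbourhoods. *)
Lemma Tannery {T : Type} {F : (T -> Prop) -> Prop} {FF : Filter F}
    {K : AbsRing} {V : NormedModule K} (f : nat -> T -> V) (l : nat -> V) (M : nat -> R)
    (s : T -> V) (S : V) :
  ex_series M -> (forall k, filterlim (f k) F (locally (l k))) ->
  F (fun x => (forall k, norm (f k x) <= M k) /\ is_series (fun k => f k x) (s x)) ->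
  is_series l S -> filterlim s F (locally S).
Proof.
  intros HM Hf Hs HS. apply filterlim_locally_ball_norm. intros eps.
  assert (He : 0 < eps / 3) by (assert (H := cond_pos eps); lra).
  assert (HM' : filterlim (sum_n M) eventually (locally (Series M))) by exact (Series_correct M HM).
  destruct (proj1 (filterlim_locally_ball_norm _ _) HM' (mkposreal _ He)) as [n1 H1].
  destruct (proj1 (filterlim_locally_ball_norm _ _) HS (mkposreal _ He)) as [n2 H2].
  set (n := Nat.max n1 n2).
  specialize (H1 n ltac:(lia)). specialize (H2 n ltac:(lia)).
  assert (H3 := proj1 (filterlim_locally_ball_norm _ _) (filterlim_sum_n f l n Hf) (mkposreal _ He)).
  generalize (filter_and _ _ Hs H3). apply filter_imp. intros x [[Hx1 Hx2] Hx3].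
  assert (H4 := norm_series_tail _ _ M n HM Hx1 Hx2).
  unfold ball_norm in *. simpl in *.
  assert (H1' : Series M - sum_n M n < eps / 3).
  { change (Rabs (sum_n M n - Series M) < eps / 3) in H1. apply Rabs_def2 in H1. lra. }
  replace (minus (s x) S) with (plus (minus (s x) (sum_n (fun k => f k x) n))
    (plus (minus (sum_n (fun k => f k x) n) (sum_n l n)) (minus (sum_n l n) S))).
  2:{ unfold minus. rewrite <- !plus_assoc. f_equal.
      rewrite plus_assoc, plus_opp_l, plus_zero_l.
      rewrite plus_assoc, plus_opp_l, plus_zero_l. reflexivity. }
  eapply Rle_lt_trans; [apply norm_triangle|].
  eapply Rle_lt_trans; [apply Rplus_le_compat_l, norm_triangle|]. lra.
Qed.

(** Comparison with a telescoping series: [1 / m^2 <= 2 / (m (m + 1)) = 2 (1 / m - 1 / (m + 1))]. *)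
Lemma ex_series_inv_sqr : ex_series (fun n => / INR (S n) ^ 2).
Proof.
  assert (H : ex_series (fun n => 2 * (/ INR (S n) - / INR (S (S n))))).
  { apply (ex_series_scal (V := R_NormedModule) 2). exists 1.
    enough (E : is_lim_seq (sum_n (fun n => / INR (S n) - / INR (S (S n)))) 1) by exact E.
    apply (is_lim_seq_ext (fun n => 1 - / INR (S (S n)))).
    - induction n as [|n IH].
      + rewrite sum_O. simpl. field.
      + rewrite sum_Sn, <- IH. unfold plus; simpl. ring.
    - replace (Finite 1) with (Finite (1 - 0)) by (f_equal; ring).
      apply is_lim_seq_minus'; [apply is_lim_seq_const|].
      apply (is_lim_seq_ext (fun n => / INR (n + 2))); [intros n; do 2 f_equal; lia|].
      apply -> (is_lim_seq_incr_n (fun n => / INR n) 2).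
      exact (is_lim_seq_inv INR p_infty is_lim_seq_INR ltac:(discriminate)). }
  apply (ex_series_le (K := R_AbsRing) (V := R_CompleteNormedModule) _ _) with (2 := H).
  intros n. change (Rabs (/ INR (S n) ^ 2) <= 2 * (/ INR (S n) - / INR (S (S n)))).
  rewrite (S_INR (S n)). assert (Hn := lt_0_INR (S n) ltac:(lia)).
  rewrite S_INR in *. set (x := INR n + 1) in *.
  assert (H1x : 1 <= x) by (unfold x; assert (H0 := pos_INR n); lra).
  rewrite Rabs_pos_eq by (left; apply Rinv_0_lt_compat; nra).
  apply Rmult_le_reg_r with (x ^ 2 * (x + 1)); [nra|].
  field_simplify; [|lra|lra]. lra.
Qed.

(** * Complex series and termwise differentiation *)

Notation is_Cseries := (@is_series C_AbsRing C_NormedModule).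
Notation ex_Cseries := (@ex_series C_AbsRing C_NormedModule).

Lemma filterlim_Cmod {T : Type} {F : (T -> Prop) -> Prop} {FF : Filter F} (f : T -> C) (l : C) :
  filterlim f F (locally l) <-> forall eps, 0 < eps -> F (fun x => Cmod (f x - l) < eps).
Proof.
  rewrite (filterlim_locally_ball_norm (U := C_NormedModule) f l). split.
  - intros H eps He. exact (H (mkposreal eps He)).
  - intros H eps. exact (H eps (cond_pos eps)).
Qed.

Lemma is_Cseries_unique (a : nat -> C) (l l' : C) :
  is_Cseries a l -> is_Cseries a l' -> l = l'.
Proof. intros H H'. exact (filterlim_locally_unique (V := C_NormedModule) _ _ _ H H'). Qed.

Lemma is_Cseries_mult_r (a : nat -> C) (l k : C) :
  is_Cseries a l -> is_Cseries (fun n => a n * k)%C (l * k)%C.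
Proof.
  intros H. apply (is_series_ext (fun n => scal k (a n))).
  { intros n. apply Cmult_comm. }
  rewrite Cmult_comm. exact (is_series_scal k a l H).
Qed.

Lemma is_Cseries_RtoC (a : nat -> R) (l : R) :
  is_series a l -> is_Cseries (fun n => RtoC (a n)) (RtoC l).
Proof.
  intros H. apply filterlim_Cmod. intros eps He.
  generalize (proj1 (filterlim_locally_ball_norm _ _) H (mkposreal eps He)).
  apply filter_imp. intros n Hn.
  set (b := fun n => RtoC (a n)).
  assert (E : @sum_n (NormedModule.AbelianMonoid C_AbsRing C_NormedModule) b n = RtoC (sum_n a n)).
  { clear Hn. induction n as [|n IH].
    - now rewrite !sum_O.
    - rewrite !sum_Sn, IH. symmetry. exact (RtoC_plus _ _). }
  rewrite E, <- RtoC_minus, Cmod_R. exact Hn.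
Qed.

(** The form suited to dominated convergence: the difference quotient of a series is the series of
    the difference quotients. *)
Lemma is_Cderive_quotient (f : C -> C) (z l : C) :
  is_Cderive f z l <->
  filterlim (fun w => (f w - f z) / (w - z))%C (within (fun w => w <> z) (locally z)) (locally l).
Proof.
  rewrite is_Cderive_eps, filterlim_Cmod. 
  assert (Hd : forall w, w <> z -> (f w - f z - (w - z) * l)%C =
    ((w - z) * ((f w - f z) / (w - z) - l))%C).
  { intros w Hw. field. intros E. apply Hw. apply Ceq_minus. exact E. }
  assert (Hp : forall w, w <> z -> 0 < Cmod (w - z)).
  { intros w Hw. apply Cmod_gt_0. intros E. apply Hw. apply Ceq_minus. exact E. }
  split.
  - intros H eps He. destruct (H (eps / 2) ltac:(lra)) as [d Hw].
    apply locally_Cmod. exists d. split; [apply Hw|]. intros w Hwd Hne.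
    destruct Hw as [_ Hw]. specialize (Hw w Hwd). rewrite Hd, Cmod_mult in Hw by exact Hne.
    specialize (Hp w Hne).
    assert (Cmod ((f w - f z) / (w - z) - l)%C <= eps / 2); [|lra].
    apply Rmult_le_reg_l with (Cmod (w - z)); lra.
  - intros H eps He. specialize (H eps He). apply locally_Cmod in H.
    destruct H as [d [Hd0 Hw]]. exists d. split; [exact Hd0|]. intros w Hwd.
    destruct (classic (w = z)) as [->|Hne].
    + replace (f z - f z - (z - z) * l)%C with (RtoC 0) by ring.
      rewrite Cmod_0. apply Rmult_le_pos; [lra|apply Cmod_ge_0].
    + rewrite Hd, Cmod_mult by exact Hne. specialize (Hw w Hwd Hne). cbv beta in Hw.
      specialize (Hp w Hne). nra.
Qed.

Lemma is_Cderive_pow (n : nat) (z : C) :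
  is_Cderive (fun w => w ^ n)%C z (RtoC (INR n) * z ^ pred n)%C.
Proof.
  induction n as [|n IH].
  - simpl. eapply is_Cderive_eq; [|apply is_Cderive_const]. ring.
  - apply (is_Cderive_ext (fun w => w * w ^ n)%C); [reflexivity|].
    eapply is_Cderive_eq; [|apply is_Cderive_mult; [apply is_Cderive_id|exact IH]].
    cbv beta. rewrite S_INR, RtoC_plus. simpl pred. destruct n as [|n].
    + simpl. ring.
    + simpl pred. simpl Cpow. ring.
Qed.

(** Supplies a majorant, independent of [w], for the difference quotients of powers. *)
Lemma Cmod_pow_minus (w z : C) (r : R) (n : nat) : Cmod w <= r -> Cmod z <= r ->
  Cmod (w ^ n - z ^ n) <= INR n * r ^ pred n * Cmod (w - z).
Proof.
  intros Hw Hz.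
  assert (Hr : 0 <= r) by (eapply Rle_trans; [apply Cmod_ge_0|exact Hw]).
  induction n as [|n IH].
  - simpl. replace (1 - 1)%C with (RtoC 0) by ring. rewrite Cmod_0. lra.
  - replace (w ^ S n - z ^ S n)%C with (w * (w ^ n - z ^ n) + (w - z) * z ^ n)%C
      by (simpl; ring).
    eapply Rle_trans; [apply Cmod_triangle|]. rewrite !Cmod_mult, Cmod_pow, S_INR.
    assert (H1 : Cmod z ^ n <= r ^ n) by (apply pow_incr; split; [apply Cmod_ge_0|exact Hz]).
    assert (H2 : Cmod w * Cmod (w ^ n - z ^ n) <= r * (INR n * r ^ pred n * Cmod (w - z))).
    { apply Rmult_le_compat; trivial; apply Cmod_ge_0. }
    assert (H3 : r * (INR n * r ^ pred n * Cmod (w - z)) = INR n * r ^ n * Cmod (w - z)).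
    { destruct n; simpl; ring. }
    simpl pred. assert (H4 := Cmod_ge_0 (w - z)). nra.
Qed.

(** The exponents are a function [p], so that series in even powers are covered without zero
    coefficients. From [n < p n] one gets [r^(p n - 1) <= r^n], and [B r^n] dominates the
    differentiated series. *)
Lemma is_Cderive_power_sum (c : nat -> C) (p : nat -> nat) (B : R) (g : C -> C) :
  (forall n, (n < p n)%nat) -> (forall n, Cmod (c n) * INR (p n) <= B) ->
  (forall z, Cmod z < 1 -> is_Cseries (fun n => c n * z ^ p n)%C (g z)) ->
  forall z, Cmod z < 1 -> exists l, is_Cderive g z l /\
    is_Cseries (fun n => c n * (RtoC (INR (p n)) * z ^ pred (p n)))%C l.
Proof.
  intros Hp HB Hg z Hz.
  (* Strictly between [|z|] and 1, so that all points near [z] lie in the disc of radius [r]. *)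
  set (r := (1 + Cmod z) / 2).
  assert (Hz0 := Cmod_ge_0 z).
  assert (Hr : Cmod z < r < 1) by (unfold r; lra).
  assert (Hgeo : ex_series (fun n => B * r ^ n)).
  { apply (ex_series_scal (V := R_NormedModule) B). exists (/ (1 - r)).
    apply is_series_geom. rewrite Rabs_pos_eq; lra. }
  assert (HB0 : 0 <= B).
  { eapply Rle_trans; [|apply (HB O)]. apply Rmult_le_pos; [apply Cmod_ge_0|apply pos_INR]. }
  assert (Hpow : forall n, Cmod (c n) * (INR (p n) * r ^ pred (p n)) <= B * r ^ n).
  { intros n. rewrite <- Rmult_assoc. apply Rmult_le_compat.
    - apply Rmult_le_pos; [apply Cmod_ge_0|apply pos_INR].
    - apply pow_le; lra.
    - apply HB.
    - specialize (Hp n). replace (pred (p n)) with (n + (pred (p n) - n))%nat by lia.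
      rewrite pow_add. assert (0 <= r ^ n) by (apply pow_le; lra).
      assert (r ^ (pred (p n) - n) <= 1) by (rewrite <- (pow1 (pred (p n) - n)); apply pow_incr; lra).
      nra. }
  set (l := fun n => (c n * (RtoC (INR (p n)) * z ^ pred (p n)))%C).
  assert (Hl : ex_Cseries l).
  { apply (ex_series_le (K := C_AbsRing) (V := C_CompleteNormedModule) l _) with (2 := Hgeo).
    intros n. change (Cmod (l n) <= B * r ^ n). eapply Rle_trans; [|apply Hpow].
    unfold l. rewrite !Cmod_mult, Cmod_R, Rabs_pos_eq, Cmod_pow by apply pos_INR.
    apply Rmult_le_compat_l; [apply Cmod_ge_0|]. apply Rmult_le_compat_l; [apply pos_INR|].
    apply pow_incr. lra. }
  destruct Hl as [L HL]. exists L. split; [|exact HL]. apply is_Cderive_quotient.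
  apply (Tannery (K := C_AbsRing) (V := C_NormedModule)
    (fun n w => c n * ((w ^ p n - z ^ p n) / (w - z)))%C l (fun n => B * r ^ n)).
  - exact Hgeo.
  - intros k. assert (H := proj1 (is_Cderive_quotient _ _ _) (is_Cderive_pow (p k) z)).
    unfold l. apply (filterlim_comp _ _ _ (fun w => (w ^ p k - z ^ p k) / (w - z))%C
      (fun y => c k * y)%C _ _ _ H).
    apply (is_Cderive_continuous (fun y => c k * y)%C _ (c k)).
    eapply is_Cderive_eq; [|apply is_Cderive_mult; [apply is_Cderive_const|apply is_Cderive_id]].
    cbv beta. ring.
  - apply locally_Cmod. exists (r - Cmod z). split; [lra|]. intros w Hw Hne.
    assert (Hwr : Cmod w <= r).
    { replace w with ((w - z) + z)%C by ring. assert (T := Cmod_triangle (w - z) z). lra. }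
    assert (Hwz : (w - z)%C <> RtoC 0) by (intros E; apply Hne, Ceq_minus, E).
    assert (Hm : 0 < Cmod (w - z)) by now apply Cmod_gt_0.
    split.
    + intros k. change (Cmod (c k * ((w ^ p k - z ^ p k) / (w - z)))%C <= B * r ^ k).
      eapply Rle_trans; [|apply Hpow]. rewrite Cmod_mult, Cmod_div by exact Hwz.
      apply Rmult_le_compat_l; [apply Cmod_ge_0|].
      apply Rmult_le_reg_r with (Cmod (w - z)); [exact Hm|].
      replace (Cmod (w ^ p k - z ^ p k) / Cmod (w - z) * Cmod (w - z)) with
        (Cmod (w ^ p k - z ^ p k)) by (field; lra).
      apply Cmod_pow_minus; lra.
    + assert (H := is_series_minus (V := C_NormedModule) _ _ _ _ (Hg w ltac:(lra)) (Hg z Hz)).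
      apply (is_Cseries_mult_r _ _ (/ (w - z))%C) in H.
      eapply is_series_ext; [|exact H]. intros n. 
      change ((c n * w ^ p n - c n * z ^ p n) * / (w - z) = c n * ((w ^ p n - z ^ p n) / (w - z)))%C.
      field. exact Hwz.
  - exact HL.
Qed.

(** * The series on the left-hand side *)

Lemma ex_series_zeta (s : nat) : (2 <= s)%nat -> ex_series (fun n => / INR (S n) ^ s).
Proof.
  intros Hs.
  apply (ex_series_le (K := R_AbsRing) (V := R_CompleteNormedModule) _ _) with (2 := ex_series_inv_sqr).
  intros n. change (Rabs (/ INR (S n) ^ s) <= / INR (S n) ^ 2).
  assert (Hn : 1 <= INR (S n)) by (rewrite S_INR; assert (H0 := pos_INR n); lra).
  rewrite Rabs_pos_eq by (left; apply Rinv_0_lt_compat, pow_lt; lra).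
  apply Rinv_le_contravar; [apply pow_lt; lra|]. now apply Rle_pow.
Qed.

Lemma zeta_bounds (s : nat) : (2 <= s)%nat -> 0 <= zeta s <= zeta 2.
Proof.
  intros Hs.
  assert (Hn : forall n, 1 <= INR (S n)) by (intros n; rewrite S_INR; assert (H0 := pos_INR n); lra).
  split.
  - assert (Hpos : forall n, 0 <= / INR (S n) ^ s).
    { intros k. left; apply Rinv_0_lt_compat, pow_lt. specialize (Hn k). lra. }
    eapply Rle_trans; [apply (Hpos O)|].
    rewrite <- (sum_O (fun n => / INR (S n) ^ s)).
    exact (is_series_sum_n_le _ O Hpos (ex_series_zeta s Hs)).
  - apply Series_le; [|apply ex_series_inv_sqr]. intros n. split.
    + left; apply Rinv_0_lt_compat, pow_lt. specialize (Hn n). lra.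
    + apply Rinv_le_contravar; [apply pow_lt; specialize (Hn n); lra|]. now apply Rle_pow.
Qed.

Definition coef (n : nat) : R :=
  (-1) ^ n * zeta (2 * S n) / ((2 * INR (S n) + 1) * (INR (S n) + 1)).

Lemma thm14_term_coef (z : C) (n : nat) : thm14_term z (S n) = (RtoC (coef n) * z ^ (2 * S n))%C.
Proof.
  unfold thm14_term, coef. assert (Hn := pos_INR (S n)).
  rewrite RtoC_div by nra. replace (S n - 1)%nat with n by lia.
  unfold Cdiv. ring.
Qed.

Lemma Rabs_coef_le (n : nat) : Rabs (coef n) <= zeta 2 / ((2 * INR (S n) + 1) * (INR (S n) + 1)).
Proof.
  assert (Hn := pos_INR (S n)). unfold coef, Rdiv.
  assert (0 < / ((2 * INR (S n) + 1) * (INR (S n) + 1))) by (apply Rinv_0_lt_compat; nra).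
  rewrite !Rabs_mult, pow_1_abs, Rmult_1_l, (Rabs_pos_eq (/ _)) by lra.
  assert (Hz := zeta_bounds (2 * S n) ltac:(lia)). rewrite Rabs_pos_eq by apply Hz.
  apply Rmult_le_compat_r; lra.
Qed.

Lemma coef_mult_le (n : nat) : Rabs (coef n) * INR (2 * S n) <= zeta 2.
Proof.
  assert (Hn := pos_INR (S n)). assert (Hz := zeta_bounds 2 (Nat.le_refl 2)).
  eapply Rle_trans; [apply Rmult_le_compat_r; [apply pos_INR|apply Rabs_coef_le]|].
  rewrite mult_INR. simpl (INR 2). set (x := INR (S n)) in *.
  apply Rmult_le_reg_r with ((2 * x + 1) * (x + 1)); [nra|].
  replace (zeta 2 / ((2 * x + 1) * (x + 1)) * ((1 + 1) * x) * ((2 * x + 1) * (x + 1)))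
    with (zeta 2 * (2 * x)) by (field; lra).
  apply Rmult_le_compat_l; [lra|nra].
Qed.

(** Quadratic decay gives a majorant on the whole closed disk, and with it continuity up to the unit
    circle. *)
Lemma coef_sqr_le (n : nat) : Rabs (coef n) <= zeta 2 * / INR (S n) ^ 2.
Proof.
  eapply Rle_trans; [apply Rabs_coef_le|]. assert (Hz := zeta_bounds 2 (Nat.le_refl 2)).
  apply Rmult_le_compat_l; [lra|].
  assert (Hn := lt_0_INR (S n) ltac:(lia)). apply Rinv_le_contravar; nra.
Qed.

Lemma ex_series_coef_bound : ex_series (fun n => zeta 2 * / INR (S n) ^ 2).
Proof. apply (ex_series_scal (V := R_NormedModule) (zeta 2)). exact ex_series_inv_sqr. Qed.

Lemma Cmod_thm14_term_le (z : C) (n : nat) : Cmod z <= 1 ->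
  Cmod (thm14_term z (S n)) <= zeta 2 * / INR (S n) ^ 2.
Proof.
  intros Hz. rewrite thm14_term_coef, Cmod_mult, Cmod_R, Cmod_pow.
  assert (H := coef_sqr_le n).
  assert (H2 : Cmod z ^ (2 * S n) <= 1).
  { rewrite <- (pow1 (2 * S n)). apply pow_incr. split; [apply Cmod_ge_0|exact Hz]. }
  assert (H3 : 0 <= Cmod z ^ (2 * S n)) by (apply pow_le, Cmod_ge_0).
  assert (H4 := Rabs_pos (coef n)). nra.
Qed.

(** A sum chosen by [epsilon], to have a total function on [C]; its value is meaningful wherever the
    series converges, in particular on the closed disk. *)
Definition thm14_sum (z : C) : C :=
  epsilon (inhabits (RtoC 0)) (fun l => is_Cseries (fun n => thm14_term z (S n)) l).

Lemma thm14_sum_correct (z : C) : Cmod z <= 1 ->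
  is_Cseries (fun n => thm14_term z (S n)) (thm14_sum z).
Proof.
  intros Hz. unfold thm14_sum. apply epsilon_spec.
  apply (ex_series_le (K := C_AbsRing) (V := C_CompleteNormedModule) _ _)
    with (2 := ex_series_coef_bound).
  intros n. now apply Cmod_thm14_term_le.
Qed.

Lemma ex_derive_thm14_sum (z : C) : Cmod z < 1 -> exists l, is_Cderive thm14_sum z l.
Proof.
  intros Hz.
  destruct (is_Cderive_power_sum (fun n => RtoC (coef n)) (fun n => 2 * S n)%nat (zeta 2) thm14_sum)
    with (z := z) as [l [Hl _]]; [| | |exact Hz|now exists l].
  - intros n. lia.
  - intros n. rewrite Cmod_R. apply coef_mult_le.
  - intros w Hw. eapply is_series_ext; [|apply thm14_sum_correct; lra].
    intros n. apply thm14_term_coef.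
Qed.

Lemma filterlim_thm14_sum {F : (C -> Prop) -> Prop} {FF : Filter F} (z : C) :
  Cmod z <= 1 -> filterlim (fun w => w) F (locally z) -> F (fun w => Cmod w <= 1) ->
  filterlim thm14_sum F (locally (thm14_sum z)).
Proof.
  intros Hz Hid HF.
  apply (Tannery (K := C_AbsRing) (V := C_NormedModule) (fun n w => thm14_term w (S n))
    (fun n => thm14_term z (S n)) (fun n => zeta 2 * / INR (S n) ^ 2)).
  - exact ex_series_coef_bound.
  - intros k. apply (filterlim_comp _ _ _ (fun w => w) (fun w => thm14_term w (S k)) _ _ _ Hid).
    rewrite thm14_term_coef.
    apply (filterlim_ext (fun w => RtoC (coef k) * w ^ (2 * S k))%C).
    { intros w. now rewrite thm14_term_coef. }
    apply (is_Cderive_continuous (fun w => RtoC (coef k) * w ^ (2 * S k))%C z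
      (RtoC 0 * z ^ (2 * S k) + RtoC (coef k) * (RtoC (INR (2 * S k)) * z ^ pred (2 * S k)))%C).
    apply is_Cderive_mult; [apply is_Cderive_const|apply is_Cderive_pow].
  - revert HF. apply filter_imp. intros w Hw. split.
    + intros k. now apply Cmod_thm14_term_le.
    + now apply thm14_sum_correct.
  - now apply thm14_sum_correct.
Qed.

(** * Partial fractions of the hyperbolic cotangent *)

(* [re_coth x b] is the real part of [coth (x + i b)]. *)
Definition re_coth (x b : R) : R := sinh x * cosh x / (sinh x ^ 2 + sin b ^ 2).

Lemma cosh_sqr (x : R) : cosh x ^ 2 = 1 + sinh x ^ 2.
Proof.
  unfold cosh, sinh. assert (H : exp x * exp (- x) = 1).
  { rewrite <- exp_plus, Rplus_opp_r. apply exp_0. }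
  nra.
Qed.

Lemma sinh_gt_0 (x : R) : 0 < x -> 0 < sinh x.
Proof. intros H. unfold sinh. assert (exp (- x) < exp x) by (apply exp_increasing; lra). lra. Qed.

Lemma cosh_gt_0 (x : R) : 0 < cosh x.
Proof. unfold cosh. assert (H := exp_pos x). assert (H' := exp_pos (- x)). lra. Qed.

Lemma sinh_double (x : R) : sinh (2 * x) = 2 * sinh x * cosh x.
Proof.
  unfold sinh, cosh. replace (2 * x) with (x + x) by ring.
  rewrite Ropp_plus_distr, !exp_plus. field.
Qed.

Lemma cosh_double (x : R) : cosh (2 * x) = 1 + 2 * sinh x ^ 2.
Proof.
  unfold sinh, cosh. replace (2 * x) with (x + x) by ring.
  rewrite Ropp_plus_distr, !exp_plus. assert (H : exp x * exp (- x) = 1).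
  { rewrite <- exp_plus, Rplus_opp_r. apply exp_0. }
  nra.
Qed.

(** The real part of [2 coth (2 w) = coth w + coth (w + i pi / 2)] at [w = u + i v]. Only the
    squared sine of the angle enters, so [pi / 2 + v] may be replaced by [pi / 2 - v], which stays
    in [[0, pi / 2]]. *)
Lemma re_coth_double (u v : R) : 0 < u ->
  2 * re_coth (2 * u) (2 * v) = re_coth u v + re_coth u (PI / 2 - v).
Proof.
  intros Hu. unfold re_coth. rewrite sinh_double, cosh_double, sin_2a, sin_shift.
  assert (Hs := sinh_gt_0 u Hu). assert (Hc := cosh_sqr u). assert (Hsc := sin2_cos2 v).
  unfold Rsqr in Hsc.
  replace (cos v ^ 2) with (1 - sin v ^ 2) by nra.
  replace ((2 * sinh u * cosh u) ^ 2 + (2 * sin v * cos v) ^ 2) with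
    (4 * ((sinh u ^ 2 + sin v ^ 2) * (sinh u ^ 2 + (1 - sin v ^ 2)))).
  2:{ replace ((2 * sinh u * cosh u) ^ 2) with (4 * sinh u ^ 2 * cosh u ^ 2) by ring.
      replace ((2 * sin v * cos v) ^ 2) with (4 * sin v ^ 2 * (cos v * cos v)) by ring.
      rewrite Hc. replace (cos v * cos v) with (1 - sin v ^ 2) by nra. ring. }
  assert (0 <= sin v ^ 2) by apply pow2_ge_0. assert (0 <= cos v * cos v) by nra.
  assert (0 < sinh u ^ 2) by nra.
  field. split; nra.
Qed.

Lemma sum_f_R0_rev (f : nat -> R) (n : nat) :
  sum_f_R0 (fun i => f (n - i)%nat) n = sum_f_R0 f n.
Proof.
  revert f. induction n as [|n IH]; intros f; [reflexivity|].
  rewrite tech5, (decomp_sum f (S n)) by lia. rewrite Nat.sub_diag. simpl pred.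
  rewrite <- (IH (fun i => f (S i))), Rplus_comm. f_equal.
  apply sum_eq. intros i Hi. f_equal. lia.
Qed.

Lemma sum_f_R0_split (f : nat -> R) (n m : nat) :
  sum_f_R0 f (n + m) = sum_f_R0 f n + sum_f_R0 (fun i => f (n + i)%nat) m - f n.
Proof.
  induction m as [|m IH].
  - simpl. rewrite Nat.add_0_r. ring.
  - rewrite Nat.add_succ_r, !tech5, IH, Nat.add_succ_r. ring.
Qed.

(** Iterated duplication: with [D = 2 2^n], [D coth x] is the sum of [coth ((x + i pi j) / D)] over
    [j] modulo [D]. The indices [j] and [D - j] have the same real part; [0] and [D / 2] are their
    own partners, hence the two terms subtracted. *)
Lemma coth_finite_sum (n : nat) (x : R) : 0 < x ->
  2 * 2 ^ n * re_coth x 0 =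
  2 * sum_f_R0 (fun j => re_coth (x / (2 * 2 ^ n)) (PI * INR j / (2 * 2 ^ n))) (2 ^ n)
  - re_coth (x / (2 * 2 ^ n)) 0 - re_coth (x / (2 * 2 ^ n)) (PI / 2).
Proof.
  intros Hx. induction n as [|n IH].
  - simpl. rewrite !Rmult_1_r. assert (H := re_coth_double (x / 2) 0 ltac:(lra)).
    rewrite Rmult_0_r, Rminus_0_r in H. replace (2 * (x / 2)) with x in H by field.
    replace (PI * 0 / 2) with 0 by field. lra.
  - set (D := 2 * 2 ^ n) in *.
    assert (HD : 0 < D) by (unfold D; assert (0 < 2 ^ n) by (apply pow_lt; lra); lra).
    replace (2 * 2 ^ S n) with (2 * D) by (unfold D; simpl; ring).
    set (N := (2 ^ n)%nat) in *.
    replace (2 ^ S n)%nat with (N + N)%nat by (unfold N; simpl; lia).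
    assert (HN : INR N = D / 2).
    { unfold N, D. rewrite pow_INR. simpl. replace (1 + 1) with 2 by ring. field. }
    set (u := x / (2 * D)). assert (Hu : 0 < u) by (apply Rdiv_lt_0_compat; lra).
    set (c := fun j => re_coth u (PI * INR j / (2 * D))).
    (* Duplication replaces the index [j] by the pair [j], [2 N - j]. The second family, read
       backwards, runs from [N] to [2 N], and the index [N] shared with the first is the one that
       [sum_f_R0_split] counts twice. *)
    assert (Hc : forall j, (j <= N)%nat ->
      2 * re_coth (x / D) (PI * INR j / D) = c j + c (N + (N - j))%nat).
    { intros j Hj. assert (H := re_coth_double u (PI * INR j / (2 * D)) Hu).
      replace (2 * u) with (x / D) in H by (unfold u; field; lra).
      replace (2 * (PI * INR j / (2 * D))) with (PI * INR j / D) in H by (field; lra).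
      rewrite H. unfold c. f_equal. f_equal.
      rewrite plus_INR, minus_INR, HN by exact Hj. field. lra. }
    rewrite sum_f_R0_split. fold c.
    assert (E : sum_f_R0 (fun j => 2 * re_coth (x / D) (PI * INR j / D)) N =
       sum_f_R0 c N + sum_f_R0 (fun i => c (N + i)%nat) N).
    { rewrite <- (sum_f_R0_rev (fun i => c (N + i)%nat) N), <- sum_plus.
      apply sum_eq. intros j Hj. now apply Hc. }
    replace (sum_f_R0 (fun j => 2 * re_coth (x / D) (PI * INR j / D)) N) with
      (2 * sum_f_R0 (fun i => re_coth (x / D) (PI * INR i / D)) N) in E
      by (rewrite scal_sum; apply sum_eq; intros; ring).
    assert (H0 := Hc O ltac:(lia)). rewrite Nat.sub_0_r in H0.
    assert (H1 := Hc N ltac:(lia)). rewrite Nat.sub_diag, Nat.add_0_r in H1.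
    rewrite HN in H1. replace (PI * (D / 2) / D) with (PI / 2) in H1 by (field; lra).
    simpl INR in H0. replace (PI * 0 / D) with 0 in H0 by (field; lra).
    assert (C0 : c O = re_coth u 0).
    { unfold c. simpl. f_equal. field. lra. }
    assert (CN : c (N + N)%nat = re_coth u (PI / 2)).
    { unfold c. rewrite plus_INR, HN. f_equal. field. lra. }
    rewrite <- C0, <- CN. fold c. lra.
Qed.

Lemma sin_ge_third (y : R) : 0 <= y <= PI / 2 -> y / 3 <= sin y.
Proof.
  intros Hy. assert (HP := PI_4).
  destruct (SIN y) as [H _]; [lra|assert (H0 := PI_RGT_0); lra|].
  eapply Rle_trans; [|exact H].
  unfold sin_lb, sin_approx, sin_term. simpl.
  (* Since [y^2 <= 4], [y - y^3 / 6 >= y / 3]; the next two Taylor terms add up to something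
     nonnegative. *)
  assert (H2 : y * y <= 4) by nra.
  assert (H3 : 0 <= y * (4 - y * y)) by (apply Rmult_le_pos; lra).
  assert (H4 : 0 <= y * (y * y) * (y * y)) by (assert (0 <= y * y) by nra; assert (0 <= y * (y * y)) by nra; nra).
  assert (H5 : 0 <= y * (y * y) * (y * y) * (4 - y * y)) by (apply Rmult_le_pos; lra).
  field_simplify. lra.
Qed.

Lemma is_lim_seq_inv_pow2 : is_lim_seq (fun n => / (2 * 2 ^ n)) 0.
Proof.
  apply (is_lim_seq_ext (fun n => (/ 2) * (/ 2) ^ n)).
  { intros n. rewrite pow_inv. field. apply pow_nonzero. lra. }
  replace (Finite 0) with (Finite (/ 2 * 0)) by (f_equal; ring).
  apply (is_lim_seq_scal_l _ (/ 2) (Finite 0)). apply is_lim_seq_geom.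
  rewrite Rabs_pos_eq; lra.
Qed.

Lemma is_lim_seq_quotient (f : R -> R) (a l : R) : f 0 = 0 -> is_derive f 0 l ->
  is_lim_seq (fun n => f (a / (2 * 2 ^ n)) * (2 * 2 ^ n)) (a * l).
Proof.
  intros Hf0 Hf. apply is_lim_seq_spec. intros eps.
  assert (Ha := Rabs_pos a).
  assert (He := cond_pos eps).
  destruct (is_derive_eps _ _ _ Hf (eps / (2 * (Rabs a + 1)))) as [d [Hd Hw]].
  { apply Rdiv_lt_0_compat; [exact He|lra]. }
  assert (Hd' : 0 < d / (Rabs a + 1)) by (apply Rdiv_lt_0_compat; lra).
  destruct (proj2 (is_lim_seq_spec _ _) is_lim_seq_inv_pow2 (mkposreal _ Hd')) as [n0 Hn].
  exists n0. intros n Hnn. specialize (Hn n Hnn). simpl in Hn.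
  assert (HD : 0 < 2 * 2 ^ n) by (assert (0 < 2 ^ n) by (apply pow_lt; lra); lra).
  set (D := 2 * 2 ^ n) in *.
  assert (HiD : 0 < / D) by now apply Rinv_0_lt_compat.
  rewrite Rminus_0_r, Rabs_pos_eq in Hn by lra.
  assert (E : Rabs (a / D) = Rabs a * / D).
  { unfold Rdiv. rewrite Rabs_mult, (Rabs_pos_eq (/ D)); lra. }
  specialize (Hw (a / D)). rewrite Hf0, !Rminus_0_r, E in Hw.
  assert (Hlt : Rabs a * / D < d).
  { apply Rmult_lt_compat_r with (r := Rabs a + 1) in Hn; [|lra].
    replace (d / (Rabs a + 1) * (Rabs a + 1)) with d in Hn by (field; lra). nra. }
  specialize (Hw Hlt).
  replace (f (a / D) * D - a * l) with ((f (a / D) - a / D * l) * D) by (field; lra).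
  rewrite Rabs_mult, (Rabs_pos_eq D) by lra.
  apply Rmult_le_compat_r with (r := D) in Hw; [|lra].
  replace (eps / (2 * (Rabs a + 1)) * (Rabs a * / D) * D) with
    (eps / 2 * (Rabs a / (Rabs a + 1))) in Hw by (field; lra).
  assert (Rabs a / (Rabs a + 1) <= 1).
  { apply Rmult_le_reg_r with (Rabs a + 1); [lra|].
    unfold Rdiv. rewrite Rmult_assoc, Rinv_l by lra. lra. }
  nra.
Qed.

Lemma is_series_finite_support (a : nat -> R) (m : nat) : (forall k, (m < k)%nat -> a k = 0) ->
  is_series a (sum_f_R0 a m).
Proof.
  intros H. enough (E : is_lim_seq (sum_n a) (sum_f_R0 a m)) by exact E.
  apply (is_lim_seq_ext_loc (fun _ => sum_f_R0 a m)); [|apply is_lim_seq_const].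
  exists m. intros n Hn. rewrite sum_n_Reals. induction Hn as [|n Hn IH]; [reflexivity|].
  rewrite tech5, <- IH, H by lia. ring.
Qed.

Lemma is_derive_sinh_0 : is_derive sinh 0 1.
Proof.
  unfold sinh. auto_derive; [exact I|]. rewrite Ropp_0, exp_0. field.
Qed.

Lemma is_derive_sin_0 : is_derive sin 0 1.
Proof. auto_derive; [exact I|]. rewrite cos_0. ring. Qed.

Lemma is_lim_seq_cosh (x : R) : is_lim_seq (fun n => cosh (x / (2 * 2 ^ n))) 1.
Proof.
  rewrite <- cosh_0. apply (is_lim_seq_continuous cosh).
  - apply continuity_pt_filterlim. apply (ex_derive_continuous cosh). unfold cosh. auto_derive. exact I.
  - replace 0 with (x * 0) by ring. apply (is_lim_seq_scal_l _ x (Finite 0)).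
    exact is_lim_seq_inv_pow2.
Qed.

(** [coth_finite_sum] is divided by [D n] and the limit taken: the term with index 0 becomes [/ x],
    the one at angle [pi / 2] disappears, and the others converge under the majorant that
    [sin_ge_third] provides. *)
Lemma coth_expansion (x : R) : 0 < x ->
  is_series (fun j => 2 * x / (x ^ 2 + PI ^ 2 * INR (S j) ^ 2)) (cosh x / sinh x - / x).
Proof.
  intros Hx.
  assert (HPI := PI_RGT_0).
  set (D := fun n : nat => 2 * 2 ^ n).
  assert (HD : forall n, 0 < D n).
  { intros n. unfold D. assert (0 < 2 ^ n) by (apply pow_lt; lra). lra. }
  (* Extension by 0 turns finite sums of growing length into series over a fixed index set. The
     [j]-th term carries the angle of index [S j], index 0 being treated apart in [s]. *)
  set (f := fun j n => if lt_dec j (2 ^ n)%nat then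
     2 / D n * re_coth (x / D n) (PI * INR (S j) / D n) else 0).
  set (s := fun n => re_coth x 0 - re_coth (x / D n) 0 / D n + re_coth (x / D n) (PI / 2) / D n).
  assert (Hsh : is_lim_seq (fun n => sinh (x / D n) * D n) x).
  { replace x with (x * 1) at 1 by ring. replace (Finite x) with (Finite (x * 1)) by (f_equal; ring).
    replace (fun n => sinh (x * 1 / D n) * D n) with (fun n => sinh (x / D n) * D n).
    - apply (is_lim_seq_quotient sinh x 1); [apply sinh_0|apply is_derive_sinh_0].
    - now rewrite Rmult_1_r. }
  assert (Hch : is_lim_seq (fun n => cosh (x / D n)) 1) by apply is_lim_seq_cosh.
  assert (Hsc : is_lim_seq (fun n => sinh (x / D n) * D n * cosh (x / D n)) x).
  { replace (Finite x) with (Finite (x * 1)) by (f_equal; ring).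
    now apply is_lim_seq_mult'. }
  assert (Hu : forall n, 0 < sinh (x / D n)).
  { intros n. apply sinh_gt_0. now apply Rdiv_lt_0_compat. }
  (* Multiplied by [D n], each factor has a finite limit: [D sinh (x / D)] tends to [x] and
     [D sin (pi j / D)] to [pi j]. *)
  assert (Hform : forall n b, re_coth (x / D n) b / D n =
    (sinh (x / D n) * D n * cosh (x / D n)) /
    ((sinh (x / D n) * D n) ^ 2 + (sin b * D n) ^ 2)).
  { intros n b. unfold re_coth. specialize (HD n). specialize (Hu n).
    assert (0 < sinh (x / D n) ^ 2) by nra. assert (0 <= sin b ^ 2) by apply pow2_ge_0.
    replace ((sinh (x / D n) * D n) ^ 2 + (sin b * D n) ^ 2) with
      (D n ^ 2 * (sinh (x / D n) ^ 2 + sin b ^ 2)) by ring.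
    field. split; lra. }
  assert (Hs : is_lim_seq s (cosh x / sinh x - / x)).
  { unfold s. replace (Finite (cosh x / sinh x - / x)) with
      (Finite (re_coth x 0 - x / x ^ 2 + 0)).
    2:{ f_equal. unfold re_coth. rewrite sin_0. assert (H := sinh_gt_0 x Hx). field. lra. }
    apply is_lim_seq_plus'; [apply is_lim_seq_minus'; [apply is_lim_seq_const|]|].
    - apply (is_lim_seq_ext (fun n => sinh (x / D n) * D n * cosh (x / D n) /
         ((sinh (x / D n) * D n) * (sinh (x / D n) * D n)))).
      { intros n. rewrite Hform, sin_0. f_equal. ring. }
      replace (x ^ 2) with (x * x) by ring.
      apply is_lim_seq_div'; [exact Hsc|now apply is_lim_seq_mult'|nra].
    - apply is_lim_seq_le_le with (u := fun _ => 0)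
        (w := fun n => sinh (x / D n) * D n * cosh (x / D n) * (/ D n * / D n)).
      + intros n. specialize (Hu n). specialize (HD n). assert (Hc := cosh_gt_0 (x / D n)).
        rewrite Hform, sin_PI2. split.
        * apply Rdiv_le_0_compat; [|nra]. apply Rmult_le_pos; nra.
        * apply Rmult_le_compat_l; [apply Rmult_le_pos; nra|].
          rewrite <- Rinv_mult. apply Rinv_le_contravar; nra.
      + apply is_lim_seq_const.
      + replace (Finite 0) with (Finite (x * (0 * 0))) by (f_equal; ring).
        apply is_lim_seq_mult'; [exact Hsc|].
        apply is_lim_seq_mult'; exact is_lim_seq_inv_pow2. }
  assert (Hsum : forall n, is_series (fun j => f j n) (s n)).
  { intros n. set (N := (2 ^ n)%nat).
    assert (HN : (0 < N)%nat) by (unfold N; apply Nat.neq_0_lt_0, Nat.pow_nonzero; lia).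
    replace (s n) with (sum_f_R0 (fun j => f j n) (pred N)).
    { apply is_series_finite_support. intros k Hk. unfold f. destruct lt_dec; [|reflexivity].
      fold N in l. lia. }
    assert (E := coth_finite_sum n x Hx). fold (D n) in E. fold N in E.
    rewrite (decomp_sum _ N HN) in E. change (INR 0) with 0 in E.
    replace (PI * 0 / D n) with 0 in E by (field; specialize (HD n); lra).
    transitivity (2 / D n * sum_f_R0 (fun j => re_coth (x / D n) (PI * INR (S j) / D n)) (pred N)).
    - rewrite scal_sum. apply sum_eq. intros j Hj. unfold f. destruct lt_dec; [ring|].
      fold N in n0. lia.
    - unfold s. specialize (HD n).
      match type of E with _ = 2 * (_ + ?S0) - _ - _ => set (S1 := S0) in * end.
      replace (re_coth x 0) with ((re_coth (x / D n) 0 + 2 * S1 - re_coth (x / D n) (PI / 2)) / D n).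
      + field. lra.
      + apply Rmult_eq_reg_l with (D n); [|lra]. rewrite E. field. lra. }
  (* The numerator [D sinh (x / D) cosh (x / D)] tends to [x], so it is eventually below [x + 1];
     the denominator is at least [INR (S j) ^ 2], because [D sin (pi m / D) >= pi m / 3 >= m] with
     [m = INR (S j)]. *)
  assert (Hex : ex_series (fun j => 2 * (x + 1) * / INR (S j) ^ 2)).
  { apply (ex_series_scal (V := R_NormedModule) (2 * (x + 1))). exact ex_series_inv_sqr. }
  set (l := fun j => 2 * x / (x ^ 2 + PI ^ 2 * INR (S j) ^ 2)).
  assert (Hl : ex_series l).
  { apply (ex_series_le (K := R_AbsRing) (V := R_CompleteNormedModule) _ _) with (2 := Hex).
    intros j. change (Rabs (l j) <= 2 * (x + 1) * / INR (S j) ^ 2).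
    assert (Hj := lt_0_INR (S j) ltac:(lia)). unfold l. set (y := INR (S j)) in *.
    assert (HP3 : 3 <= PI) by (assert (H := PI2_3_2); lra).
    assert (Hy : 0 < y ^ 2) by nra.
    assert (Hx2 : 0 <= x ^ 2) by apply pow2_ge_0.
    assert (HP9 : 1 <= PI ^ 2) by nra.
    assert (Hy2 : y ^ 2 <= x ^ 2 + PI ^ 2 * y ^ 2) by nra.
    rewrite Rabs_pos_eq by (apply Rdiv_le_0_compat; lra).
    apply Rmult_le_compat; [lra| |lra|now apply Rinv_le_contravar].
    left. apply Rinv_0_lt_compat. lra. }
  replace (cosh x / sinh x - / x) with (Series l); [now apply Series_correct|].
  (* The sequence [s] has its closed-form limit by [Hs]; as a sequence of sums it also tends to
     [Series l]. *)
  assert (Hlim : is_lim_seq s (Series l)).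
  2:{ apply is_lim_seq_unique in Hlim. apply is_lim_seq_unique in Hs.
      rewrite Hs in Hlim. now injection Hlim. }
  apply (Tannery (K := R_AbsRing) (V := R_NormedModule) f l
    (fun j => 2 * (x + 1) * / INR (S j) ^ 2)).
  - exact Hex.
  - intros j.
    assert (Hsin : is_lim_seq (fun n => sin (PI * INR (S j) / D n) * D n) (PI * INR (S j))).
    { assert (H := is_lim_seq_quotient sin (PI * INR (S j)) 1 sin_0 is_derive_sin_0).
      rewrite Rmult_1_r in H. exact H. }
    enough (E : is_lim_seq (f j) (l j)) by exact E.
    apply (is_lim_seq_ext_loc (fun n => 2 * ((sinh (x / D n) * D n * cosh (x / D n)) /
      ((sinh (x / D n) * D n) * (sinh (x / D n) * D n) +
       (sin (PI * INR (S j) / D n) * D n) * (sin (PI * INR (S j) / D n) * D n))))).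
    { exists j. intros n Hn. unfold f. destruct lt_dec as [_|Hlt].
      - replace (2 / D n * re_coth (x / D n) (PI * INR (S j) / D n)) with
          (2 * (re_coth (x / D n) (PI * INR (S j) / D n) / D n)) by (unfold Rdiv; ring).
        rewrite Hform. do 2 f_equal. ring.
      - exfalso. apply Hlt. apply Nat.le_lt_trans with n; [exact Hn|]. apply Nat.pow_gt_lin_r. lia. }
    assert (Hj := lt_0_INR (S j) ltac:(lia)).
    assert (0 < (PI * INR (S j)) * (PI * INR (S j))) by (apply Rmult_lt_0_compat; nra).
    replace (l j) with (2 * (x / (x * x + PI * INR (S j) * (PI * INR (S j))))).
    2:{ unfold l, Rdiv. rewrite <- Rmult_assoc. do 2 f_equal. ring. }
    apply (is_lim_seq_scal_l _ 2 (Finite _)).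
    apply is_lim_seq_div'; [exact Hsc| |nra].
    apply is_lim_seq_plus'; apply is_lim_seq_mult'; assumption.
  - apply is_lim_seq_spec in Hsc. destruct (Hsc (mkposreal 1 Rlt_0_1)) as [n0 Hn0].
    exists n0. intros n Hn. split; [|apply Hsum].
    specialize (Hn0 n Hn). simpl in Hn0. apply Rabs_def2 in Hn0.
    intros j. change (Rabs (f j n) <= 2 * (x + 1) * / INR (S j) ^ 2).
    assert (Hj := lt_0_INR (S j) ltac:(lia)).
    assert (Hy : 0 < INR (S j) ^ 2) by nra.
    assert (HM : 0 <= 2 * (x + 1) * / INR (S j) ^ 2).
    { apply Rmult_le_pos; [lra|]. left. now apply Rinv_0_lt_compat. }
    unfold f. destruct lt_dec as [Hlt|_]; [|now rewrite Rabs_R0].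
    specialize (HD n). specialize (Hu n). assert (Hc := cosh_gt_0 (x / D n)).
    replace (2 / D n * re_coth (x / D n) (PI * INR (S j) / D n)) with
      (2 * (re_coth (x / D n) (PI * INR (S j) / D n) / D n)) by (field; lra).
    rewrite Hform.
    assert (Hsin : INR (S j) <= sin (PI * INR (S j) / D n) * D n).
    { assert (HjD : INR (S j) <= D n / 2).
      { apply le_INR in Hlt. rewrite pow_INR in Hlt. simpl (INR 2) in Hlt.
        replace (1 + 1) with 2 in Hlt by ring. unfold D. lra. }
      assert (Hr : 0 <= PI * INR (S j) / D n <= PI / 2).
      { split; [apply Rdiv_le_0_compat; nra|].
        apply Rmult_le_reg_r with (D n); [exact HD|].
        replace (PI * INR (S j) / D n * D n) with (PI * INR (S j)) by (field; lra). nra. }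
      assert (H := sin_ge_third _ Hr).
      apply Rmult_le_compat_r with (r := D n) in H; [|lra].
      replace (PI * INR (S j) / D n / 3 * D n) with (PI / 3 * INR (S j)) in H by (field; lra).
      assert (HP3 := PI2_3_2). nra. }
    set (A := sinh (x / D n) * D n) in *. set (B := sin (PI * INR (S j) / D n) * D n) in *.
    assert (HA : 0 < A) by (unfold A; nra).
    assert (HB : INR (S j) ^ 2 <= A ^ 2 + B ^ 2) by nra.
    rewrite Rabs_pos_eq.
    2:{ apply Rmult_le_pos; [lra|]. apply Rdiv_le_0_compat; nra. }
    rewrite Rmult_assoc. apply Rmult_le_compat_l; [lra|].
    apply Rmult_le_compat; [nra| |lra|now apply Rinv_le_contravar].
    left. apply Rinv_0_lt_compat. lra.
  - now apply Series_correct.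
Qed.

(** * The identity on the negative real axis *)

Lemma ex_series_power (c : nat -> R) (p : nat -> nat) (B y : R) :
  (forall n, (n <= p n)%nat) -> (forall n, Rabs (c n) <= B) -> Rabs y < 1 ->
  ex_series (fun n => c n * y ^ p n).
Proof.
  intros Hp HB Hy.
  assert (Hgeo : ex_series (fun n => B * Rabs y ^ n)).
  { apply (ex_series_scal (V := R_NormedModule) B). exists (/ (1 - Rabs y)).
    apply is_series_geom. now rewrite Rabs_Rabsolu. }
  apply (ex_series_le (K := R_AbsRing) (V := R_CompleteNormedModule) _ _) with (2 := Hgeo).
  intros n. change (Rabs (c n * y ^ p n) <= B * Rabs y ^ n).
  rewrite Rabs_mult, <- RPow_abs. assert (Hy0 := Rabs_pos y).
  apply Rmult_le_compat; [apply Rabs_pos|now apply pow_le|apply HB|].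
  replace (p n) with (n + (p n - n))%nat by (specialize (Hp n); lia).
  rewrite pow_add. assert (0 <= Rabs y ^ n) by now apply pow_le.
  assert (Rabs y ^ (p n - n) <= 1) by (rewrite <- (pow1 (p n - n)); apply pow_incr; lra).
  nra.
Qed.

(** The restriction of the complex statement to the real axis, where the auxiliary complex sum [gC]
    takes the values of [g]. *)
Lemma is_derive_power_sum (c : nat -> R) (p : nat -> nat) (B : R) (g : R -> R) (y l : R) :
  (forall n, (n < p n)%nat) -> (forall n, Rabs (c n) * INR (p n) <= B) ->
  (forall y, Rabs y < 1 -> is_series (fun n => c n * y ^ p n) (g y)) ->
  Rabs y < 1 -> is_series (fun n => c n * (INR (p n) * y ^ pred (p n))) l ->
  is_derive g y l.
Proof.
  intros Hp HB Hg Hy Hl.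
  assert (HcB : forall n, Rabs (c n) <= B).
  { intros n. specialize (Hp n). specialize (HB n).
    assert (1 <= INR (p n)) by (apply (le_INR 1); lia). assert (H1 := Rabs_pos (c n)). nra. }
  set (gC := fun z : C => epsilon (inhabits (RtoC 0)) (is_Cseries (fun n => RtoC (c n) * z ^ p n)%C)).
  assert (HgC : forall z, Cmod z < 1 -> is_Cseries (fun n => RtoC (c n) * z ^ p n)%C (gC z)).
  { intros z Hz. unfold gC. apply epsilon_spec.
    assert (Hex := ex_series_power (fun _ => B) p B (Cmod z)).
    apply (ex_series_le (K := C_AbsRing) (V := C_CompleteNormedModule) _
      (fun n => B * Cmod z ^ p n)).
    - intros n. change (Cmod (RtoC (c n) * z ^ p n)%C <= B * Cmod z ^ p n).
      rewrite Cmod_mult, Cmod_R, Cmod_pow. apply Rmult_le_compat_r; [apply pow_le, Cmod_ge_0|apply HcB].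
    - apply Hex.
      + intros n. specialize (Hp n). lia.
      + intros n. rewrite Rabs_pos_eq; [lra|]. eapply Rle_trans; [apply Rabs_pos|apply (HcB n)].
      + rewrite Rabs_pos_eq; [exact Hz|apply Cmod_ge_0]. }
  destruct (is_Cderive_power_sum (fun n => RtoC (c n)) p B gC Hp) with (z := RtoC y)
    as [L [HL1 HL2]].
  - intros n. rewrite Cmod_R. apply HB.
  - exact HgC.
  - now rewrite Cmod_R.
  - assert (EL : L = RtoC l).
    { apply (is_Cseries_unique _ _ _ HL2).
      eapply is_series_ext; [|exact (is_Cseries_RtoC _ _ Hl)].
      intros n. cbv beta. now rewrite !RtoC_mult, RtoC_pow. }
    rewrite EL in HL1. apply is_derive_hline in HL1. apply is_derive_Re in HL1.
    simpl Re in HL1. eapply is_derive_ext_loc; [|exact HL1].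
    assert (Hd : 0 < 1 - Rabs y) by lra.
    exists (mkposreal _ Hd). intros t Ht. change (Rabs (t - y) < 1 - Rabs y) in Ht.
    assert (Ht1 : Rabs t < 1).
    { replace t with ((t - y) + y) by ring. assert (T := Rabs_triang (t - y) y). lra. }
    assert (E : gC (RtoC t) = RtoC (g t)).
    { apply (is_Cseries_unique (fun n => RtoC (c n) * RtoC t ^ p n)%C).
      - apply HgC. now rewrite Cmod_R.
      - eapply is_series_ext; [|exact (is_Cseries_RtoC _ _ (Hg t Ht1))].
        intros n. cbv beta. now rewrite RtoC_mult, RtoC_pow. }
    change (t, 0) with (RtoC t). now rewrite E.
Qed.

(** * Real polylogarithms and their behaviour at 1 *)

Definition Li (s : nat) (x : R) : R := Series (fun n => / INR (S n) ^ s * x ^ S n).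

Lemma inv_INR_pow_le (s n : nat) : Rabs (/ INR (S n) ^ s) <= 1.
Proof.
  assert (Hn : 1 <= INR (S n)) by (rewrite S_INR; assert (H0 := pos_INR n); lra).
  assert (H1 : 1 <= INR (S n) ^ s) by now apply pow_R1_Rle.
  rewrite Rabs_pos_eq by (left; apply Rinv_0_lt_compat; lra).
  rewrite <- Rinv_1. apply Rinv_le_contravar; lra.
Qed.

Lemma is_series_Li (s : nat) (x : R) : Rabs x < 1 ->
  is_series (fun n => / INR (S n) ^ s * x ^ S n) (Li s x).
Proof.
  intros Hx. apply Series_correct.
  apply (ex_series_power (fun n => / INR (S n) ^ s) S 1); [lia|apply inv_INR_pow_le|exact Hx].
Qed.

Lemma is_derive_Li (s : nat) (x : R) : 0 < x < 1 -> is_derive (Li (S s)) x (Li s x / x).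
Proof.
  intros Hx.
  assert (HE : forall n, / INR (S n) ^ S s * INR (S n) = / INR (S n) ^ s).
  { intros n. assert (Hn := lt_0_INR (S n) ltac:(lia)). 
    change (INR (S n) ^ S s) with (INR (S n) * INR (S n) ^ s).
    set (m := INR (S n)) in *. assert (m ^ s <> 0) by (apply pow_nonzero; lra).
    field. split; lra. }
  apply (is_derive_power_sum (fun n => / INR (S n) ^ S s) S 1).
  - lia.
  - intros n. rewrite <- (Rabs_pos_eq (INR (S n))) at 2 by apply pos_INR.
    rewrite <- Rabs_mult, HE. apply inv_INR_pow_le.
  - intros y Hy. now apply is_series_Li.
  - rewrite Rabs_pos_eq; lra.
  - apply (is_series_ext (fun n => / INR (S n) ^ s * x ^ S n * / x)).
    { intros n. rewrite <- HE. simpl pred. change (x ^ S n) with (x * x ^ n).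
      set (a := / INR (S n) ^ S s).
      change (@eq R (a * INR (S n) * (x * x ^ n) * / x) (a * (INR (S n) * x ^ n))).
      field. lra. }
    apply (is_series_scal_r (/ x)). apply is_series_Li. rewrite Rabs_pos_eq; lra.
Qed.

(** The chain of derivatives from [Li 3] down ends in this elementary function. *)
Lemma Li_0 (x : R) : Rabs x < 1 -> Li 0 x = x / (1 - x).
Proof.
  intros Hx. apply is_series_unique.
  apply (is_series_ext (fun n => x * x ^ n)).
  { intros n. simpl. field. }
  exact (is_series_scal_l x _ _ (is_series_geom x Hx)).
Qed.

Lemma exp_neg_bounds (t : R) : 0 < t -> 0 < exp (- t) < 1.
Proof.
  intros Ht. split; [apply exp_pos|]. rewrite <- exp_0. apply exp_increasing. lra.
Qed.

Lemma is_derive_Li_exp (s : nat) (t : R) : 0 < t ->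
  is_derive (fun t => Li (S s) (exp (- t))) t (- Li s (exp (- t))).
Proof.
  intros Ht. assert (He := exp_neg_bounds t Ht).
  evar_last.
  - apply (is_derive_comp (Li (S s)) (fun t => exp (- t))).
    + now apply is_derive_Li.
    + instantiate (1 := - exp (- t)). auto_derive; [exact I|ring].
  - change (scal (- exp (- t)) (Li s (exp (- t)) / exp (- t))) with
      (- exp (- t) * (Li s (exp (- t)) / exp (- t))). field. lra.
Qed.

Lemma filterlim_at_right_ex_derive (f : R -> R) (x l : R) : f x = l -> ex_derive f x ->
  filterlim f (at_right x) (locally l).
Proof.
  intros <- H P HP. apply (ex_derive_continuous f) in H.
  destruct (H P HP) as [d Hd]. exists d. intros y Hy _. now apply Hd.
Qed.

Lemma filterlim_Li_exp (s : nat) : (2 <= s)%nat ->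
  filterlim (fun t => Li s (exp (- t))) (at_right 0) (locally (zeta s)).
Proof.
  intros Hs.
  apply (Tannery (K := R_AbsRing) (V := R_NormedModule)
    (fun n t => / INR (S n) ^ s * exp (- t) ^ S n) (fun n => / INR (S n) ^ s)
    (fun n => / INR (S n) ^ s)).
  - now apply ex_series_zeta.
  - intros k. apply filterlim_at_right_ex_derive.
    + rewrite Ropp_0, exp_0, pow1. ring.
    + auto_derive. exact I.
  - exists (mkposreal 1 Rlt_0_1). intros t _ Ht.
    assert (He := exp_neg_bounds t Ht). split.
    + intros k. change (Rabs (/ INR (S k) ^ s * exp (- t) ^ S k) <= / INR (S k) ^ s).
      assert (H0 : 0 < / INR (S k) ^ s) by (apply Rinv_0_lt_compat, pow_lt, lt_0_INR; lia).
      assert (H1 : 0 <= exp (- t) ^ S k <= 1).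
      { split; [apply pow_le; lra|]. rewrite <- (pow1 (S k)). apply pow_incr. lra. }
      rewrite Rabs_pos_eq; nra.
    + apply is_series_Li. rewrite Rabs_pos_eq; lra.
  - apply Series_correct. now apply ex_series_zeta.
Qed.

(** [Li 1] diverges logarithmically at 1, and the factor [t] outweighs this: [m t <= exp (m t)]
    bounds the term [t exp (- m t) / m] by [1 / m^2]. *)
Lemma filterlim_id_Li_1_exp : filterlim (fun t => t * Li 1 (exp (- t))) (at_right 0) (locally 0).
Proof.
  apply (Tannery (K := R_AbsRing) (V := R_NormedModule)
    (fun n t => t * (/ INR (S n) ^ 1 * exp (- t) ^ S n)) (fun n => 0)
    (fun n => / INR (S n) ^ 2)).
  - exact ex_series_inv_sqr.
  - intros k. apply filterlim_at_right_ex_derive; [ring|]. auto_derive. exact I.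
  - exists (mkposreal 1 Rlt_0_1). intros t _ Ht.
    assert (He := exp_neg_bounds t Ht). split.
    + intros k. change (Rabs (t * (/ INR (S k) ^ 1 * exp (- t) ^ S k)) <= / INR (S k) ^ 2).
      assert (Hk := lt_0_INR (S k) ltac:(lia)). set (m := INR (S k)) in *.
      assert (E : exp (- t) ^ S k = / exp (m * t)).
      { unfold m. rewrite <- exp_Ropp.
        assert (Hind : forall n, exp (- t) ^ n = exp (- (INR n * t))).
        { induction n as [|n IH].
          - simpl. rewrite Rmult_0_l, Ropp_0, exp_0. reflexivity.
          - rewrite S_INR. simpl pow. rewrite IH, <- exp_plus. f_equal. ring. }
        apply Hind. }
      rewrite E. assert (Hexp : m * t <= exp (m * t)).
      { assert (H := exp_ineq1_le (m * t)). lra. }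
      assert (Hmt : 0 < m * t) by (apply Rmult_lt_0_compat; assumption).
      rewrite Rabs_pos_eq.
      2:{ apply Rmult_le_pos; [lra|]. apply Rmult_le_pos; left; apply Rinv_0_lt_compat;
          [apply pow_lt; lra|apply exp_pos]. }
      apply Rmult_le_reg_r with (m ^ 2 * exp (m * t)); [apply Rmult_lt_0_compat; [nra|apply exp_pos]|].
      assert (Hp := exp_pos (m * t)).
      replace (t * (/ m ^ 1 * / exp (m * t)) * (m ^ 2 * exp (m * t))) with (m * t) by (field; lra).
      replace (/ m ^ 2 * (m ^ 2 * exp (m * t))) with (exp (m * t)) by (field; lra).
      exact Hexp.
    + refine (is_series_scal_l t _ _ (is_series_Li 1 (exp (- t)) _)). rewrite Rabs_pos_eq; lra.
  - enough (E : is_lim_seq (sum_n (fun _ : nat => 0)) 0) by exact E.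
    apply (is_lim_seq_ext (fun _ => 0)); [|apply is_lim_seq_const].
    intros n. rewrite sum_n_const. ring.
Qed.

(** * Behaviour of coth at 0 and the value of zeta(2) *)

Lemma nonneg_of_derive (f f' : R -> R) (x : R) : 0 <= x -> f 0 = 0 ->
  (forall t, 0 <= t <= x -> is_derive f t (f' t)) ->
  (forall t, 0 <= t <= x -> 0 <= f' t) -> 0 <= f x.
Proof.
  intros Hx Hf0 Hd Hp.
  destruct (MVT_gen f 0 x f') as [c [Hc E]].
  - intros t. rewrite Rmin_left, Rmax_right by lra. intros Ht. apply Hd. lra.
  - intros t. rewrite Rmin_left, Rmax_right by lra. intros Ht.
    apply continuity_pt_filterlim. apply (ex_derive_continuous f). eexists. now apply Hd.
  - rewrite Rmin_left, Rmax_right in Hc by lra. specialize (Hp c Hc). nra.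
Qed.

Lemma is_derive_sinh (x : R) : is_derive sinh x (cosh x).
Proof. unfold sinh, cosh. auto_derive; [exact I|field]. Qed.

Lemma is_derive_cosh (x : R) : is_derive cosh x (sinh x).
Proof. unfold sinh, cosh. auto_derive; [exact I|field]. Qed.

Lemma sinh_ge_0 (x : R) : 0 <= x -> 0 <= sinh x.
Proof. intros [H| <-]; [left; now apply sinh_gt_0|cbv beta; rewrite sinh_0; lra]. Qed.

Lemma cosh_ge_1 (x : R) : 1 <= cosh x.
Proof. assert (H := cosh_sqr x). assert (H1 := cosh_gt_0 x). assert (H2 := pow2_ge_0 (sinh x)). nra. Qed.

Lemma cosh_increasing (s x : R) : 0 <= s <= x -> cosh s <= cosh x.
Proof.
  intros Hs. destruct (MVT_gen cosh s x sinh) as [c [Hc E]].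
  - intros t _. apply is_derive_cosh.
  - intros t _. apply continuity_pt_filterlim. apply (ex_derive_continuous cosh). eexists. apply is_derive_cosh.
  - rewrite Rmin_left, Rmax_right in Hc by lra. assert (H := sinh_ge_0 c ltac:(lra)). nra.
Qed.

Lemma sinh_bounds (x : R) : 0 <= x -> x <= sinh x <= x * cosh x.
Proof.
  intros Hx. split.
  - assert (H : 0 <= (fun t => sinh t - t) x); [|cbv beta in H; lra].
    apply (nonneg_of_derive (fun t => sinh t - t) (fun t => cosh t - 1)); [exact Hx|cbv beta; rewrite sinh_0; ring| |].
    + intros t _. apply (is_derive_minus (V := R_NormedModule)); [apply is_derive_sinh|].
      exact (is_derive_id t).
    + intros t _. assert (H := cosh_ge_1 t). lra.
  - assert (H : 0 <= (fun t => t * cosh x - sinh t) x); [|cbv beta in H; lra].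
    apply (nonneg_of_derive (fun t => t * cosh x - sinh t) (fun t => cosh x - cosh t)); [exact Hx|cbv beta; rewrite sinh_0; ring| |].
    + intros t _. apply (is_derive_minus (V := R_NormedModule)); [|apply is_derive_sinh].
      auto_derive; [exact I|ring].
    + intros t Ht. assert (H := cosh_increasing t x Ht). lra.
Qed.

Lemma is_derive_xcosh_minus_sinh (t : R) : is_derive (fun t => t * cosh t - sinh t) t (t * sinh t).
Proof. unfold cosh, sinh. auto_derive; [exact I|field]. Qed.

(** This is the numerator of [coth x - 1 / x] over [x sinh x]. Its derivative [t sinh t] lies
    between [t^2] and [t^2 cosh t]; in the upper bound the cosh is frozen at the right end. *)
Lemma xcosh_minus_sinh_bounds (x : R) : 0 <= x ->
  x ^ 3 / 3 <= x * cosh x - sinh x <= cosh x * x ^ 3 / 3.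
Proof.
  intros Hx. split.
  - assert (H : 0 <= (fun t => t * cosh t - sinh t - t ^ 3 / 3) x); [|cbv beta in H; lra].
    apply (nonneg_of_derive (fun t => t * cosh t - sinh t - t ^ 3 / 3) (fun t => t * sinh t - t ^ 2)); [exact Hx|cbv beta; rewrite sinh_0; field| |].
    + intros t _. apply (is_derive_minus (V := R_NormedModule)); [apply is_derive_xcosh_minus_sinh|].
      auto_derive; [exact I|field].
    + intros t Ht. assert (H := sinh_bounds t ltac:(lra)). nra.
  - assert (H : 0 <= (fun t => cosh x * t ^ 3 / 3 - (t * cosh t - sinh t)) x); [|cbv beta in H; lra].
    apply (nonneg_of_derive (fun t => cosh x * t ^ 3 / 3 - (t * cosh t - sinh t)) (fun t => cosh x * t ^ 2 - t * sinh t)); [exact Hx|cbv beta; rewrite sinh_0; field| |].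
    + intros t _. apply (is_derive_minus (V := R_NormedModule)); [|apply is_derive_xcosh_minus_sinh].
      auto_derive; [exact I|field].
    + intros t Ht. assert (H := sinh_bounds t ltac:(lra)).
      assert (H1 := cosh_increasing t x ltac:(lra)).
      assert (t * sinh t <= t * (t * cosh t)) by (apply Rmult_le_compat_l; lra).
      assert (t * (t * cosh t) <= t * (t * cosh x)).
      { apply Rmult_le_compat_l; [lra|]. apply Rmult_le_compat_l; lra. }
      lra.
Qed.

Lemma coth_quotient_limit :
  filterlim (fun x => (cosh x / sinh x - / x) / x) (at_right 0) (locally (/ 3)).
Proof.
  apply (filterlim_le_le (F := at_right 0)
    (fun x => / (3 * cosh x)) _ (fun x => cosh x / 3) (Finite (/ 3))).
  - exists (mkposreal 1 Rlt_0_1). intros x _ Hx.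
    assert (Hs := sinh_gt_0 x Hx). assert (Hb := sinh_bounds x ltac:(lra)).
    assert (Hn := xcosh_minus_sinh_bounds x ltac:(lra)). assert (Hc := cosh_gt_0 x).
    replace ((cosh x / sinh x - / x) / x) with ((x * cosh x - sinh x) / (x ^ 2 * sinh x))
      by (field; lra).
    assert (Hx2 : 0 < x ^ 2) by nra.
    assert (Hd : 0 < x ^ 2 * sinh x) by nra.
    split.
    + apply Rmult_le_reg_r with (3 * cosh x * (x ^ 2 * sinh x)); [nra|].
      replace (/ (3 * cosh x) * (3 * cosh x * (x ^ 2 * sinh x))) with (x ^ 2 * sinh x) by (field; lra).
      replace ((x * cosh x - sinh x) / (x ^ 2 * sinh x) * (3 * cosh x * (x ^ 2 * sinh x)))
        with ((x * cosh x - sinh x) * 3 * cosh x) by (field; lra).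
      apply Rle_trans with (x ^ 2 * (x * cosh x)); [nra|].
      replace (x ^ 2 * (x * cosh x)) with (x ^ 3 / 3 * 3 * cosh x) by field. nra.
    + apply Rmult_le_reg_r with (x ^ 2 * sinh x); [exact Hd|].
      replace ((x * cosh x - sinh x) / (x ^ 2 * sinh x) * (x ^ 2 * sinh x))
        with (x * cosh x - sinh x) by (field; lra).
      apply Rle_trans with (cosh x * x ^ 3 / 3); [lra|].
      replace (cosh x * x ^ 3 / 3) with (cosh x / 3 * (x ^ 2 * x)) by field.
      apply Rmult_le_compat_l; [lra|]. apply Rmult_le_compat_l; lra.
  - apply filterlim_at_right_ex_derive; [rewrite cosh_0; field|].
    unfold cosh. auto_derive. rewrite Ropp_0, exp_0. lra.
  - apply filterlim_at_right_ex_derive; [rewrite cosh_0; field|].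
    unfold cosh. auto_derive. exact I.
Qed.

(** Dividing the expansion of coth by [x] and letting [x] tend to 0 gives [2 zeta(2) / pi^2] on the
    side of the series and [1 / 3] on the other. *)
Lemma zeta_2 : zeta 2 = PI ^ 2 / 6.
Proof.
  assert (HP9 : 1 <= PI ^ 2) by (assert (H := PI2_3_2); nra).
  assert (Hex : ex_series (fun j => 2 * / INR (S j) ^ 2)).
  { apply (ex_series_scal (V := R_NormedModule) 2). exact ex_series_inv_sqr. }
  assert (Hlim : filterlim (fun x => (cosh x / sinh x - / x) / x) (at_right 0)
    (locally (2 / PI ^ 2 * zeta 2))).
  { apply (Tannery (K := R_AbsRing) (V := R_NormedModule)
      (fun j x => 2 / (x ^ 2 + PI ^ 2 * INR (S j) ^ 2)) (fun j => 2 / PI ^ 2 * / INR (S j) ^ 2)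
      (fun j => 2 * / INR (S j) ^ 2)).
    - exact Hex.
    - intros k. assert (Hk := lt_0_INR (S k) ltac:(lia)).
      assert (0 < INR (S k) ^ 2) by nra.
      assert (HPI := PI_RGT_0). set (m := INR (S k)) in *.
      apply filterlim_at_right_ex_derive.
      { replace (0 ^ 2 + PI ^ 2 * m ^ 2) with (PI ^ 2 * m ^ 2) by ring. field. split; lra. }
      auto_derive. simpl in *. nra.
    - exists (mkposreal 1 Rlt_0_1). intros x _ Hx. split.
      + intros k. change (Rabs (2 / (x ^ 2 + PI ^ 2 * INR (S k) ^ 2)) <= 2 * / INR (S k) ^ 2).
        assert (Hk := lt_0_INR (S k) ltac:(lia)). assert (Hk2 : 0 < INR (S k) ^ 2) by nra.
        assert (Hx2 := pow2_ge_0 x).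
        assert (INR (S k) ^ 2 <= x ^ 2 + PI ^ 2 * INR (S k) ^ 2) by nra.
        rewrite Rabs_pos_eq by (apply Rdiv_le_0_compat; lra).
        apply Rmult_le_compat_l; [lra|]. now apply Rinv_le_contravar.
      + assert (H := is_series_scal_r (/ x) _ _ (coth_expansion x Hx)).
        eapply is_series_ext; [|exact H]. intros k.
        change (@eq R (2 * x / (x ^ 2 + PI ^ 2 * INR (S k) ^ 2) * / x)
          (2 / (x ^ 2 + PI ^ 2 * INR (S k) ^ 2))).
        assert (Hx2 : 0 < x ^ 2) by nra. assert (Hk2 := pow2_ge_0 (INR (S k))).
        field. split; [nra|lra].
    - exact (is_series_scal_l (2 / PI ^ 2) _ _ (Series_correct _ ex_series_inv_sqr)). }
  assert (E := filterlim_locally_unique (V := R_NormedModule) _ _ _ Hlim coth_quotient_limit).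
  apply Rmult_eq_reg_l with (2 / PI ^ 2).
  - rewrite E. field. nra.
  - apply Rgt_not_eq. apply Rdiv_lt_0_compat; lra.
Qed.

(** * The series in a real variable and its derivatives *)

Definition sq_sum'' (y : R) : R := Series (fun n => 2 * ((-1) ^ n * zeta (2 * S n)) * y ^ (2 * S n)).

Lemma alternating_zeta_bound (n : nat) : Rabs (2 * ((-1) ^ n * zeta (2 * S n))) <= 2 * zeta 2.
Proof.
  assert (Hz := zeta_bounds (2 * S n) ltac:(lia)).
  rewrite !Rabs_mult, pow_1_abs, !Rabs_pos_eq by lra. lra.
Qed.

Lemma is_series_sq_sum'' (y : R) : Rabs y < 1 ->
  is_series (fun n => 2 * ((-1) ^ n * zeta (2 * S n)) * y ^ (2 * S n)) (sq_sum'' y).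
Proof.
  intros Hy. apply Series_correct.
  apply (ex_series_power (fun n => 2 * ((-1) ^ n * zeta (2 * S n))) (fun n => 2 * S n)%nat (2 * zeta 2));
    [intros n; lia|apply alternating_zeta_bound|exact Hy].
Qed.

(* Expand each fraction as a geometric series and exchange the two summations. *)
Lemma sq_sum''_partial_fractions (y : R) : 0 < y < 1 ->
  is_series (fun j => 2 * y ^ 2 / (y ^ 2 + INR (S j) ^ 2)) (sq_sum'' y).
Proof.
  intros Hy.
  set (q := fun j => (y / INR (S j)) ^ 2).
  assert (Hj1 : forall j, 1 <= INR (S j)).
  { intros j. rewrite S_INR. assert (H := pos_INR j). lra. }
  assert (Hq : forall j, 0 <= q j < 1).
  { intros j. specialize (Hj1 j). unfold q.
    assert (0 <= y / INR (S j) < 1).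
    { split; [apply Rdiv_le_0_compat; lra|]. apply Rmult_lt_reg_r with (INR (S j)); [lra|].
      replace (y / INR (S j) * INR (S j)) with y by (field; lra). lra. }
    nra. }
  assert (Hgeo : forall j, is_series (fun n => 2 * (-1) ^ n * y ^ (2 * S n) * / INR (S j) ^ (2 * S n))
     (2 * y ^ 2 / (y ^ 2 + INR (S j) ^ 2))).
  { intros j. specialize (Hq j). specialize (Hj1 j).
    assert (Hg := is_series_geom (- q j) ltac:(rewrite Rabs_Ropp, Rabs_pos_eq; lra)).
    apply (is_series_scal_l (2 * q j)) in Hg.
    replace (2 * y ^ 2 / (y ^ 2 + INR (S j) ^ 2)) with (2 * q j * / (1 - - q j)).
    - eapply is_series_ext; [|exact Hg]. intros n.
      change (@eq R (2 * q j * (- q j) ^ n)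
        (2 * (-1) ^ n * y ^ (2 * S n) * / INR (S j) ^ (2 * S n))).
      replace (- q j) with (-1 * q j) by ring. rewrite Rpow_mult_distr.
      replace (2 * q j * ((-1) ^ n * q j ^ n)) with (2 * (-1) ^ n * q j ^ S n) by (simpl; ring).
      unfold q. rewrite <- pow_mult. unfold Rdiv.
      rewrite Rpow_mult_distr, pow_inv. ring.
    - assert (H1 := pow2_ge_0 (INR (S j))). unfold q. field. repeat split; nra. }
  (* The limit is taken in [J], the number of fractions added. A finite sum of geometric series is
     again a series in [n], with partial sums of zeta as coefficients, and [zeta 2] dominates them
     all. *)
  set (f := fun n J => 2 * (-1) ^ n * y ^ (2 * S n) * sum_n (fun j => / INR (S j) ^ (2 * S n)) J).
  assert (Hlim : filterlim (sum_n (fun j => 2 * y ^ 2 / (y ^ 2 + INR (S j) ^ 2))) eventually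
     (locally (sq_sum'' y))); [|exact Hlim].
  apply (Tannery (K := R_AbsRing) (V := R_NormedModule) f
    (fun n => 2 * ((-1) ^ n * zeta (2 * S n)) * y ^ (2 * S n))
    (fun n => 2 * zeta 2 * y ^ (2 * S n))).
  - apply (ex_series_power (fun _ => 2 * zeta 2) (fun n => 2 * S n)%nat (2 * zeta 2)).
    + intros n. lia.
    + intros n. assert (Hz := zeta_bounds 2 ltac:(lia)). rewrite Rabs_pos_eq; lra.
    + rewrite Rabs_pos_eq; lra.
  - intros n. 
    assert (H : is_lim_seq (sum_n (fun j => / INR (S j) ^ (2 * S n))) (zeta (2 * S n))).
    { exact (Series_correct _ (ex_series_zeta (2 * S n) ltac:(lia))). }
    apply (is_lim_seq_scal_l _ (2 * (-1) ^ n * y ^ (2 * S n))) in H.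
    replace (2 * ((-1) ^ n * zeta (2 * S n)) * y ^ (2 * S n)) with
      (2 * (-1) ^ n * y ^ (2 * S n) * zeta (2 * S n)) by ring. exact H.
  - exists O. intros J _. split.
    + intros n. change (Rabs (f n J) <= 2 * zeta 2 * y ^ (2 * S n)).
      assert (Hpos : forall j, 0 <= / INR (S j) ^ (2 * S n)).
      { intros j. left. apply Rinv_0_lt_compat, pow_lt. specialize (Hj1 j). lra. }
      assert (Hs : 0 <= sum_n (fun j => / INR (S j) ^ (2 * S n)) J <= zeta (2 * S n)).
      { split; [rewrite sum_n_Reals; now apply cond_pos_sum|].
        apply is_series_sum_n_le; [exact Hpos|]. apply ex_series_zeta. lia. }
      assert (Hz := zeta_bounds (2 * S n) ltac:(lia)).
      assert (Hyp : 0 <= y ^ (2 * S n)) by (apply pow_le; lra).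
      unfold f. rewrite !Rabs_mult, pow_1_abs, !Rabs_pos_eq by lra.
      nra.
    + induction J as [|J IH].
      * rewrite sum_O. eapply is_series_ext; [|apply (Hgeo O)].
        intros n. unfold f. now rewrite sum_O.
      * rewrite sum_Sn. eapply is_series_ext; [|exact (is_series_plus _ _ _ _ IH (Hgeo (S J)))].
        intros n. unfold f. rewrite sum_Sn. unfold plus; simpl. ring.
  - apply is_series_sq_sum''. rewrite Rabs_pos_eq; lra.
Qed.

(** Both sides equal [(t / 2) coth (t / 2) - 1]. The scale [2 pi] turns the poles [i pi j] of coth
    into the points [i j] of the partial fractions. *)
Lemma sq_sum''_coth (t : R) : 0 < t < 2 * PI ->
  sq_sum'' (t / (2 * PI)) = t * (Li 0 (exp (- t)) + / 2) - 1.
Proof.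
  intros Ht. assert (HPI := PI_RGT_0).
  set (y := t / (2 * PI)).
  assert (Hy : 0 < y < 1).
  { unfold y. split; [apply Rdiv_lt_0_compat; lra|].
    apply Rmult_lt_reg_r with (2 * PI); [lra|].
    replace (t / (2 * PI) * (2 * PI)) with t by (field; lra). lra. }
  assert (H1 := sq_sum''_partial_fractions y Hy).
  assert (H2 := is_series_scal_l (t / 2) _ _ (coth_expansion (t / 2) ltac:(lra))).
  assert (E : sq_sum'' y = t / 2 * (cosh (t / 2) / sinh (t / 2) - / (t / 2))).
  { rewrite <- (is_series_unique _ _ H1). apply is_series_unique.
    eapply is_series_ext; [|exact H2]. intros j.
    change (@eq R (t / 2 * (2 * (t / 2) / ((t / 2) ^ 2 + PI ^ 2 * INR (S j) ^ 2)))
      (2 * y ^ 2 / (y ^ 2 + INR (S j) ^ 2))).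
    replace t with (2 * PI * y) by (unfold y; field; lra).
    assert (Hj := pow2_ge_0 (INR (S j))). assert (0 < y ^ 2) by nra.
    assert (0 < PI ^ 2) by nra.
    field. split; [nra|].
    replace ((2 * PI * y) ^ 2 + PI ^ 2 * 4 * INR (S j) ^ 2) with (4 * PI ^ 2 * (y ^ 2 + INR (S j) ^ 2)) by ring.
    nra. }
  rewrite E. assert (He := exp_neg_bounds t ltac:(lra)).
  rewrite Li_0 by (rewrite Rabs_pos_eq; lra).
  unfold cosh, sinh. 
  assert (Ee : exp (- t) = exp (- (t / 2)) * exp (- (t / 2))).
  { rewrite <- exp_plus. f_equal. field. }
  rewrite Ee in *. set (e := exp (- (t / 2))) in *.
  assert (He0 : 0 < e) by apply exp_pos.
  replace (exp (t / 2)) with (/ e).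
  2:{ unfold e. rewrite exp_Ropp, Rinv_inv. reflexivity. }
  field. repeat split; lra.
Qed.

(* [sq_sum y = y^2 S(y)], where [S] is the series of the theorem; then [sq_sum'' = sq_sum'']. *)
Definition sq_sum (y : R) : R := Series (fun n => coef n * y ^ S (S (2 * S n))).
Definition sq_sum' (y : R) : R := Series (fun n => coef n * INR (S (S (2 * S n))) * y ^ S (2 * S n)).

Lemma coef_sq_sum_bound (n : nat) : Rabs (coef n) * INR (S (S (2 * S n))) <= 2 * zeta 2.
Proof.
  assert (H1 := coef_mult_le n). assert (H2 := coef_sqr_le n).
  assert (Hz := zeta_bounds 2 ltac:(lia)).
  assert (Hc := Rabs_coef_le n). assert (Hn := pos_INR (S n)).
  rewrite (S_INR (S _)), (S_INR (2 * _)), mult_INR. simpl (INR 2). set (x := INR (S n)) in *.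
  assert (Hx : 0 < (2 * x + 1) * (x + 1)) by nra.
  apply Rle_trans with (zeta 2 / ((2 * x + 1) * (x + 1)) * ((1 + 1) * x + 1 + 1)).
  - apply Rmult_le_compat_r; lra.
  - replace (zeta 2 / ((2 * x + 1) * (x + 1)) * ((1 + 1) * x + 1 + 1)) with
      (2 * zeta 2 * / (2 * x + 1)) by (field; lra).
    rewrite <- (Rmult_1_r (2 * zeta 2)) at 2. apply Rmult_le_compat_l; [lra|].
    rewrite <- Rinv_1. apply Rinv_le_contravar; lra.
Qed.

(** With [k = S n], the denominator [(2k + 1)(k + 1)] is half of [(2k + 2)(2k + 1)], the factor from
    differentiating [y^(2k + 2)] twice. This is the reason for multiplying the series by [y^2]. *)
Lemma coef_sq_sum' (n : nat) :
  coef n * INR (S (S (2 * S n))) * INR (S (2 * S n)) = 2 * ((-1) ^ n * zeta (2 * S n)).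
Proof.
  unfold coef. rewrite (S_INR (S _)), (S_INR (2 * _)), mult_INR. simpl (INR 2).
  assert (Hn := pos_INR (S n)). set (x := INR (S n)) in *. field. lra.
Qed.

Lemma coef_sq_sum'_bound (n : nat) :
  Rabs (coef n * INR (S (S (2 * S n)))) * INR (S (2 * S n)) <= 2 * zeta 2.
Proof.
  rewrite <- (Rabs_pos_eq (INR (S (2 * S n)))) by apply pos_INR.
  rewrite <- Rabs_mult, coef_sq_sum'. apply alternating_zeta_bound.
Qed.

Lemma Rabs_le_of_mult_INR (c B : R) (p : nat) : (0 < p)%nat -> Rabs c * INR p <= B -> Rabs c <= B.
Proof.
  intros Hp HB. assert (1 <= INR p) by (apply (le_INR 1); lia). assert (H1 := Rabs_pos c). nra.
Qed.

Lemma is_series_sq_sum (y : R) : Rabs y < 1 ->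
  is_series (fun n => coef n * y ^ S (S (2 * S n))) (sq_sum y).
Proof.
  intros Hy. apply Series_correct.
  apply (ex_series_power coef (fun n => S (S (2 * S n))) (2 * zeta 2)); [intros n; lia| |exact Hy].
  intros n. apply (Rabs_le_of_mult_INR _ _ (S (S (2 * S n)))); [lia|apply coef_sq_sum_bound].
Qed.

Lemma is_series_sq_sum' (y : R) : Rabs y < 1 ->
  is_series (fun n => coef n * INR (S (S (2 * S n))) * y ^ S (2 * S n)) (sq_sum' y).
Proof.
  intros Hy. apply Series_correct.
  apply (ex_series_power (fun n => coef n * INR (S (S (2 * S n)))) (fun n => S (2 * S n)) (2 * zeta 2));
    [intros n; lia| |exact Hy].
  intros n. apply (Rabs_le_of_mult_INR _ _ (S (2 * S n))); [lia|apply coef_sq_sum'_bound].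
Qed.

Lemma is_derive_sq_sum (y : R) : Rabs y < 1 -> is_derive sq_sum y (sq_sum' y).
Proof.
  intros Hy. apply (is_derive_power_sum coef (fun n => S (S (2 * S n))) (2 * zeta 2)).
  - intros n. lia.
  - apply coef_sq_sum_bound.
  - apply is_series_sq_sum.
  - exact Hy.
  - eapply is_series_ext; [|apply (is_series_sq_sum' y Hy)]. intros n. apply Rmult_assoc.
Qed.

Lemma is_derive_sq_sum' (y : R) : Rabs y < 1 -> is_derive sq_sum' y (sq_sum'' y).
Proof.
  intros Hy. apply (is_derive_power_sum (fun n => coef n * INR (S (S (2 * S n))))
    (fun n => S (2 * S n)) (2 * zeta 2)).
  - intros n. lia.
  - apply coef_sq_sum'_bound.
  - apply is_series_sq_sum'.
  - exact Hy.
  - eapply is_series_ext; [|apply (is_series_sq_sum'' y Hy)]. intros n. cbv beta.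
    rewrite <- coef_sq_sum'. apply Rmult_assoc.
Qed.

Lemma sq_sum_0 : sq_sum 0 = 0.
Proof.
  unfold sq_sum. rewrite (Series_ext _ (fun n => 0 * coef n)).
  - rewrite Series_scal_l. ring.
  - intros n. simpl. ring.
Qed.

Lemma sq_sum'_0 : sq_sum' 0 = 0.
Proof.
  unfold sq_sum'. rewrite (Series_ext _ (fun n => 0 * coef n)).
  - rewrite Series_scal_l. ring.
  - intros n. simpl. ring.
Qed.

(** * The two integrations *)

Lemma zero_of_derive_zero (f : R -> R) (b : R) :
  (forall t, 0 < t < b -> is_derive f t 0) -> filterlim f (at_right 0) (locally 0) ->
  forall t, 0 < t < b -> f t = 0.
Proof.
  intros Hd Hl t Ht.
  assert (Hc : forall s, 0 < s < t -> f s = f t).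
  { intros s Hs. apply (eq_is_derive f s t); [|lra]. intros u Hu. apply Hd. lra. }
  apply (filterlim_locally_unique (F := at_right 0) (V := R_NormedModule) f); [|exact Hl].
  apply (filterlim_ext_loc (fun _ => f t)); [|apply filterlim_const].
  exists (mkposreal t (proj1 Ht)). intros s Hs Hs0.
  change (Rabs (s - 0) < t) in Hs. rewrite Rminus_0_r, Rabs_pos_eq in Hs by lra.
  symmetry. apply Hc. lra.
Qed.

Lemma Rabs_div_2PI_lt (t : R) : 0 <= t < 2 * PI -> Rabs (t / (2 * PI)) < 1.
Proof.
  intros Ht. assert (HPI := PI_RGT_0).
  rewrite Rabs_pos_eq by (apply Rdiv_le_0_compat; lra).
  apply Rmult_lt_reg_r with (2 * PI); [lra|].
  replace (t / (2 * PI) * (2 * PI)) with t by (field; lra). lra.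
Qed.

Lemma is_derive_scaled (f : R -> R) (t l : R) : is_derive f (t / (2 * PI)) l ->
  is_derive (fun t => f (t / (2 * PI))) t (l / (2 * PI)).
Proof.
  intros H. assert (HPI := PI_RGT_0).
  evar_last.
  - apply (is_derive_comp f (fun t => t / (2 * PI))); [exact H|].
    instantiate (1 := / (2 * PI)). auto_derive; [exact I|field; lra].
  - apply Rmult_comm.
Qed.

Lemma filterlim_scaled (f : R -> R) (l : R) : is_derive f 0 l -> f 0 = 0 ->
  filterlim (fun t => f (t / (2 * PI))) (at_right 0) (locally 0).
Proof.
  intros H H0.
  assert (E : 0 / (2 * PI) = 0) by (unfold Rdiv; ring).
  apply filterlim_at_right_ex_derive; [now rewrite E|].
  exists (l / (2 * PI)). apply is_derive_scaled. now rewrite E.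
Qed.

Lemma filterlim_Rplus {T : Type} {F : (T -> Prop) -> Prop} {FF : Filter F} (f g : T -> R) (a b : R) :
  filterlim f F (locally a) -> filterlim g F (locally b) ->
  filterlim (fun x => f x + g x) F (locally (a + b)).
Proof.
  intros Hf Hg. exact (filterlim_comp_2 f g Rplus Hf Hg (filterlim_plus (V := R_NormedModule) a b)).
Qed.

Lemma filterlim_Rmult {T : Type} {F : (T -> Prop) -> Prop} {FF : Filter F} (f g : T -> R) (a b : R) :
  filterlim f F (locally a) -> filterlim g F (locally b) ->
  filterlim (fun x => f x * g x) F (locally (a * b)).
Proof.
  intros Hf Hg. exact (filterlim_comp_2 f g Rmult Hf Hg (filterlim_mult (K := R_AbsRing) a b)).
Qed.

(* The derivatives agree by the expansion of coth; [zeta_2] fixes the constant of integration. *)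
Lemma first_derivative_identity (t : R) : 0 < t < 2 * PI ->
  - Li 2 (exp (- t)) - t * Li 1 (exp (- t)) + PI ^ 2 / 6 - t + t ^ 2 / 4
  - 2 * PI * sq_sum' (t / (2 * PI)) = 0.
Proof.
  revert t. assert (HPI := PI_RGT_0).
  apply (zero_of_derive_zero (fun t => - Li 2 (exp (- t)) - t * Li 1 (exp (- t)) + PI ^ 2 / 6 - t
    + t ^ 2 / 4 - 2 * PI * sq_sum' (t / (2 * PI)))).
  - intros t Ht.
    assert (D2 := is_derive_Li_exp 1 t (proj1 Ht)). assert (D1 := is_derive_Li_exp 0 t (proj1 Ht)).
    assert (DV := is_derive_scaled sq_sum' t _ (is_derive_sq_sum' _ (Rabs_div_2PI_lt t ltac:(lra)))).
    rewrite (sq_sum''_coth t Ht) in DV.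
    assert (D1' := is_derive_mult (fun t => t) (fun t => Li 1 (exp (- t))) t _ _
      (is_derive_id t) D1 Rmult_comm).
    assert (DP : is_derive (fun t => PI ^ 2 / 6 - t + t ^ 2 / 4) t (-1 + t / 2)).
    { auto_derive; [exact I|field]. }
    assert (DA := is_derive_minus (V := R_NormedModule) _ _ _ _ _
      (is_derive_plus (V := R_NormedModule) _ _ _ _ _ (is_derive_opp (V := R_NormedModule) _ _ _
        (is_derive_plus (V := R_NormedModule) _ _ _ _ _ D2 D1')) DP)
      (is_derive_scal _ _ (2 * PI) _ DV)).
    eapply is_derive_ext; [|evar_last; [exact DA|]].
    + intros s. unfold minus, plus, opp, mult; simpl. ring.
    + unfold minus, plus, opp, mult, one; simpl. field. lra.
  - assert (E2 : zeta 2 = PI ^ 2 / 6) by apply zeta_2.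
    assert (L2 := filterlim_Li_exp 2 ltac:(lia)). assert (L1 := filterlim_id_Li_1_exp).
    assert (LV := filterlim_scaled sq_sum' _ (is_derive_sq_sum' 0 ltac:(rewrite Rabs_R0; lra)) sq_sum'_0).
    assert (LP : filterlim (fun t => PI ^ 2 / 6 - t + t ^ 2 / 4) (at_right 0) (locally (PI ^ 2 / 6))).
    { apply filterlim_at_right_ex_derive; [field|]. auto_derive. exact I. }
    assert (K : forall k : R, filterlim (fun _ : R => k) (at_right 0) (locally k)).
    { intros k. apply filterlim_const. }
    assert (LL := filterlim_Rplus _ _ _ _ (filterlim_Rplus _ _ _ _
      (filterlim_Rmult _ _ _ _ (K (-1)) (filterlim_Rplus _ _ _ _ L2 L1)) LP)
      (filterlim_Rmult _ _ _ _ (K (- 2 * PI)) LV)).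
    eapply filterlim_ext; [|].
    2:{ replace 0 with (-1 * (zeta 2 + 0) + PI ^ 2 / 6 + - 2 * PI * 0) at 2 by (rewrite E2; ring).
        exact LL. }
    intros s. cbv beta. ring.
Qed.

(** Its derivative is [first_derivative_identity]. As [t] tends to 0, [2 Li_3(e^(-t))] tends to
    [2 zeta(3)], which accounts for that constant in the formula. *)
Lemma real_identity (t : R) : 0 < t < 2 * PI ->
  2 * Li 3 (exp (- t)) + t * Li 2 (exp (- t)) - 2 * zeta 3 + PI ^ 2 / 6 * t - t ^ 2 / 2 + t ^ 3 / 12
  = 4 * PI ^ 2 * sq_sum (t / (2 * PI)).
Proof.
  intros Ht. apply Rminus_diag_uniq. revert t Ht. assert (HPI := PI_RGT_0).
  apply (zero_of_derive_zero (fun t => 2 * Li 3 (exp (- t)) + t * Li 2 (exp (- t)) - 2 * zeta 3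
    + PI ^ 2 / 6 * t - t ^ 2 / 2 + t ^ 3 / 12 - 4 * PI ^ 2 * sq_sum (t / (2 * PI)))).
  - intros t Ht.
    assert (D3 := is_derive_Li_exp 2 t (proj1 Ht)). assert (D2 := is_derive_Li_exp 1 t (proj1 Ht)).
    assert (DV := is_derive_scaled sq_sum t _ (is_derive_sq_sum _ (Rabs_div_2PI_lt t ltac:(lra)))).
    assert (D2' := is_derive_mult (fun t => t) (fun t => Li 2 (exp (- t))) t _ _
      (is_derive_id t) D2 Rmult_comm).
    assert (DP : is_derive (fun t => - 2 * zeta 3 + PI ^ 2 / 6 * t - t ^ 2 / 2 + t ^ 3 / 12) t
      (PI ^ 2 / 6 - t + t ^ 2 / 4)).
    { auto_derive; [exact I|field]. }
    assert (DA := is_derive_minus (V := R_NormedModule) _ _ _ _ _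
      (is_derive_plus (V := R_NormedModule) _ _ _ _ _
        (is_derive_plus (V := R_NormedModule) _ _ _ _ _ (is_derive_scal _ _ 2 _ D3) D2') DP)
      (is_derive_scal _ _ (4 * PI ^ 2) _ DV)).
    assert (Hfirst := first_derivative_identity t Ht).
    eapply is_derive_ext; [|evar_last; [exact DA|]].
    + intros s. unfold minus, plus, opp, mult; simpl. ring.
    + rewrite <- Hfirst. unfold minus, plus, opp, mult, one; simpl. field. lra.
  - assert (L3 := filterlim_Li_exp 3 ltac:(lia)). assert (L2 := filterlim_Li_exp 2 ltac:(lia)).
    assert (LV := filterlim_scaled sq_sum _ (is_derive_sq_sum 0 ltac:(rewrite Rabs_R0; lra)) sq_sum_0).
    assert (LP : filterlim (fun t => - 2 * zeta 3 + PI ^ 2 / 6 * t - t ^ 2 / 2 + t ^ 3 / 12)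
      (at_right 0) (locally (- 2 * zeta 3))).
    { apply filterlim_at_right_ex_derive; [field|]. auto_derive. exact I. }
    assert (LI : filterlim (fun t => t) (at_right 0) (locally 0)).
    { apply filterlim_at_right_ex_derive; [reflexivity|]. auto_derive. exact I. }
    assert (K : forall k : R, filterlim (fun _ : R => k) (at_right 0) (locally k)).
    { intros k. apply filterlim_const. }
    assert (LL := filterlim_Rplus _ _ _ _ (filterlim_Rplus _ _ _ _ (filterlim_Rplus _ _ _ _
      (filterlim_Rmult _ _ _ _ (K 2) L3) (filterlim_Rmult _ _ _ _ LI L2)) LP)
      (filterlim_Rmult _ _ _ _ (K (- 4 * PI ^ 2)) LV)).
    eapply filterlim_ext; [|].
    2:{ replace 0 with (2 * zeta 3 + 0 * zeta 2 + - 2 * zeta 3 + - 4 * PI ^ 2 * 0) at 2 by ring.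
        exact LL. }
    intros s. cbv beta. ring.
Qed.

(** * Continuation to the closed disk *)

Ltac Cderive_tac :=
  repeat lazymatch goal with
  | |- is_derive (fun w => Cminus (@?f w) (@?g w)) _ _ => apply (is_Cderive_minus f g)
  | |- is_derive (fun w => Cplus (@?f w) (@?g w)) _ _ => apply (is_Cderive_plus f g)
  | |- is_derive (fun w => Cmult (@?f w) (@?g w)) _ _ => apply (is_Cderive_mult f g)
  | |- is_derive (fun w => w) _ _ => apply is_Cderive_id
  | |- _ => first [eassumption | apply is_Cderive_const]
  end.

(** [exp (2 pi z)] is positive real only if [Im z] is an integer, which the bound on [Im z]
    restricts to 0. *)
Lemma cexp_on_cut (z : C) : Rabs (Im z) < 1 -> on_cut (cexp (2 * RtoC PI * z)) ->
  Im z = 0 /\ 0 <= Re z.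
Proof.
  intros Hz [Hi Hr]. assert (HPI := PI_RGT_0).
  destruct z as [x y]. unfold cexp, Re, Im in *. simpl in *.
  replace ((2 * PI - 0 * 0) * x - (2 * 0 + 0 * PI) * y) with (2 * PI * x) in * by ring.
  replace ((2 * PI - 0 * 0) * y + (2 * 0 + 0 * PI) * x) with (2 * (PI * y)) in * by ring.
  assert (He := exp_pos (2 * PI * x)).
  assert (Hsin : sin (2 * (PI * y)) = 0) by nra.
  assert (Hcos : 0 < cos (2 * (PI * y))) by nra.
  assert (Hc1 : cos (2 * (PI * y)) = 1).
  { assert (H := sin2_cos2 (2 * (PI * y))). rewrite Hsin in H. unfold Rsqr in H. nra. }
  (* Passing to the half angle brings the argument into [(- pi, pi)], where 0 is the single zero of
     the sine. *)
  assert (Hs0 : sin (PI * y) = 0).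
  { rewrite cos_2a_sin in Hc1. nra. }
  apply Rabs_def2 in Hz.
  assert (Hy : y = 0).
  { destruct (Rtotal_order y 0) as [H|[H|H]]; [exfalso|exact H|exfalso].
    - assert (H1 := sin_gt_0 (PI * - y)). rewrite <- Ropp_mult_distr_r, sin_neg in H1. nra.
    - assert (H1 := sin_gt_0 (PI * y)). nra. }
  split; [exact Hy|]. apply Rnot_lt_le. intros Hx.
  assert (exp (2 * PI * x) < 1) by (rewrite <- exp_0; apply exp_increasing; nra).
  rewrite Hc1 in Hr. lra.
Qed.

Lemma polylog_RtoC (s : nat) (L : C -> C) (x : R) : is_polylog s L -> Rabs x < 1 ->
  L (RtoC x) = RtoC (Li s x).
Proof.
  intros [HL _] Hx.
  apply (is_Cseries_unique (fun k => RtoC x ^ S k / RtoC (INR (S k) ^ s))%C).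
  - apply HL. rewrite Cmod_R. lra.
  - eapply is_series_ext; [|exact (is_Cseries_RtoC _ _ (is_series_Li s x Hx))].
    intros n. cbv beta. rewrite RtoC_mult, RtoC_inv, <- RtoC_pow.
    + apply Cmult_comm.
    + apply pow_nonzero. assert (H := lt_0_INR (S n) ltac:(lia)). lra.
Qed.

(** Here continuity comes from the series, dominated by that of zeta. This includes the point 1,
    which lies on the cut and is reached by [exp (2 pi z)] at [z = i] and [z = - i]. *)
Lemma polylog_continuous_disk (s : nat) (L : C -> C) {T : Type} {F : (T -> Prop) -> Prop}
    {FF : Filter F} (p : T -> C) (x : C) :
  (2 <= s)%nat -> is_polylog s L -> Cmod x <= 1 -> filterlim p F (locally x) ->
  F (fun t => Cmod (p t) <= 1) -> filterlim (fun t => L (p t)) F (locally (L x)).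
Proof.
  intros Hs [HL _] Hx Hp HF.
  assert (Hk : forall k, 0 < INR (S k) ^ s).
  { intros k. apply pow_lt, lt_0_INR. lia. }
  apply (Tannery (K := C_AbsRing) (V := C_NormedModule)
    (fun k t => p t ^ S k / RtoC (INR (S k) ^ s))%C (fun k => x ^ S k / RtoC (INR (S k) ^ s))%C
    (fun k => / INR (S k) ^ s)).
  - now apply ex_series_zeta.
  - intros k. apply (filterlim_comp _ _ _ p (fun w => w ^ S k / RtoC (INR (S k) ^ s))%C _ _ _ Hp).
    apply (is_Cderive_continuous (fun w => w ^ S k * / RtoC (INR (S k) ^ s))%C x
      (RtoC (INR (S k)) * x ^ pred (S k) * / RtoC (INR (S k) ^ s) + x ^ S k * RtoC 0)%C).
    apply (is_Cderive_mult (fun w => w ^ S k)%C (fun _ => / RtoC (INR (S k) ^ s))%C x).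
    + apply (is_Cderive_pow (S k)).
    + apply is_Cderive_const.
  - revert HF. apply filter_imp. intros t Ht. split; [|now apply HL].
    intros k. specialize (Hk k).
    change (Cmod (p t ^ S k / RtoC (INR (S k) ^ s))%C <= / INR (S k) ^ s).
    rewrite Cmod_div, Cmod_pow, Cmod_R, Rabs_pos_eq by (lra || (intros E; apply RtoC_inj in E; lra)).
    rewrite <- (Rmult_1_l (/ _)). apply Rmult_le_compat_r; [left; now apply Rinv_0_lt_compat|].
    rewrite <- (pow1 (S k)). apply pow_incr. split; [apply Cmod_ge_0|exact Ht].
  - now apply HL.
Qed.

(* [(2 pi z)^2] times the difference of the two sides of the theorem. *)
Definition defect (Li2 Li3 : C -> C) (z : C) : C :=
  (2 * Li3 (cexp (2 * RtoC PI * z)) - 2 * RtoC PI * z * Li2 (cexp (2 * RtoC PI * z))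
   - (2 * RtoC (zeta 3) + RtoC (PI ^ 3 / 3) * z + RtoC (2 * PI ^ 2) * (z * z)
      + RtoC (2 * PI ^ 3 / 3) * (z * (z * z)))
   - RtoC (4 * PI ^ 2) * (z * z) * thm14_sum z)%C.

Lemma defect_negative_real (Li2 Li3 : C -> C) (y : R) : is_polylog 2 Li2 -> is_polylog 3 Li3 ->
  0 < y < 1 -> defect Li2 Li3 (RtoC (- y)) = RtoC 0.
Proof.
  intros H2 H3 Hy. assert (HPI := PI_RGT_0).
  set (t := 2 * PI * y).
  assert (Ht : 0 < t < 2 * PI) by (unfold t; split; nra).
  assert (He := exp_neg_bounds t (proj1 Ht)).
  assert (Ex : cexp (2 * RtoC PI * RtoC (- y)) = RtoC (exp (- t))).
  { unfold cexp; simpl.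
    replace ((2 * PI - 0 * 0) * - y - (2 * 0 + 0 * PI) * 0) with (- t) by (unfold t; ring).
    replace ((2 * PI - 0 * 0) * 0 + (2 * 0 + 0 * PI) * - y) with 0 by ring.
    rewrite cos_0, sin_0. apply injective_projections; simpl; ring. }
  unfold defect. rewrite Ex.
  rewrite (polylog_RtoC 2 Li2), (polylog_RtoC 3 Li3) by (trivial; rewrite Rabs_pos_eq; lra).
  assert (Hsum : (RtoC (y * y) * thm14_sum (RtoC (- y)))%C = RtoC (sq_sum y)).
  { apply (is_Cseries_unique (fun n => RtoC (coef n * y ^ S (S (2 * S n))))).
    2:{ apply is_Cseries_RtoC. apply is_series_sq_sum. rewrite Rabs_pos_eq; lra. }
    assert (H := thm14_sum_correct (RtoC (- y))
      ltac:(rewrite Cmod_R, Rabs_Ropp, Rabs_pos_eq; lra)).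
    apply (is_Cseries_mult_r _ _ (RtoC (y * y))) in H. rewrite Cmult_comm.
    eapply is_series_ext; [|exact H]. intros n. cbv beta.
    rewrite thm14_term_coef, <- RtoC_pow, <- !RtoC_mult. f_equal.
    rewrite !pow_mult. replace ((- y) ^ 2) with (y ^ 2) by ring.
    rewrite <- pow_mult. simpl pow. ring. }
  assert (HR := real_identity t Ht).
  replace (t / (2 * PI)) with y in HR by (unfold t; field; lra).
  transitivity (2 * RtoC (Li 3 (exp (- t))) - 2 * RtoC PI * RtoC (- y) * RtoC (Li 2 (exp (- t)))
   - (2 * RtoC (zeta 3) + RtoC (PI ^ 3 / 3) * RtoC (- y) + RtoC (2 * PI ^ 2) * (RtoC (- y) * RtoC (- y))
      + RtoC (2 * PI ^ 3 / 3) * (RtoC (- y) * (RtoC (- y) * RtoC (- y))))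
   - RtoC (4 * PI ^ 2) * (RtoC (y * y) * thm14_sum (RtoC (- y))))%C.
  { rewrite (RtoC_mult y y), (RtoC_opp y). ring. }
  rewrite Hsum. unfold t in HR |- *. revert HR.
  generalize (Li 3 (exp (- (2 * PI * y)))) (Li 2 (exp (- (2 * PI * y)))) (zeta 3) (sq_sum y).
  intros l3 l2 z3 v HR.
  transitivity (RtoC (2 * l3 + 2 * PI * y * l2 - 2 * z3 + PI ^ 2 / 6 * (2 * PI * y)
    - (2 * PI * y) ^ 2 / 2 + (2 * PI * y) ^ 3 / 12 - 4 * PI ^ 2 * v)).
  - apply injective_projections; simpl; field.
  - f_equal. lra.
Qed.

Lemma ex_derive_defect (Li2 Li3 : C -> C) (z : C) : is_polylog 2 Li2 -> is_polylog 3 Li3 ->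
  Cmod z < 1 -> ~ (Im z = 0 /\ 0 <= Re z) -> exists l, is_Cderive (defect Li2 Li3) z l.
Proof.
  intros H2 H3 Hz Hcut.
  assert (Hc : ~ on_cut (cexp (2 * RtoC PI * z))).
  { intros H. apply Hcut. apply cexp_on_cut; [|exact H].
    eapply Rle_lt_trans; [apply im_le_Cmod|exact Hz]. }
  destruct (proj1 (proj2 H2) _ Hc) as [l2 D2]. destruct (proj1 (proj2 H3) _ Hc) as [l3 D3].
  destruct (ex_derive_thm14_sum z Hz) as [ls Ds].
  assert (Di := is_Cderive_id z).
  assert (De : exists l, is_Cderive (fun w => cexp (2 * RtoC PI * w))%C z l).
  { eexists. apply (is_Cderive_comp cexp (fun w => 2 * RtoC PI * w)%C); [apply is_Cderive_cexp|].
    apply is_Cderive_mult; [apply is_Cderive_const|exact Di]. }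
  destruct De as [e De].
  assert (E2 := is_Cderive_comp Li2 (fun w => cexp (2 * RtoC PI * w))%C z _ _ D2 De).
  assert (E3 := is_Cderive_comp Li3 (fun w => cexp (2 * RtoC PI * w))%C z _ _ D3 De).
  eexists. unfold defect. Cderive_tac.
Qed.

(** Polar coordinates measured from the negative axis: the right side is [- |z| exp (- i sg u)],
    with [u] the angle to that axis and [sg] the sign of the imaginary part. *)
Lemma neg_cexp_polar (sg : R) (z : C) : (sg = 1 \/ sg = -1) -> 0 < sg * Im z ->
  exists u, 0 < u < PI /\
    z = (- cexp (- RtoC sg * Ci * (u, (sg * ln (Cmod z))%R)))%C.
Proof.
  intros Hsg Him. assert (HPI := PI_RGT_0).
  destruct z as [x y]. simpl in Him.
  assert (Hm : 0 < Cmod (x, y)).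
  { apply Cmod_gt_0. intros E. injection E. intros -> ->. lra. }
  assert (Hm2 := Cmod_sqr (x, y)). simpl Re in Hm2. simpl Im in Hm2.
  set (m := Cmod (x, y)) in *.
  assert (Hsg2 : sg * sg = 1) by (destruct Hsg as [-> | ->]; ring).
  assert (Hy2 : 0 < y ^ 2) by (assert (y <> 0) by (intros E; rewrite E in Him; lra); nra).
  assert (Hx : -1 < - x / m < 1).
  { assert (H : -m < - x < m) by nra. unfold Rdiv.
    assert (Hi : 0 < / m) by now apply Rinv_0_lt_compat.
    assert (m * / m = 1) by (apply Rinv_r; lra). nra. }
  exists (acos (- x / m)).
  assert (Ha := acos_bound_lt (- x / m) Hx).
  split; [exact Ha|].
  unfold cexp; simpl.
  replace ((- sg * 0 - - 0 * 1) * acos (- x / m) - (- sg * 1 + - 0 * 0) * (sg * ln m))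
    with (sg * sg * ln m) by ring.
  replace ((- sg * 0 - - 0 * 1) * (sg * ln m) + (- sg * 1 + - 0 * 0) * acos (- x / m))
    with (- (sg * acos (- x / m))) by ring.
  rewrite Hsg2, Rmult_1_l, exp_ln by exact Hm. rewrite cos_neg, sin_neg.
  assert (Hcos : cos (acos (- x / m)) = - x / m) by (apply cos_acos; lra).
  assert (Hsin : sin (acos (- x / m)) = sg * y / m).
  { rewrite sin_acos by lra.
    replace (1 - (- x / m)²) with ((sg * y / m) ^ 2).
    - apply sqrt_pow2. apply Rdiv_le_0_compat; lra.
    - replace ((sg * y / m) ^ 2) with (sg * sg * y ^ 2 / m ^ 2) by (field; lra).
      rewrite Hsg2. unfold Rsqr. replace (y ^ 2) with (m ^ 2 - x ^ 2) by lra. field. lra. }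
  assert (Hcs : cos (sg * acos (- x / m)) = - x / m).
  { destruct Hsg as [-> | ->]; [now rewrite Rmult_1_l|].
    replace (-1 * acos (- x / m)) with (- acos (- x / m)) by ring. now rewrite cos_neg. }
  assert (Hsn : sin (sg * acos (- x / m)) = y / m).
  { destruct Hsg as [-> | ->].
    - rewrite Rmult_1_l, Hsin. field. lra.
    - replace (-1 * acos (- x / m)) with (- acos (- x / m)) by ring. rewrite sin_neg, Hsin. field. lra. }
  rewrite Hcs, Hsn. apply injective_projections; simpl; field; lra.
Qed.

(* The change of variable [z = - exp (-+ i w)] maps the imaginary axis to the negative reals
   and a horizontal strip of width [pi] to the upper (lower) half of the disk. *)
Lemma defect_half_disk (Li2 Li3 : C -> C) (z : C) : is_polylog 2 Li2 -> is_polylog 3 Li3 ->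
  Cmod z < 1 -> Im z <> 0 -> defect Li2 Li3 z = RtoC 0.
Proof.
  intros H2 H3 Hz Hi. assert (HPI := PI_RGT_0).
  assert (Hsg : exists sg, (sg = 1 \/ sg = -1) /\ 0 < sg * Im z).
  { destruct (Rtotal_order (Im z) 0) as [H|[H|H]]; [|lra|].
    - exists (-1). split; [now right|lra].
    - exists 1. split; [now left|lra]. }
  destruct Hsg as [sg [Hsg Him]].
  destruct (neg_cexp_polar sg z Hsg Him) as [u [Hu Ez]].
  assert (Hm : 0 < Cmod z).
  { apply Cmod_gt_0. intros E. apply Hi. now rewrite E. }
  assert (Hln : ln (Cmod z) < 0) by (rewrite <- ln_1; now apply ln_increasing).
  set (phi := fun w : C => (- cexp (- RtoC sg * Ci * w))%C).
  assert (Ephi : forall x y, phi (x, y) = (- (exp (sg * y) * cos (sg * x)), exp (sg * y) * sin (sg * x))).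
  { intros x y. unfold phi, cexp; simpl.
    replace ((- sg * 0 - - 0 * 1) * x - (- sg * 1 + - 0 * 0) * y) with (sg * y) by ring.
    replace ((- sg * 0 - - 0 * 1) * y + (- sg * 1 + - 0 * 0) * x) with (- (sg * x)) by ring.
    rewrite cos_neg, sin_neg. apply injective_projections; simpl; ring. }
  assert (Hphi_mod : forall x y, Cmod (phi (x, y)) = exp (sg * y)).
  { intros x y. unfold phi. rewrite Cmod_opp, Cmod_cexp. f_equal. simpl. ring. }
  (* [sg * y < 0] means [|phi| < 1]; the margin of 1 past [ln |z|] puts the point inside an open
     interval. *)
  assert (Hbox : exists A1 A2, A1 < sg * ln (Cmod z) < A2 /\
    forall y, A1 < y < A2 -> sg * y < 0).
  { destruct Hsg as [-> | ->].
    - exists (ln (Cmod z) - 1), 0. split; [lra|]. intros y Hy. lra.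
    - exists 0, (- ln (Cmod z) + 1). split; [lra|]. intros y Hy. lra. }
  destruct Hbox as [A1 [A2 [HA Hneg]]].
  assert (Hsin0 : forall x, - PI < x < PI -> sin (sg * x) = 0 -> x = 0).
  { intros x Hx Hs.
    assert (Hs1 : sin x = 0).
    { destruct Hsg as [-> | ->]; [now rewrite Rmult_1_l in Hs|].
      replace (-1 * x) with (- x) in Hs by ring. rewrite sin_neg in Hs. lra. }
    destruct (Rtotal_order x 0) as [H|[H|H]]; [exfalso|exact H|exfalso].
    - assert (S1 := sin_gt_0 (- x)). rewrite sin_neg in S1. lra.
    - assert (S1 := sin_gt_0 x). lra. }
  rewrite Ez. change (defect Li2 Li3 (phi (u, sg * ln (Cmod z))) = RtoC 0).
  (* With half-width [PI] the box corresponds to an annulus slit along the positive axis, which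
     [phi] would meet at abscissas [PI] and [- PI]. *)
  apply (holomorphic_zero_on_axis (fun w => defect Li2 Li3 (phi w)) PI A1 A2); [| |lra|exact HA].
  - intros [x y] [Hx Hy]. simpl in Hx, Hy. specialize (Hneg y Hy).
    assert (He1 : exp (sg * y) < 1) by (rewrite <- exp_0; now apply exp_increasing).
    destruct (ex_derive_defect Li2 Li3 (phi (x, y)) H2 H3) as [l Hl].
    + now rewrite Hphi_mod.
    + rewrite Ephi. simpl. intros [I0 R0].
      assert (He := exp_pos (sg * y)).
      assert (x = 0) by (apply Hsin0; [exact Hx|nra]). subst x.
      rewrite Rmult_0_r, cos_0 in R0. lra.
    + eexists. apply (is_Cderive_comp (defect Li2 Li3) phi (x, y) l); [exact Hl|].
      apply is_Cderive_opp. apply (is_Cderive_comp cexp (fun w => - RtoC sg * Ci * w)%C).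
      * apply is_Cderive_cexp.
      * apply is_Cderive_mult; [apply is_Cderive_const|apply is_Cderive_id].
  - intros y Hy. specialize (Hneg y Hy). rewrite Ephi.
    rewrite Rmult_0_r, cos_0, sin_0.
    replace (- (exp (sg * y) * 1), exp (sg * y) * 0) with (RtoC (- exp (sg * y)))
      by (apply injective_projections; simpl; ring).
    apply defect_negative_real; [exact H2|exact H3|]. split; [apply exp_pos|].
    rewrite <- exp_0. now apply exp_increasing.
Qed.

(** * Limits at the boundary *)

Lemma filterlim_Cplus {T : Type} {F : (T -> Prop) -> Prop} {FF : Filter F} (f g : T -> C) (a b : C) :
  filterlim f F (locally a) -> filterlim g F (locally b) ->
  filterlim (fun x => f x + g x)%C F (locally (a + b)%C).
Proof.
  intros Hf Hg. exact (filterlim_comp_2 f g Cplus Hf Hg (filterlim_plus (V := C_NormedModule) a b)).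
Qed.

Lemma filterlim_Cmult {T : Type} {F : (T -> Prop) -> Prop} {FF : Filter F} (f g : T -> C) (a b : C) :
  filterlim f F (locally a) -> filterlim g F (locally b) ->
  filterlim (fun x => f x * g x)%C F (locally (a * b)%C).
Proof.
  intros Hf Hg.
  refine (filterlim_comp_2 f g Cmult Hf Hg _).
  intros P HP. apply locally_C in HP.
  destruct (filterlim_mult (K := C_AbsRing) a b P HP) as [Q R HQ HR H].
  exists Q R; [now apply locally_C|now apply locally_C|exact H].
Qed.

Lemma filterlim_Cderive {T : Type} {F : (T -> Prop) -> Prop} {FF : Filter F}
    (f : C -> C) (p : T -> C) (z l : C) :
  is_Cderive f z l -> filterlim p F (locally z) ->
  filterlim (fun t => f (p t)) F (locally (f z)).
Proof.
  intros Hf Hp. apply (filterlim_comp _ _ _ p f _ _ _ Hp). exact (is_Cderive_continuous f z l Hf).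
Qed.

(** Continuity of the two polylogarithms along [p] stays a hypothesis, since it has three sources:
    the series, the derivative off the cut, and the boundary value from below. *)
Lemma defect_limit (Li2 Li3 : C -> C) {T : Type} {F : (T -> Prop) -> Prop}
    {FF : ProperFilter F} (p : T -> C) (z : C) :
  Cmod z <= 1 -> filterlim p F (locally z) ->
  filterlim (fun t => Li2 (cexp (2 * RtoC PI * p t))) F (locally (Li2 (cexp (2 * RtoC PI * z)))) ->
  filterlim (fun t => Li3 (cexp (2 * RtoC PI * p t))) F (locally (Li3 (cexp (2 * RtoC PI * z)))) ->
  F (fun t => Cmod (p t) <= 1 /\ defect Li2 Li3 (p t) = RtoC 0) ->
  defect Li2 Li3 z = RtoC 0.
Proof.
  intros Hz Hp L2 L3 HF.
  assert (K : forall k : C, filterlim (fun _ : T => k) F (locally k)).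
  { intros k. apply filterlim_const. }
  assert (Opp : forall (f : T -> C) (a : C), filterlim f F (locally a) ->
    filterlim (fun t => - f t)%C F (locally (- a)%C)).
  { intros f a Hf. apply (filterlim_comp _ _ _ f Copp _ _ _ Hf).
    exact (filterlim_opp (V := C_NormedModule) a). }
  assert (LS : filterlim (fun t => thm14_sum (p t)) F (locally (thm14_sum z))).
  { apply (filterlim_comp _ _ _ p thm14_sum _ (filtermap p F)).
    - intros P HP. exact HP.
    - apply filterlim_thm14_sum; [exact Hz|exact Hp|].
      unfold filtermap. revert HF. apply filter_imp. now intros t [Ht _]. }
  assert (LD : filterlim (fun t => defect Li2 Li3 (p t)) F (locally (defect Li2 Li3 z))).
  { unfold defect, Cminus.
    repeat lazymatch goal with
    | |- filterlim (fun w => Cplus (@?f w) (@?g w)) _ _ => apply (filterlim_Cplus f g)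
    | |- filterlim (fun w => Cmult (@?f w) (@?g w)) _ _ => apply (filterlim_Cmult f g)
    | |- filterlim (fun w => Copp (@?f w)) _ _ => apply (Opp f)
    | |- _ => first [assumption | apply K]
    end. }
  apply (filterlim_locally_unique (V := C_NormedModule) _ _ _ LD).
  apply (filterlim_ext_loc (fun _ => RtoC 0)); [|apply K].
  revert HF. apply filter_imp. now intros t [_ ->].
Qed.

(** [k = 1] gives the radial approach; [k = 1 + Ci] bends it into the lower half plane when [z] is
    positive. *)
Lemma filterlim_segment (z k : C) :
  filterlim (fun s : R => z * (1 - RtoC s * k))%C (at_right 0) (locally z).
Proof.
  assert (HR : filterlim RtoC (at_right 0) (locally (RtoC 0))).
  { apply filterlim_Cmod. intros eps He. exists (mkposreal eps He). intros s Hs _.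
    rewrite <- RtoC_minus, Cmod_R. exact Hs. }
  assert (H := filterlim_Cderive (F := at_right 0) (fun w => z * (1 - w * k))%C RtoC (RtoC 0)).
  cbv beta in H. replace (z * (1 - RtoC 0 * k))%C with z in H by ring.
  eapply H; [|exact HR].
  Cderive_tac.
Qed.

Lemma filterlim_cexp_2PI {T : Type} {F : (T -> Prop) -> Prop} {FF : Filter F} (p : T -> C) (z : C) :
  filterlim p F (locally z) ->
  filterlim (fun t => cexp (2 * RtoC PI * p t)) F (locally (cexp (2 * RtoC PI * z))).
Proof.
  intros Hp. apply (filterlim_Cderive cexp (fun t => 2 * RtoC PI * p t)%C _ _ (is_Cderive_cexp _)).
  apply filterlim_Cmult; [apply filterlim_const|exact Hp].
Qed.

Lemma at_right_0_lt (d : R) (P : R -> Prop) : 0 < d -> (forall s, 0 < s < d -> P s) -> at_right 0 P.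
Proof.
  intros Hd HP. exists (mkposreal d Hd). intros s Hs Hs0.
  change (Rabs (s - 0) < d) in Hs. rewrite Rminus_0_r, Rabs_pos_eq in Hs by lra.
  apply HP. lra.
Qed.

(** The radial path serves for negative and for nonreal [z], as it remains on the negative axis or
    in one half disk. For positive [z] it would run along the cut, and an oblique path takes its
    place. *)
Lemma defect_zero (Li2 Li3 : C -> C) (z : C) : is_polylog 2 Li2 -> is_polylog 3 Li3 ->
  0 < Cmod z <= 1 -> defect Li2 Li3 z = RtoC 0.
Proof.
  intros H2 H3 Hz. assert (HPI := PI_RGT_0).
  set (p := fun s : R => (z * (1 - RtoC s * 1))%C).
  assert (Ep : forall s, p s = ((1 - s) * Re z, (1 - s) * Im z)).
  { intros s. destruct z as [x y]. unfold p. apply injective_projections; simpl; ring. }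
  assert (Hp := filterlim_segment z (RtoC 1) : filterlim p (at_right 0) (locally z)).
  assert (Hpm : forall s, 0 < s < 1 -> Cmod (p s) < 1).
  { intros s Hs. unfold p. replace (1 - RtoC s * 1)%C with (RtoC (1 - s)) by (rewrite RtoC_minus; ring).
    rewrite Cmod_mult, Cmod_R, Rabs_pos_eq by lra. nra. }
  destruct (Req_dec (Im z) 0) as [Hi|Hi].
  - destruct (Rle_or_lt (Re z) 0) as [Hr|Hr].
    + assert (Ez : z = RtoC (Re z)) by (apply injective_projections; [reflexivity|exact Hi]).
      assert (Hneg : Re z < 0).
      { destruct Hr as [Hr|Hr]; [exact Hr|]. rewrite Ez, Hr, Cmod_0 in Hz. lra. }
      assert (Hx : forall w, Re w <= 0 -> Cmod (cexp (2 * RtoC PI * w)) <= 1).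
      { intros w Hw. rewrite Cmod_cexp, <- exp_0. replace (Re (2 * RtoC PI * w)) with (2 * PI * Re w)
          by (destruct w; simpl; ring).
        assert (2 * PI * Re w <= 0) by nra.
        destruct H as [H|H]; [left; now apply exp_increasing|right; now rewrite H]. }
      apply (defect_limit Li2 Li3 (F := at_right 0) p); [lra|exact Hp| | |].
      * apply (polylog_continuous_disk 2 Li2 (F := at_right 0) (fun s => cexp (2 * RtoC PI * p s))%C); [lia|exact H2|apply Hx; lra|now apply filterlim_cexp_2PI|].
        apply (at_right_0_lt 1); [lra|]. intros s Hs. apply Hx. rewrite Ep. simpl. nra.
      * apply (polylog_continuous_disk 3 Li3 (F := at_right 0) (fun s => cexp (2 * RtoC PI * p s))%C); [lia|exact H3|apply Hx; lra|now apply filterlim_cexp_2PI|].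
        apply (at_right_0_lt 1); [lra|]. intros s Hs. apply Hx. rewrite Ep. simpl. nra.
      * apply (at_right_0_lt 1); [lra|]. intros s Hs. split; [left; now apply Hpm|].
        replace (p s) with (RtoC (- ((1 - s) * - Re z))).
        -- apply defect_negative_real; [exact H2|exact H3|].
           assert (H := re_le_Cmod z). rewrite Rabs_left in H by exact Hneg. split; nra.
        -- rewrite Ep, Hi. apply injective_projections; simpl; ring.
    + (* On the cut, the convention selects the limit from [Im z < 0]. *)
      assert (Ez : z = RtoC (Re z)) by (apply injective_projections; [reflexivity|exact Hi]).
      set (x := Re z) in *.
      assert (Hx1 : x <= 1) by (assert (H := re_le_Cmod z); fold x in H; rewrite Rabs_pos_eq in H; lra).
      set (q := fun s : R => (z * (1 - RtoC s * (1 + Ci)))%C).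
      assert (Eq : forall s, q s = ((1 - s) * x, - (s * x))).
      { intros s. unfold q. rewrite Ez. apply injective_projections; simpl; ring. }
      assert (Hq := filterlim_segment z (1 + Ci)%C : filterlim q (at_right 0) (locally z)).
      assert (Hqm : forall s, 0 < s < 1 / 2 -> Cmod (q s) < 1).
      { intros s Hs. apply Rsqr_incrst_0; [|apply Cmod_ge_0|lra].
        replace ((Cmod (q s))²) with (Cmod (q s) ^ 2) by (unfold Rsqr; ring).
        rewrite Cmod_sqr, Eq. simpl. unfold Rsqr.
        assert (Hxx : x * x <= 1) by nra.
        assert (Hss : (1 - s) * (1 - s) + s * s < 1) by nra.
        assert (0 <= (1 - s) * (1 - s) + s * s) by nra. nra. }
      assert (Hside : filterlim (fun s => cexp (2 * RtoC PI * q s)) (at_right 0)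
        (within (fun w : C => Im w < 0) (locally (cexp (2 * RtoC PI * z))))).
      { assert (Hl := filterlim_cexp_2PI q z Hq).
        intros P HP. unfold within in HP. specialize (Hl _ HP).
        (* For [s < 1 / 2] the angle [2 pi s x] lies in [(0, pi)], so the exponential comes to the
           cut from below. *)
        assert (Hlow : at_right 0 (fun s => Im (cexp (2 * RtoC PI * q s)) < 0)).
        { apply (at_right_0_lt (1 / 2)); [lra|]. intros s Hs. rewrite Eq. unfold cexp; simpl.
          replace ((2 * PI - 0 * 0) * - (s * x) + (2 * 0 + 0 * PI) * ((1 - s) * x))
            with (- (2 * PI * (s * x))) by ring.
          rewrite sin_neg.
          assert (Hsx : 0 < s * x < 1 / 2) by (split; nra).
          assert (0 < sin (2 * PI * (s * x))) by (apply sin_gt_0; nra).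
          match goal with |- exp ?A * _ < 0 => assert (0 < exp A) by apply exp_pos end. nra. }
        unfold filtermap in Hl |- *.
        generalize (filter_and _ _ Hl Hlow). apply filter_imp. intros s [HA HB]. exact (HA HB). }
      assert (Him : Im (cexp (2 * RtoC PI * z)) = 0).
      { rewrite Ez. unfold cexp; simpl.
        replace ((2 * PI - 0 * 0) * 0 + (2 * 0 + 0 * PI) * x) with 0 by ring. rewrite sin_0. ring. }
      assert (Hre : 1 < Re (cexp (2 * RtoC PI * z))).
      { rewrite Ez. unfold cexp; simpl.
        replace ((2 * PI - 0 * 0) * 0 + (2 * 0 + 0 * PI) * x) with 0 by ring. rewrite cos_0.
        replace ((2 * PI - 0 * 0) * x - (2 * 0 + 0 * PI) * 0) with (2 * PI * x) by ring.
        rewrite Rmult_1_r, <- exp_0. apply exp_increasing. nra. }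
      apply (defect_limit Li2 Li3 (F := at_right 0) q); [lra|exact Hq| | |].
      * exact (filterlim_comp _ _ _ _ _ _ _ _ Hside (proj2 (proj2 H2) _ Him Hre)).
      * exact (filterlim_comp _ _ _ _ _ _ _ _ Hside (proj2 (proj2 H3) _ Him Hre)).
      * apply (at_right_0_lt (1 / 2)); [lra|]. intros s Hs. split; [left; now apply Hqm|].
        apply defect_half_disk; [exact H2|exact H3|now apply Hqm|]. rewrite Eq. simpl. nra.
  - assert (Hzero : at_right 0 (fun s => Cmod (p s) <= 1 /\ defect Li2 Li3 (p s) = RtoC 0)).
    { apply (at_right_0_lt 1); [lra|]. intros s Hs. split; [left; now apply Hpm|].
      apply defect_half_disk; [exact H2|exact H3|now apply Hpm|]. rewrite Ep. simpl. nra. }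
    assert (Hl := filterlim_cexp_2PI p z Hp).
    destruct (Rle_or_lt (Re z) 0) as [Hr|Hr].
    + assert (Hx : forall w, Re w <= 0 -> Cmod (cexp (2 * RtoC PI * w)) <= 1).
      { intros w Hw. rewrite Cmod_cexp, <- exp_0. replace (Re (2 * RtoC PI * w)) with (2 * PI * Re w)
          by (destruct w; simpl; ring).
        assert (2 * PI * Re w <= 0) by nra.
        destruct H as [H|H]; [left; now apply exp_increasing|right; now rewrite H]. }
      assert (Hps : at_right 0 (fun s => Cmod (cexp (2 * RtoC PI * p s)) <= 1)).
      { apply (at_right_0_lt 1); [lra|]. intros s Hs. apply Hx. rewrite Ep. simpl. nra. }
      apply (defect_limit Li2 Li3 (F := at_right 0) p); [lra|exact Hp| | |exact Hzero].
      * apply (polylog_continuous_disk 2 Li2 (F := at_right 0) (fun s => cexp (2 * RtoC PI * p s))%C); [lia|exact H2|now apply Hx|exact Hl|exact Hps].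
      * apply (polylog_continuous_disk 3 Li3 (F := at_right 0) (fun s => cexp (2 * RtoC PI * p s))%C); [lia|exact H3|now apply Hx|exact Hl|exact Hps].
    (* On the closed disk [Re z > 0] forces [|Im z| < 1], so [exp (2 pi z)] avoids the cut; [z = i]
       and [z = - i] fell under the preceding case. *)
    + assert (Hy1 : Rabs (Im z) < 1).
      { assert (H := Cmod_sqr z). assert (Cmod z ^ 2 <= 1) by nra.
        apply Rabs_def1; nra. }
      assert (Hc : ~ on_cut (cexp (2 * RtoC PI * z))).
      { intros H. apply Hi. now apply cexp_on_cut. }
      destruct (proj1 (proj2 H2) _ Hc) as [l2 D2]. destruct (proj1 (proj2 H3) _ Hc) as [l3 D3].
      apply (defect_limit Li2 Li3 (F := at_right 0) p); [lra|exact Hp| | |exact Hzero].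
      * exact (filterlim_Cderive Li2 _ _ _ D2 Hl).
      * exact (filterlim_Cderive Li3 _ _ _ D3 Hl).
Qed.

Theorem theorem14 (Li2 Li3 : C -> C) (z : C) :
  is_polylog 2 Li2 -> is_polylog 3 Li3 ->
  0 < Cmod z -> Cmod z <= 1 ->
  is_series (fun n : nat => thm14_term z (S n))
    (- RtoC (1 / 2) - RtoC PI * z / 6 - RtoC PI / (12 * z)
     - RtoC (zeta 3) / (2 * RtoC PI ^ 2 * z ^ 2)
     + Li3 (cexp (2 * RtoC PI * z)) / (2 * RtoC PI ^ 2 * z ^ 2)
     - Li2 (cexp (2 * RtoC PI * z)) / (2 * RtoC PI * z))%C.
Proof.
  intros H2 H3 Hz Hz1. assert (HPI := PI_RGT_0).
  assert (Hd := defect_zero Li2 Li3 z H2 H3 (conj Hz Hz1)).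
  assert (Hz0 : z <> RtoC 0) by now apply Cmod_gt_0.
  assert (HP0 : RtoC PI <> RtoC 0) by (intros E; apply RtoC_inj in E; lra).
  evar_last; [exact (thm14_sum_correct z Hz1)|].
  unfold defect in Hd.
  set (A := Li3 _) in *. set (B := Li2 _) in *. set (s := thm14_sum z) in *.
  assert (E1 : RtoC (PI ^ 3 / 3) = (RtoC PI ^ 3 / 3)%C) by (rewrite RtoC_div, RtoC_pow by lra; reflexivity).
  assert (E2 : RtoC (2 * PI ^ 2) = (2 * RtoC PI ^ 2)%C) by (rewrite RtoC_mult, RtoC_pow; reflexivity).
  assert (E3 : RtoC (2 * PI ^ 3 / 3) = (2 * RtoC PI ^ 3 / 3)%C)
    by (rewrite RtoC_div, RtoC_mult, RtoC_pow by lra; reflexivity).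
  assert (E4 : RtoC (4 * PI ^ 2) = (4 * RtoC PI ^ 2)%C) by (rewrite RtoC_mult, RtoC_pow; reflexivity).
  assert (E5 : RtoC (1 / 2) = (1 / 2)%C) by (rewrite RtoC_div by lra; reflexivity).
  rewrite E1, E2, E3, E4 in Hd. rewrite E5.
  assert (HN : forall r : R, r <> 0 -> RtoC r <> RtoC 0) by (intros r Hr E; apply Hr; now apply RtoC_inj).
  assert (Es : s = ((2 * A - 2 * RtoC PI * z * B
    - (2 * RtoC (zeta 3) + RtoC PI ^ 3 / 3 * z + 2 * RtoC PI ^ 2 * (z * z)
       + 2 * RtoC PI ^ 3 / 3 * (z * (z * z)))) / (4 * RtoC PI ^ 2 * (z * z)))%C).
  { assert (HD : (4 * RtoC PI ^ 2 * (z * z))%C <> RtoC 0).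
    { repeat apply Cmult_neq_0; trivial; apply HN; lra. }
    set (X := (2 * A - 2 * RtoC PI * z * B
    - (2 * RtoC (zeta 3) + RtoC PI ^ 3 / 3 * z + 2 * RtoC PI ^ 2 * (z * z)
       + 2 * RtoC PI ^ 3 / 3 * (z * (z * z))))%C) in *.
    assert (EX : X = (4 * RtoC PI ^ 2 * (z * z) * s)%C) by now apply Ceq_minus.
    rewrite EX. field. repeat split; trivial; apply HN; lra. }
  change (@eq C s (- (1 / 2) - RtoC PI * z / 6 - RtoC PI / (12 * z)
     - RtoC (zeta 3) / (2 * RtoC PI ^ 2 * z ^ 2) + A / (2 * RtoC PI ^ 2 * z ^ 2)
     - B / (2 * RtoC PI * z))%C).
  rewrite Es. field. repeat split; trivial; apply HN; lra.
Qed.
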